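(* Let $T:\widetilde{\mathcal{W}}\to\mathbb{R}$ be a bounded continuous function on the metric space $(\widetilde{\mathcal{W}},\delta_\Box)$. For each $n\ge1$ let $G_n$ be a random element of $\mathcal{G}_n$ with $$\mathbb{P}(G_n=G)=e^{n^2(T(\widetilde{G})-\psi_n)},\qquad G\in\mathcal{G}_n,$$ where $\psi_n=\frac{1}{n^2}\log\sum_{G\in\mathcal{G}_n}e^{n^2T(\widetilde{G})}$. Let $\widetilde{F}^*\subseteq\widetilde{\mathcal{W}}$ be the set of points at which $T(\widetilde{h})-I(\widetilde{h})$ attains its maximum over $\widetilde{\mathcal{W}}$. Then for any $\eta>0$ there exist $C,\gamma>0$ such that for any $n$, $$\mathbb{P}\bigl(\delta_\Box(\widetilde{G}_n,\widetilde{F}^* )>\eta\bigr)\le Ce^{-n^2\gamma}.$$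
   Context: $\mathcal{G}_n$ is the set of all simple graphs (undirected, no loops, no multiple edges) on the vertex set $\{1,\dots,n\}$. $\mathcal{W}$ is the set of all measurable functions $h:[0,1]^2\to[0,1]$ with $h(x,y)=h(y,x)$. The cut distance on $\mathcal{W}$ is $d_\Box(f,g)=\sup_{S,A\subseteq[0,1]}\left|\int_{S\times A}[f(x,y)-g(x,y)]\,dx\,dy\right|$ (supremum over measurable sets). Let $\Sigma$ be the set of measure-preserving bijections $\sigma:[0,1]\to[0,1]$ and write $g_\sigma(x,y)=g(\sigma x,\sigma y)$. For $g\in\mathcal{W}$, $\widetilde{g}$ denotes the closure in $(\mathcal{W},d_\Box)$ of the orbit $\{g_\sigma:\sigma\in\Sigma\}$; $\widetilde{\mathcal{W}}$ is the resulting quotient space, with metric $\delta_\Box(\widetilde{f},\widetilde{g})=\inf_{\sigma\in\Sigma}d_\Box(f,g_\sigma)$. The space $\widetilde{\mathcal{W}}$ is known to be compact. For a set $\widetilde{F}$, $\delta_\Box(\widetilde{h},\widetilde{F})=\inf_{\widetilde{f}\in\widetilde{F}}\delta_\Box(\widetilde{h},\widetilde{f})$. For a simple graph $G$ on $\{1,\dots,n\}$, $f^G\in\mathcal{W}$ is defined by $f^G(x,y)=1$ if $(\lceil nx\rceil,\lceil ny\rceil)$ is an edge of $G$ and $f^G(x,y)=0$ otherwise; $\widetilde{G}:=\widetilde{f^G}\in\widetilde{\mathcal{W}}$. For $u\in[0,1]$, $I(u)=\frac12u\log u+\frac12(1-u)\log(1-u)$ (with $0\log 0=0$), and $I(\widetilde{h})=\iint_{[0,1]^2}I(h(x,y))\,dx\,dy$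 where $h$ is any representative of $\widetilde{h}$; this is known to be well defined and lower semicontinuous on $\widetilde{\mathcal{W}}$. Consequently $\widetilde{F}^*$ is a nonempty compact set. *)

(* Defs.v *)
From HB Require Import structures.
From mathcomp Require Import all_boot all_order all_algebra.
From mathcomp Require Import all_classical all_reals all_analysis.
From mathcomp Require Import measurable_realfun lra.

Set Implicit Arguments.
Unset Strict Implicit.
Unset Printing Implicit Defensive.

Import Order.TTheory GRing.Theory Num.Theory.
Import numFieldNormedType.Exports.

Local Open Scope classical_set_scope.
Local Open Scope ring_scope.

Definition unit_itv {R : realType} : set (measurableTypeR R) :=
  [set` `[0 : R, 1 : R]].
Definition unit_square {R : realType} :
    set (measurableTypeR R * measurableTypeR R) :=
  unit_itv `*` unit_itv.
Arguments unit_itv : simpl never.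
Arguments unit_square : simpl never.

Notation leb2 R := (@lebesgue_measure R \x @lebesgue_measure R)%E.

(** The values outside [unit_square] are irrelevant: every notion below only
    looks at [gfun] on the square.  Measurability is Borel measurability; a
    Lebesgue measurable graphon is almost everywhere equal to a Borel one, so
    the space of classes [wgraphon] below is the same. *)
Record graphon (R : realType) := Graphon {
  gfun :> measurableTypeR R * measurableTypeR R -> R ;
  gfun_meas : measurable_fun unit_square gfun ;
  gfun_sym : forall x y, unit_itv x -> unit_itv y -> gfun (x, y) = gfun (y, x) ;
  gfun_range : forall z, unit_square z -> 0 <= gfun z <= 1 }.

(** Automorphisms of [0,1] as a measure space: bijections [s] such that [s] and
    its inverse are measurable and preserve Lebesgue measure (preservation by
    the inverse follows from [mpb_meas_image] and [mpb_preserve]).  By the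
    Lusin-Souslin theorem, [mpb_meas_image] excludes no measure-preserving
    Borel bijection. *)
Record mpbij (R : realType) := MPBij {
  mpb_fun :> measurableTypeR R -> measurableTypeR R ;
  mpb_bij : set_bij unit_itv unit_itv mpb_fun ;
  mpb_meas : measurable_fun unit_itv mpb_fun ;
  mpb_meas_image : forall A, measurable A -> A `<=` unit_itv ->
    measurable (mpb_fun @` A) ;
  mpb_preserve : forall A, measurable A -> A `<=` unit_itv ->
    lebesgue_measure (unit_itv `&` mpb_fun @^-1` A) = lebesgue_measure A }.

Definition cutdist {R : realType}
    (f g : measurableTypeR R * measurableTypeR R -> R) : R :=
  sup [set r | exists S A : set (measurableTypeR R),
    [/\ measurable S, measurable A, S `<=` unit_itv, A `<=` unit_itv &
        r = `| \int[leb2 R]_(z in S `*` A) (f z - g z) | ] ].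

Section measure_preserving.
Context {R : realType}.
Local Notation mR := (measurableTypeR R).
Implicit Types (s t : mpbij R).

Lemma measurable_unit_itv : measurable (@unit_itv R).
Proof. exact: measurable_itv. Qed.

Lemma measurable_unit_square : measurable (@unit_square R).
Proof. by apply: measurableX; exact: measurable_unit_itv. Qed.

Lemma mpb_in s x : unit_itv x -> unit_itv (s x).
Proof. by have [h _ _] := mpb_bij s; exact: h. Qed.

Lemma mpb_inj s x y : unit_itv x -> unit_itv y -> s x = s y -> x = y.
Proof.
by have [_ h _] := mpb_bij s => Ix Iy; apply: h; rewrite inE.
Qed.

Lemma mpb_surj s y : unit_itv y -> exists2 x, unit_itv x & s x = y.
Proof. by have [_ _ h] := mpb_bij s => /h. Qed.

Fact mpb_id_bij : set_bij unit_itv unit_itv (@id mR).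
Proof. by split => // x Ix; exists x. Qed.

Fact mpb_id_meas_image (A : set mR) : measurable A -> A `<=` unit_itv ->
  measurable (id @` A).
Proof. by move=> mA _; rewrite image_id. Qed.

Fact mpb_id_preserve (A : set mR) : measurable A -> A `<=` unit_itv ->
  lebesgue_measure (unit_itv `&` id @^-1` A) = lebesgue_measure A.
Proof. by move=> mA AI; rewrite setIidr. Qed.

Definition mpb_id : mpbij R :=
  MPBij mpb_id_bij (@measurable_id _ _ _) mpb_id_meas_image mpb_id_preserve.

Lemma mpb_sub_image s (A : set mR) : A `<=` unit_itv -> s @` A `<=` unit_itv.
Proof. by move=> AI _ [x Ax <-]; exact/mpb_in/AI. Qed.

Fact mpb_comp_bij s t : set_bij unit_itv unit_itv (s \o t).
Proof.
split.
- by move=> x Ix; exact/mpb_in/mpb_in.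
- move=> x y; rewrite !inE => Ix Iy /(mpb_inj (mpb_in t Ix) (mpb_in t Iy)).
  exact: mpb_inj.
- move=> z /(mpb_surj s)[y Iy <-]; have [x Ix <-] := mpb_surj t Iy.
  by exists x.
Qed.

Fact mpb_comp_meas s t : measurable_fun unit_itv (s \o t).
Proof.
apply: (measurable_comp (F := unit_itv)).
- exact: measurable_unit_itv.
- exact: mpb_sub_image.
- exact: mpb_meas.
- exact: mpb_meas.
Qed.

Fact mpb_comp_meas_image s t (A : set mR) : measurable A -> A `<=` unit_itv ->
  measurable ((s \o t) @` A).
Proof.
move=> mA AI; rewrite -image_comp.
by apply: mpb_meas_image; [exact: mpb_meas_image|exact: mpb_sub_image].
Qed.

Fact mpb_comp_preserve s t (A : set mR) : measurable A -> A `<=` unit_itv ->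
  lebesgue_measure (unit_itv `&` (s \o t) @^-1` A) = lebesgue_measure A.
Proof.
move=> mA AI; rewrite -[RHS](mpb_preserve s)// -[RHS](mpb_preserve t).
- congr lebesgue_measure; apply/seteqP; split => x /=.
    by move=> [Ix Ax]; split => //; split => //; exact: mpb_in.
  by move=> [Ix [_ Ax]]; split.
- exact: (mpb_meas s measurable_unit_itv).
- by move=> x [].
Qed.

Definition mpb_comp s t : mpbij R :=
  MPBij (mpb_comp_bij s t) (mpb_comp_meas s t) (@mpb_comp_meas_image s t)
    (@mpb_comp_preserve s t).

Lemma mpb_inv s : exists t : mpbij R,
  (forall x, unit_itv x -> s (t x) = x) /\ (forall x, unit_itv x -> t (s x) = x).
Proof.
have /choice[t tP] : forall y, exists x, unit_itv y -> unit_itv x /\ s x = y.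
  move=> y; have [Iy|nIy] := pselect (unit_itv y).
    by have [x Ix sx] := mpb_surj s Iy; exists x.
  by exists 0.
have tI y : unit_itv y -> unit_itv (t y) by move=> /tP[].
have st y : unit_itv y -> s (t y) = y by move=> /tP[].
have ts x : unit_itv x -> t (s x) = x.
  move=> Ix; apply: (@mpb_inj s); rewrite ?st//; first exact/tI/mpb_in.
  exact: mpb_in.
have imt (A : set mR) : A `<=` unit_itv -> t @` A = unit_itv `&` s @^-1` A.
  move=> AI; apply/seteqP; split => [_ [x Ax <-]|x [Ix Ax]].
    by split; [exact/tI/AI|rewrite /= st//; exact: AI].
  by exists (s x) => //; exact: ts.
have pret (A : set mR) : A `<=` unit_itv -> unit_itv `&` t @^-1` A = s @` A.
  move=> AI; apply/seteqP; split => [x [Ix Ax]|_ [x Ax <-]].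
    by exists (t x) => //; exact: st.
  by split; [exact/mpb_in/AI|rewrite /= ts//; exact: AI].
have t1 : set_bij unit_itv unit_itv t.
  split.
  - exact: tI.
  - by move=> x y; rewrite !inE => Ix Iy txy; rewrite -(st _ Ix) -(st _ Iy) txy.
  - by move=> x Ix; exists (s x); [exact: mpb_in|exact: ts].
have t2 : measurable_fun unit_itv t.
  move=> mI Y mY.
  rewrite (_ : _ `&` _ = unit_itv `&` t @^-1` (unit_itv `&` Y)); last first.
    apply/seteqP; split => x /= [Ix]; last by move=> [].
    by move=> Yx; split => //; split => //; exact: tI.
  rewrite pret; last by move=> x [].
  by apply: mpb_meas_image; [exact: measurableI|move=> x []].
have t3 (A : set mR) : measurable A -> A `<=` unit_itv -> measurable (t @` A).
  by move=> mA AI; rewrite imt//; exact: (mpb_meas s measurable_unit_itv).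
have t4 (A : set mR) : measurable A -> A `<=` unit_itv ->
    lebesgue_measure (unit_itv `&` t @^-1` A) = lebesgue_measure A.
  move=> mA AI; rewrite pret// -(@mpb_preserve _ s).
  - congr lebesgue_measure; apply/seteqP; split => [x [Ix [y Ay]]|x Ax].
      by move=> /(mpb_inj (AI _ Ay) Ix) <-.
    by split; [exact: AI|exists x].
  - exact: mpb_meas_image.
  - by move=> _ [x Ax <-]; exact/mpb_in/AI.
by exists (MPBij t1 t2 t3 t4).
Qed.

Fact measurable_mpb_pair s :
  measurable_fun unit_square (fun z : mR * mR => (s z.1, s z.2)).
Proof.
have msT : measurable_fun setT (s \_ unit_itv).
  apply/(measurable_restrictT _ _).1; first exact: measurable_unit_itv.
  exact: mpb_meas.
apply: (@eq_measurable_fun _ _ _ _ _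
  (fun z => ((s \_ unit_itv) z.1, (s \_ unit_itv) z.2))).
  by move=> [x y]; rewrite inE => -[/= Ix Iy]; rewrite !patchE !mem_set.
apply: measurable_funTS; apply: measurable_fun_pair.
- exact: (measurableT_comp msT measurable_fst).
- exact: (measurableT_comp msT measurable_snd).
Qed.

Fact gact_meas (g : graphon R) s :
  measurable_fun unit_square (fun z : mR * mR => g (s z.1, s z.2)).
Proof.
apply: (measurable_comp (F := unit_square) (g := fun z => (s z.1, s z.2))).
- exact: measurable_unit_square.
- by move=> _ [[x y] [/= Ix Iy] <-]; split; exact: mpb_in.
- exact: gfun_meas.
- exact: measurable_mpb_pair.
Qed.

Fact gact_sym (g : graphon R) s x y : unit_itv x -> unit_itv y ->
  g (s x, s y) = g (s y, s x).
Proof. by move=> Ix Iy; rewrite gfun_sym//; exact: mpb_in. Qed.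

Fact gact_range (g : graphon R) s (z : mR * mR) : unit_square z ->
  0 <= g (s z.1, s z.2) <= 1.
Proof.
by case: z => x y [/= Ix Iy]; apply: gfun_range; split; exact: mpb_in.
Qed.

Definition gact (g : graphon R) s : graphon R :=
  @Graphon R (fun z => g (s z.1, s z.2))
    (gact_meas g s) (gact_sym g s) (@gact_range g s).

End measure_preserving.

Section cut_distance.
Context {R : realType}.
Local Notation mR := (measurableTypeR R).
Implicit Types (f g h : graphon R) (s t : mpbij R).
Local Notation mu := (@lebesgue_measure R).
Local Notation mu2 := (leb2 R).

Let mI := @measurable_unit_itv R.
Let mQ := @measurable_unit_square R.

Lemma leb_unit_itv : mu unit_itv = 1%E.
Proof.
have -> := @lebesgue_measure_itv R `[0, 1].
by rewrite /= lte_fin ltr01 oppr0 adde0.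
Qed.

Lemma leb2_unit_square : mu2 unit_square = 1%E.
Proof.
by rewrite /unit_square product_measure1E//= leb_unit_itv mule1.
Qed.

Lemma sub_rect (S A : set mR) : S `<=` unit_itv -> A `<=` unit_itv ->
  S `*` A `<=` unit_square.
Proof. by move=> SI AI [x y] [/= /SI ? /AI ?]. Qed.

Lemma integrable_graphon g (B : set (mR * mR)) : measurable B ->
  B `<=` unit_square -> mu2.-integrable B (EFin \o g).
Proof.
move=> mB BQ; apply: (integrableS mQ) => //.
apply: measurable_bounded_integrable => //.
- by rewrite /= leb2_unit_square ltry.
- exact: gfun_meas.
- exists 1; split; first exact: real1.
  move=> M M1 z Qz /=; have /andP[g0 g1] := gfun_range g Qz.
  by rewrite ger0_norm// (le_trans g1)// ltW.
Qed.

Lemma integrable_graphonB f g (B : set (mR * mR)) : measurable B ->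
  B `<=` unit_square -> mu2.-integrable B (EFin \o (fun z => f z - g z)).
Proof.
move=> mB BQ.
have := integrableB mB (integrable_graphon f mB BQ) (integrable_graphon g mB BQ).
by apply: eq_integrable => // z _.
Qed.

Local Notation cutset f g := [set r | exists S A : set mR,
    [/\ measurable S, measurable A, S `<=` unit_itv, A `<=` unit_itv &
        r = `| \int[mu2]_(z in S `*` A) (f z - g z) | ] ].

Lemma cutset_nonempty (f g : mR * mR -> R) : cutset f g !=set0.
Proof. by eexists; exists set0, set0; split. Qed.

Lemma cutset_has_ubound f g : has_ubound (cutset f g).
Proof.
exists 1 => _ [S [A [mS mA SI AI ->]]].
have mB : measurable (S `*` A) by exact: measurableX.
have BQ := sub_rect SI AI.
rewrite (le_trans (le_normr_Rintegral _ (integrable_graphonB f g mB BQ)))//.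
have i1 (D : set (mR * mR)) : measurable D -> D `<=` unit_square ->
    mu2.-integrable D (EFin \o cst (1 : R)).
  move=> mD DQ; apply: (integrableS mQ) => //.
  apply: measurable_bounded_integrable => //.
    by rewrite /= leb2_unit_square ltry.
  by exists 1; split => // M M1 z _ /=; rewrite normr1 ltW.
apply: (@le_trans _ _ (\int[mu2]_(z in S `*` A) 1)).
  apply: le_Rintegral => //.
  - exact: (integrable_norm (integrable_graphonB f g mB BQ)).
  - exact: i1.
  - move=> z /BQ Qz; have := gfun_range f Qz; have := gfun_range g Qz.
    by move=> /andP[g0 g1] /andP[f0 f1]; rewrite ler_norml; apply/andP; lra.
rewrite Rintegral_cst// mul1r -lee_fin fineK.
  by rewrite -leb2_unit_square le_measure ?inE.
rewrite ge0_fin_numE// (@le_lt_trans _ _ (mu2 unit_square))//.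
  by rewrite le_measure ?inE.
by rewrite /= leb2_unit_square ltry.
Qed.

Lemma cutset_le f g (S A : set mR) : measurable S -> measurable A ->
  S `<=` unit_itv -> A `<=` unit_itv ->
  `| \int[mu2]_(z in S `*` A) (f z - g z) | <= cutdist f g.
Proof.
move=> mS mA SI AI; apply: ub_le_sup; first exact: cutset_has_ubound.
by exists S, A.
Qed.

Lemma cutdist_leP f g (c : R) :
  (forall S A : set mR, measurable S -> measurable A ->
   S `<=` unit_itv -> A `<=` unit_itv ->
   `| \int[mu2]_(z in S `*` A) (f z - g z) | <= c) -> cutdist f g <= c.
Proof.
move=> H; apply: ge_sup; first exact: cutset_nonempty.
by move=> _ [S [A [mS mA SI AI ->]]]; exact: H.
Qed.

Lemma cutdist_ge0 f g : 0 <= cutdist f g.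
Proof. exact: le_trans (cutset_le f g measurable0 measurable0 _ _). Qed.

Lemma cutdist_eq0 f g : {in unit_square, f =1 g} -> cutdist f g = 0.
Proof.
move=> fg; apply/eqP; rewrite eq_le cutdist_ge0 andbT.
apply: cutdist_leP => S A mS mA SI AI.
have mB : measurable (S `*` A) by exact: measurableX.
rewrite (@eq_Rintegral _ _ _ mu2 _ (cst 0)); last first.
  by move=> z; rewrite inE => /(sub_rect SI AI) Qz; rewrite fg ?inE// subrr.
by rewrite Rintegral_cst// mul0r normr0.
Qed.

Lemma cutdistC f g : cutdist f g = cutdist g f.
Proof.
have H f' g' : cutdist f' g' <= cutdist g' f'.
  apply: cutdist_leP => S A mS mA SI AI.
  apply: le_trans (cutset_le g' f' mS mA SI AI).
  have mB : measurable (S `*` A) by exact: measurableX.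
  have BQ := sub_rect SI AI.
  by rewrite !RintegralB// 1?distrC//; exact: integrable_graphon.
by apply/eqP; rewrite eq_le !H.
Qed.

Lemma cutdist_triangle g f h : cutdist f h <= cutdist f g + cutdist g h.
Proof.
apply: cutdist_leP => S A mS mA SI AI.
apply: le_trans (lerD (cutset_le f g mS mA SI AI) (cutset_le g h mS mA SI AI)).
have mB : measurable (S `*` A) by exact: measurableX.
have BQ := sub_rect SI AI.
apply: le_trans (ler_normD _ _).
rewrite !RintegralB//; try exact: integrable_graphon.
by rewrite addrA subrK.
Qed.

Let sext s (x : mR) : mR := if x \in unit_itv then s x else x.

Let sextE s x : unit_itv x -> sext s x = s x.
Proof. by move=> Ix; rewrite /sext mem_set. Qed.

Let sextNE s x : ~ unit_itv x -> sext s x = x.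
Proof. by move=> Ix; rewrite /sext memNset. Qed.

Let sext_preim s (A : set mR) : sext s @^-1` A =
  (unit_itv `&` s @^-1` (A `&` unit_itv)) `|` (A `\` unit_itv).
Proof.
apply/seteqP; split => x.
  have [Ix|nIx] := pselect (unit_itv x).
    rewrite /preimage/= sextE// => Ax; left; split => //.
    by split => //; exact: mpb_in.
  by rewrite /preimage/= sextNE// => Ax; right.
move=> [[Ix [Ax _]]|[Ax nIx]]; first by rewrite /preimage/= sextE.
by rewrite /preimage/= sextNE.
Qed.

Let measurable_sext s : measurable_fun setT (sext s).
Proof.
move=> _ A mA; rewrite setTI sext_preim; apply: measurableU.
  by apply: (mpb_meas s mI); exact: measurableI.
exact: measurableD.
Qed.

Let sext_preserve s (A : set mR) : measurable A -> mu (sext s @^-1` A) = mu A.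
Proof.
move=> mA; have mAI : measurable (A `&` unit_itv) by exact: measurableI.
have mAD : measurable (A `\` unit_itv) by exact: measurableD.
rewrite sext_preim measureU//; last 2 first.
- exact: (mpb_meas s mI).
- by apply/seteqP; split => // x [[? _] []].
have -> : mu A = mu ((A `&` unit_itv) `|` (A `\` unit_itv)) by rewrite setUIDK.
rewrite measureU//; last by apply/seteqP; split => // x [[_ ?] []].
by congr (_ + _)%E; exact: mpb_preserve.
Qed.

Lemma Rintegral_gact f g s (S A : set mR) : measurable S -> measurable A ->
  S `<=` unit_itv -> A `<=` unit_itv ->
  \int[mu2]_(z in S `*` A) (gact f s z - gact g s z) =
  \int[mu2]_(z in (s @` S) `*` (s @` A)) (f z - g z).
Proof.
move=> mS mA SI AI.
pose phi (z : mR * mR) := (sext s z.1, sext s z.2).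
have mphi : measurable_fun setT phi.
  apply: measurable_fun_pair.
    exact: (measurableT_comp (measurable_sext s) measurable_fst).
  exact: (measurableT_comp (measurable_sext s) measurable_snd).
pose F : mR * mR -> \bar R := (EFin \o (fun z => f z - g z)) \_ unit_square.

have mF : measurable_fun setT F.
  apply/(measurable_restrictT _ _).1; first exact: mQ.
  have := integrable_graphonB f g mQ (@subset_refl _ _).
  by move=> /integrableP[].
have mS' := @mpb_meas_image _ s _ mS SI.
have mA' := @mpb_meas_image _ s _ mA AI.
have SI' := @mpb_sub_image _ s _ SI.
have AI' := @mpb_sub_image _ s _ AI.
have mB : measurable (S `*` A) by exact: measurableX.
have BQ := sub_rect SI AI.
have preB : phi @^-1` ((s @` S) `*` (s @` A)) = S `*` A.
  have H (E : set mR) x : E `<=` unit_itv -> (s @` E) (sext s x) <-> E x.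
    move=> EI; split; last first.
      by move=> Ex; exists x => //; rewrite sextE//; exact: EI.
    move=> [y Ey]; have [Ix|nIx] := pselect (unit_itv x).
      by rewrite sextE// => /(mpb_inj (EI _ Ey) Ix) <-.
    by rewrite sextNE// => yx; case: nIx; rewrite -yx; exact/mpb_in/EI.
  by apply/seteqP; split => [[x y]|[x y]] [/= /(H _ _ SI) ? /(H _ _ AI) ?].
have FphiE : {in S `*` A, (EFin \o (fun z => gact f s z - gact g s z)) =1
    (F \o phi)}.
  move=> [x y]; rewrite inE => -[/= /SI Ix /AI Iy].
  rewrite /F patchE mem_set /phi/= !sextE//.
  by split; exact: mpb_in.
have iF : mu2.-integrable (phi @^-1` ((s @` S) `*` (s @` A))) (F \o phi).
  rewrite preB; apply: (eq_integrable mB _ _ FphiE).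
  exact: integrable_graphonB.
have mpre (C : set mR) : measurable C -> measurable (sext s @^-1` C).
  by move=> mC; have := measurable_sext s measurableT mC; rewrite setTI.
have mpres (X : set (mR * mR)) : measurable X ->
    mu2 X = pushforward mu2 phi X.
  pose mphi_mixin := isMeasurableFun.Build _ _ _ _ _ mphi.
  pose mphi_pack : {mfun _ >-> _} := HB.pack phi mphi_mixin.
  move=> mX; rewrite (_ : phi = mphi_pack)//.
  apply: product_measure_unique => // C D mC mD.
  rewrite /= /pushforward.
  rewrite (_ : _ @^-1` _ = (sext s @^-1` C) `*` (sext s @^-1` D))//.
  have [mC' mD'] := (mpre _ mC, mpre _ mD).
  have [eC eD] := (sext_preserve s mC, sext_preserve s mD).
  by rewrite product_measure1E//; congr (_ * _)%E; [exact: eC|exact: eD].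
have mB' : measurable ((s @` S) `*` (s @` A)) by exact: measurableX.
congr fine.
transitivity (\int[mu2]_(z in S `*` A) (F \o phi) z)%E.
  by apply: eq_integral => z zB; rewrite -FphiE.
rewrite -preB; transitivity
    (\int[pushforward mu2 phi]_(z in (s @` S) `*` (s @` A)) F z)%E.
  exact/esym/(integral_pushforward mphi mF iF mB').
transitivity (\int[mu2]_(z in (s @` S) `*` (s @` A)) F z)%E.
  by apply: eq_measure_integral => X mX _; exact/esym/mpres.
apply: eq_integral => z; rewrite inE => /(sub_rect SI' AI') Qz.
by rewrite /F patchE mem_set.
Qed.

Lemma cutdist_gact f g s : cutdist (gact f s) (gact g s) = cutdist f g.
Proof.
apply/eqP; rewrite eq_le; apply/andP; split.
  apply: cutdist_leP => S A mS mA SI AI; rewrite Rintegral_gact//.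
  by apply: cutset_le; [exact: mpb_meas_image|exact: mpb_meas_image|
                        exact: mpb_sub_image|exact: mpb_sub_image].
apply: cutdist_leP => S A mS mA SI AI.
have im (B : set mR) : B `<=` unit_itv -> s @` (unit_itv `&` s @^-1` B) = B.
  move=> BI; apply/seteqP; split => [_ [x [_ Bx] <-]//|y By].
  by have [x Ix xy] := mpb_surj s (BI _ By); exists x => //; split; rewrite /= ?xy.
have mpre (B : set mR) : measurable B -> measurable (unit_itv `&` s @^-1` B).
  exact: (mpb_meas s mI).
rewrite -(im S SI) -(im A AI) -Rintegral_gact; try by move=> x [].
- apply: cutset_le; [exact: mpre|exact: mpre|by move=> x []..].
- exact: mpre.
- exact: mpre.
Qed.

Lemma cutdist_eql f f' g : {in unit_square, f =1 f'} ->
  cutdist f g = cutdist f' g.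
Proof.
move=> ff'; have H : cutdist f f' = 0 by exact: cutdist_eq0.
apply/eqP; rewrite eq_le.
apply/andP; split.
  by have := cutdist_triangle f' f g; rewrite H add0r.
by have := cutdist_triangle f f' g; rewrite (cutdistC f' f) H add0r.
Qed.

End cut_distance.

Definition deltacut {R : realType} (f g : graphon R) : R :=
  inf [set cutdist f (gact g s) | s in [set: mpbij R]].

Section deltacut_theory.
Context {R : realType}.
Implicit Types (f g h : graphon R) (s t : mpbij R).
Local Notation orb f g := [set cutdist f (gact g s) | s in [set: mpbij R]].

Lemma deltacut_has_inf f g : has_inf (orb f g).
Proof.
split; first by exists (cutdist f (gact g mpb_id)), mpb_id.
by exists 0 => _ [s _ <-]; exact: cutdist_ge0.
Qed.

Lemma deltacut_le f g s : deltacut f g <= cutdist f (gact g s).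
Proof. by apply: ge_inf; [have [] := deltacut_has_inf f g|exists s]. Qed.

Lemma deltacut_ge f g (c : R) :
  (forall s, c <= cutdist f (gact g s)) -> c <= deltacut f g.
Proof.
move=> H; apply: lb_le_inf; first by have [] := deltacut_has_inf f g.
by move=> _ [s _ <-].
Qed.

Lemma deltacut_ge0 f g : 0 <= deltacut f g.
Proof. by apply: deltacut_ge => s; exact: cutdist_ge0. Qed.

Lemma deltacut_cutdist f g : deltacut f g <= cutdist f g.
Proof.
apply: le_trans (deltacut_le f g mpb_id) _.
rewrite cutdistC (@cutdist_eql _ _ g) 1?cutdistC//.
by move=> [x y] _.
Qed.

Lemma deltacutxx f : deltacut f f = 0.
Proof.
apply/eqP; rewrite eq_le deltacut_ge0 andbT.
by rewrite (le_trans (deltacut_cutdist f f))// cutdist_eq0.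
Qed.

Lemma deltacutC f g : deltacut f g = deltacut g f.
Proof.
have H f' g' : deltacut f' g' <= deltacut g' f'.
  apply: deltacut_ge => s; have [t [st ts]] := mpb_inv s.
  rewrite -(cutdist_gact _ _ t) cutdistC.
  rewrite (@cutdist_eql _ _ f' (gact g' t)); first exact: deltacut_le.
  by move=> [x y]; rewrite inE => -[/= Ix Iy]; rewrite !st.
by apply/eqP; rewrite eq_le !H.
Qed.

Lemma deltacut_triangle g f h : deltacut f h <= deltacut f g + deltacut g h.
Proof.
apply/ler_addgt0Pl => e e0.
have e20 : 0 < e / 2 by rewrite divr_gt0.
have [_ [t _ <-] ft] := inf_adherent e20 (deltacut_has_inf f g).
have [_ [s _ <-] gs] := inf_adherent e20 (deltacut_has_inf g h).
apply: le_trans (deltacut_le f h (mpb_comp s t)) _.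
apply: le_trans (cutdist_triangle (gact g t) _ _) _.
have -> : cutdist (gact g t) (gact h (mpb_comp s t)) = cutdist g (gact h s).
  by rewrite -(cutdist_gact g (gact h s) t).
by move: ft gs; rewrite -!/(deltacut _ _); lra.
Qed.

End deltacut_theory.

HB.instance Definition _ (R : realType) := gen_eqMixin (graphon R).
HB.instance Definition _ (R : realType) := gen_choiceMixin (graphon R).

Section graphon_pseudometric.
Context {R : realType}.
Implicit Types (f g h : graphon R).

Let ball f (e : R) : set (graphon R) := [set g | cutdist f g < e].
Let ent : set_system (graphon R * graphon R) := entourage_ ball.
Let nbhs f : set_system (graphon R) := nbhs_ ent f.

HB.instance Definition _ := hasNbhs.Build (graphon R) nbhs.

Let ball_center f (e : R) : 0 < e -> ball f e f.
Proof. by move=> e0; rewrite /ball/= cutdist_eq0. Qed.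

Let ball_sym f g (e : R) : ball f e g -> ball g e f.
Proof. by rewrite /ball/= cutdistC. Qed.

Let ball_triangle f g h (e1 e2 : R) : ball f e1 g -> ball g e2 h ->
  ball f (e1 + e2) h.
Proof.
by move=> fg gh; apply: le_lt_trans (cutdist_triangle g f h) _; exact: ltrD.
Qed.

HB.instance Definition _ := @Nbhs_isPseudoMetric.Build R (graphon R)
  ent erefl ball ball_center ball_sym ball_triangle erefl.

Lemma graphon_ballE f (e : R) :
  pseudometric_structure.ball f e = [set g | cutdist f g < e].
Proof. by []. Qed.

End graphon_pseudometric.

(** [closure] is taken for the topology of [cutdist]. *)
Definition orbit_closure {R : realType} (g : graphon R) : set (graphon R) :=
  closure [set gact g s | s in [set: mpbij R]].

Record wgraphon (R : realType) := WGraphon {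
  wset : set (graphon R) ;
  wsetP : exists g, wset = orbit_closure g }.

Definition wclass {R : realType} (g : graphon R) : wgraphon R :=
  WGraphon (ex_intro _ g erefl).

(** An arbitrary representative, picked by choice. *)
Definition wrepr {R : realType} (F : wgraphon R) : graphon R :=
  projT1 (cid (wsetP F)).

Section wgraphon_theory.
Context {R : realType}.
Implicit Types (f g h : graphon R) (F G : wgraphon R).

Lemma wgraphon_eq F G : wset F = wset G -> F = G.
Proof.
case: F G => [A PA] [B PB] /= AB; case: _ / AB PB => PB.
by congr WGraphon; exact: Prop_irrelevance.
Qed.

Lemma wreprK F : wclass (wrepr F) = F.
Proof.
by apply: wgraphon_eq; rewrite /= /wrepr; case: cid => g /= ->.
Qed.

Lemma orbit_closureP g f : orbit_closure g f <-> deltacut f g = 0.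
Proof.
split => [fg|fg].
  apply/eqP; rewrite eq_le deltacut_ge0 andbT; apply/ler_addgt0Pl => e e0.
  have [_ [[s _ <-] se]] := fg _ (nbhsx_ballx f _ e0).
  rewrite addr0 (le_trans (deltacut_le f g s))// ltW//.
move=> B /nbhs_ballP[e /= e0 eB].
have [_ [s _ <-] se] := inf_adherent e0 (deltacut_has_inf f g).
exists (gact g s); split; first by exists s.
by apply: eB; rewrite graphon_ballE/=; move: se; rewrite -/(deltacut _ _) fg add0r.
Qed.

Lemma wclass_eq f g : wclass f = wclass g <-> deltacut f g = 0.
Proof.
split => [[fg]|fg].
  by apply/orbit_closureP; rewrite -fg; apply/orbit_closureP/deltacutxx.
apply: wgraphon_eq; apply/seteqP; split => h /= /orbit_closureP h0;
  apply/orbit_closureP/eqP; rewrite eq_le deltacut_ge0 andbT.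
  by rewrite (le_trans (deltacut_triangle f h g))// h0 fg addr0.
by rewrite (le_trans (deltacut_triangle g h f))// h0 deltacutC fg addr0.
Qed.

Lemma deltacut_wrepr f g :
  deltacut (wrepr (wclass f)) (wrepr (wclass g)) = deltacut f g.
Proof.
have H h : deltacut (wrepr (wclass h)) h = 0.
  by apply/wclass_eq; rewrite wreprK.
apply/eqP; rewrite eq_le; apply/andP; split.
  rewrite (le_trans (deltacut_triangle f _ _))// H add0r.
  by rewrite (le_trans (deltacut_triangle g _ _))// (deltacutC g) H addr0.
rewrite (le_trans (deltacut_triangle (wrepr (wclass f)) _ _))//.
rewrite deltacutC H add0r.
by rewrite (le_trans (deltacut_triangle (wrepr (wclass g)) _ _))// H addr0.
Qed.

End wgraphon_theory.

HB.instance Definition _ (R : realType) := gen_eqMixin (wgraphon R).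
HB.instance Definition _ (R : realType) := gen_choiceMixin (wgraphon R).

Section wgraphon_metric.
Context {R : realType}.

Let wdist (F G : wgraphon R) : R := deltacut (wrepr F) (wrepr G).

Let wdistxx F : wdist F F = 0.
Proof. exact: deltacutxx. Qed.

Let wdist_positivity F G : wdist F G = 0 -> F = G.
Proof. by rewrite -{2}(wreprK F) -{2}(wreprK G) => /wclass_eq. Qed.

Let wdistC F G : wdist F G = wdist G F.
Proof. exact: deltacutC. Qed.

Let wdist_triangle G F H : wdist F H <= wdist F G + wdist G H.
Proof. exact: deltacut_triangle. Qed.

HB.instance Definition _ := @isMetric.Build R (wgraphon R)
  wdist wdistxx wdist_positivity wdistC wdist_triangle.

End wgraphon_metric.

(** [mdist] on [wgraphon R] does not depend on the representatives. *)
Lemma mdist_wclass {R : realType} (f g : graphon R) :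
  mdist (wclass f) (wclass g) = deltacut f g.
Proof. exact: deltacut_wrepr. Qed.

Definition mdist_set {R : realType} (h : wgraphon R) (F : set (wgraphon R)) :
    \bar R :=
  ereal_inf [set (mdist h f)%:E | f in F].

(** [0 log 0 = 0] holds because of the zero factor. *)
Definition entropy {R : realType} (u : R) : R :=
  2^-1 * u * ln u + 2^-1 * (1 - u) * ln (1 - u).

(** The integral does not depend on the representative of the class. *)
Definition rate {R : realType} (h : wgraphon R) : R :=
  \int[leb2 R]_(z in unit_square) entropy (wrepr h z).

Definition maximizers {R : realType} (T : wgraphon R -> R) : set (wgraphon R) :=
  [set h | forall h', T h' - rate h' <= T h - rate h].

(** Simple graphs, given by their adjacency relation; the ordinal [i : 'I_n]
    stands for the vertex [i.+1] of {1, ..., n}. *)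
Definition simple_adj n (e : {ffun 'I_n * 'I_n -> bool}) : bool :=
  [forall i, ~~ e (i, i)] && [forall i, forall j, e (i, j) == e (j, i)].

Definition sgraph (n : nat) := {e : {ffun 'I_n * 'I_n -> bool} | simple_adj e}.

HB.instance Definition _ n := Finite.on (sgraph n).

Section sgraph_theory.
Variable n : nat.
Implicit Types G : sgraph n.

Definition adj G (i j : 'I_n) : bool := val G (i, j).

Lemma adj_irrefl G i : adj G i i = false.
Proof. by have /andP[/forallP/(_ i)/negbTE] := valP G. Qed.

Lemma adj_sym G i j : adj G i j = adj G j i.
Proof. by have /andP[_ /forallP/(_ i)/forallP/(_ j)/eqP] := valP G. Qed.

Fact empty_sgraph_subproof : simple_adj [ffun _ : 'I_n * 'I_n => false].
Proof.
apply/andP; split; apply/forallP => i; first by rewrite ffunE.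
by apply/forallP => j; rewrite !ffunE.
Qed.

Definition empty_sgraph : sgraph n := Sub _ empty_sgraph_subproof.

HB.instance Definition _ := isPointed.Build (sgraph n) empty_sgraph.
HB.instance Definition _ := @isMeasurable.Build default_measure_display
  (sgraph n) discrete_measurable discrete_measurable0
  discrete_measurableC discrete_measurableU.

End sgraph_theory.

Section graph_graphon.
Context {R : realType} {n : nat}.
Implicit Types G : sgraph n.
Local Notation mR := (measurableTypeR R).

Definition graph_support G : set (mR * mR) :=
  [set z | exists i j : 'I_n, [/\ adj G i j,
     Num.ceil (n%:R * (z.1 : R)) = i.+1 & Num.ceil (n%:R * (z.2 : R)) = j.+1]].

Fact graph_fun_meas G : measurable_fun unit_square (\1_(graph_support G) : _ -> R).
Proof.
apply: measurable_funTS; apply: measurable_indic.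
pose cell (k : nat) : set mR := [set x | Num.ceil (n%:R * (x : R)) = k].
have mcell k : measurable (cell k).
  have -> : cell k = (fun x : R => n%:R * x) @^-1` `](k%:Z - 1)%:~R, (k%:Z)%:~R].
    apply/seteqP; split => x /=.
      by rewrite in_itv/= /cell/= => <-; exact: ceil_itv.
    by rewrite in_itv/= => H; exact: ceil_def.
  rewrite -[X in measurable X]setTI.
  exact: (mulrl_measurable n%:R measurableT).
rewrite (_ : graph_support G = \bigcup_(p in [set p | adj G p.1 p.2])
    (cell p.1.+1 `*` cell p.2.+1)).
  apply: fin_bigcup_measurable; first exact: finite_finset.
  by move=> p _; exact: measurableX.
apply/seteqP; split => z.
  by move=> [i [j [Gij zi zj]]]; exists (i, j).
by move=> [[i j] /= Gij [zi zj]]; exists i, j.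
Qed.

Fact graph_fun_sym G (x y : mR) : unit_itv x -> unit_itv y ->
  \1_(graph_support G) (x, y) = \1_(graph_support G) (y, x) :> R.
Proof.
move=> _ _; rewrite !indicE; congr (_ : bool)%:R.
by apply/idP/idP; rewrite !inE => -[i [j [Gij xi yj]]]; exists j, i;
  rewrite adj_sym.
Qed.

Fact graph_fun_range G (z : mR * mR) : unit_square z ->
  0 <= (\1_(graph_support G) z : R) <= 1.
Proof. by move=> _; rewrite indicE; case: (_ \in _); rewrite ?lexx ler01. Qed.

Definition graph_graphon G : graphon R :=
  Graphon (graph_fun_meas G) (graph_fun_sym G) (@graph_fun_range G).

End graph_graphon.

Definition wgraph {R : realType} {n : nat} (G : sgraph n) : wgraphon R :=
  wclass (graph_graphon G).

Definition psi {R : realType} (T : wgraphon R -> R) (n : nat) : R :=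
  (n%:R ^+ 2)^-1 * ln (\sum_(G : sgraph n) expR (n%:R ^+ 2 * T (wgraph G))).

(* Main.v *)
Require Import Defs.
From HB Require Import structures.
From mathcomp Require Import all_boot all_order all_algebra fingroup perm.
From mathcomp Require Import all_classical all_reals all_analysis.
From mathcomp Require Import measurable_realfun random_variable metric_structure.
From mathcomp Require Import ring lra zify.

(** Let [I] be the rate function and [Z_n] the sum of [exp (n^2 T)] over all
    graphs on [n] vertices, so that a set of graphs has probability the
    sum of [exp (n^2 T)] over it, divided by [Z_n].  Two counting estimates
    control such quotients.  For a graphon [h], the graphs on [n] vertices at
    small distance from [h] number at most [exp (n^2 (- I(h) + e))]
    ([graphs_near_le]), and at least [exp (n^2 (- I(h) - e))]
    ([graphs_near_ge]).  If [h] is not a maximizer, some [h'] has a larger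
    [T - I]; the graphs near [h'] alone make [Z_n] exponentially larger than
    the contribution of a small ball around [h], which is thus exponentially
    unlikely ([exp_small_near_nonmaximizer]).

    Compactness takes us from balls to the set [K] of all classes at distance
    at least [eta] from the maximizers.  Exponentially unlikely sets are stable
    under finite unions.  If [K] were not one of them, cutting it again and
    again into finitely many pieces of small diameter
    ([graphs_totally_bounded]) and keeping a bad piece each time would give a
    Cauchy sequence of graphs, whose limit ([deltacut_complete]) lies in [K]
    and has a good neighbourhood that contains a bad piece
    ([exp_small_closed_set]).

    Upper count.  The distance [deltacut] allows an unknown rearrangement of
    [0,1], but a step function [lam] on an [N] by [N] grid sees it only through
    the fractions of each vertex cell sent to each of the [N] intervals.
    Rounding these fractions leaves [exp (O(n))] possibilities.  For each one,
    Markov's inequality for [exp (sum lam)], the product formula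
    [sgraph_partition] and Jensen's inequality bound the number of graphs by
    [exp (n^2 (int logpart lam - int lam h + e))] ([graph_count_le]).  As
    [logpart] is the Legendre dual of [entropy], a good choice of [lam] brings
    the exponent to [- I(h)].

    Lower count.  Draw edges independently, with probabilities the averages of
    [h] over the cells, moved slightly towards 1/2.  By a Chernoff bound and a
    union over the [4^n] rectangles, the graph is near [h] with probability at
    least 1/2, while each typical graph has probability close to
    [exp (n^2 I(h))] ([graph_count_ge]).

    Both counts need that the averages of [h] over the cells of a fine grid
    converge to [h] in L1 ([avg_converges]).

    Total boundedness is the weak regularity lemma of Frieze and Kannan: up to
    a small cut error an adjacency matrix is a combination of boundedly many
    rectangles.  These classify the vertices into boundedly many types; once
    the vertices are sorted by type, the graph is described up to a small error
    by the proportions of the types and the coefficients.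

    Completeness.  A Cauchy sequence for [deltacut] becomes, after composing
    the rearrangements, Cauchy for the cut norm.  Graphons of almost minimal
    L2 norm in decreasing convex sets of almost limits converge in L2 by the
    parallelogram identity, and their limit is a limit for the cut norm. *)

Set Implicit Arguments.
Unset Strict Implicit.
Unset Printing Implicit Defensive.

Import Order.TTheory GRing.Theory Num.Theory.
Import numFieldNormedType.Exports.

Local Open Scope classical_set_scope.
Local Open Scope ring_scope.

(** * Entropy and its Legendre dual *)

Section entropy_duality.
Context {R : realType}.
Implicit Types (l u v w c e : R).

(** Half the log-partition function of a single edge with weight [2 l]; the factor
    1/2 matches [entropy], because each edge appears twice in sums over ordered
    pairs of vertices. *)
Definition logpart (l : R) : R := 2^-1 * ln (1 + expR (2 * l)).

(** The derivative of [logpart]: the edge probability when the edge has weight [2 l]. *)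
Definition logistic (l : R) : R := expR (2 * l) / (1 + expR (2 * l)).

Lemma logistic_itv l : 0 < logistic l < 1.
Proof.
rewrite /logistic; have e0 := expR_gt0 (2 * l).
rewrite divr_gt0 ?addr_gt0//= ltr_pdivrMr ?addr_gt0//; lra.
Qed.

Lemma logpart_ge0 l : 0 <= logpart l.
Proof.
rewrite /logpart mulr_ge0 ?invr_ge0// ln_ge0//; have := expR_gt0 (2 * l); lra.
Qed.

Lemma logpart_ge l : l / 2 <= logpart l.
Proof.
rewrite /logpart mulrC ler_pM2l ?invr_gt0//.
have e0 := expR_gt0 l; have e20 := expR_gt0 (2 * l).
rewrite -[leLHS]expRK ler_ln ?posrE ?addr_gt0//.
by rewrite mulrC expRM_natr; nra.
Qed.

Lemma mul_ln_sub_le u p : 0 <= u -> 0 < p -> u * ln p - u * ln u <= p - u.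
Proof.
rewrite le_eqVlt => /predU1P[<- p0|u0 p0]; first by lra.
have h : ln (p / u) <= p / u - 1.
  have := @le_ln1Dx R (p / u - 1); rewrite addrCA subrr addr0; apply.
  by have := divr_gt0 p0 u0; lra.
move: h; rewrite ln_div ?posrE// => h.
have := ler_wpM2l (ltW u0) h.
by rewrite mulrBr mulrBr mulr1 mulrCA divff ?gt_eqF// mulr1.
Qed.

(** Young's inequality for the dual pair [entropy], [logpart].  It is the
    nonnegativity of the Kullback-Leibler divergence from [logistic l] to [u]. *)
Lemma entropy_ge l u : 0 <= u <= 1 -> l * u - logpart l <= entropy u.
Proof.
move=> /andP[u0 u1]; rewrite /logpart /entropy.
have e20 := expR_gt0 (2 * l); set A := 1 + expR (2 * l).
have A0 : 0 < A by rewrite addr_gt0.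
have h1 := @mul_ln_sub_le u (expR (2 * l) / A) u0 (divr_gt0 e20 A0).
have h2 := @mul_ln_sub_le (1 - u) A^-1 _ _.
have := h2 _ _; rewrite subr_ge0 invr_gt0 => /(_ u1 A0) {}h2.
move: h1 h2; rewrite ln_div ?posrE// expRK lnV ?posrE//.
have : expR (2 * l) / A + A^-1 = 1.
  by rewrite -[X in _ + X]mul1r -mulrDl addrC divff// gt_eqF.
nra.
Qed.

(** The equality case of [entropy_ge]. *)
Lemma logpart_logistic l :
  logpart l = l * logistic l - entropy (logistic l).
Proof.
rewrite /entropy /logpart /logistic.
have e20 := expR_gt0 (2 * l); set A := 1 + expR (2 * l).
have A0 : 0 < A by rewrite addr_gt0.
have -> : 1 - expR (2 * l) / A = A^-1.
  by rewrite -[X in X - _](@divff _ A) ?gt_eqF// -mulrBl /A addrK mul1r.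
rewrite ln_div ?posrE// expRK lnV ?posrE//.
have : expR (2 * l) / A + A^-1 = 1.
  by rewrite -[X in _ + X]mul1r -mulrDl addrC divff// gt_eqF.
move: (expR _ / A) => x; move: A^-1 => y xy.
have -> : y = 1 - x by lra.
by field.
Qed.

Lemma entropy_le0 u : 0 <= u <= 1 -> entropy u <= 0.
Proof.
move=> /andP[u0 u1]; rewrite /entropy.
have h (x : R) : 0 <= x <= 1 -> x * ln x <= 0.
  by move=> /andP[x0 x1]; rewrite mulr_ge0_le0// ln_le0.
have := h u; have := h (1 - u); rewrite u0 u1 /= subr_ge0 u1 lerBlDr lerDl u0.
by move=> /(_ isT) ? /(_ isT) ?; nra.
Qed.

Lemma entropy_ge_half u : 0 <= u <= 1 -> - (2^-1 * ln 2) <= entropy u.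
Proof.
move=> u01; have := @entropy_ge 0 u u01.
by rewrite /logpart mulr0 expR0 mul0r sub0r -natr1.
Qed.

Definition logit v : R := 2^-1 * (ln v - ln (1 - v)).

Lemma logitK v : 0 < v < 1 -> logistic (logit v) = v.
Proof.
move=> /andP[v0 v1]; rewrite /logistic /logit mulrA divff// mul1r expRB.
have w0 : 0 < 1 - v by lra.
rewrite !lnK ?posrE//; field.
by rewrite !gt_eqF//=; lra.
Qed.

(** A contraction towards 1/2, which keeps probabilities away from 0 and 1, where
    [logit] is infinite. *)
Definition shrink c u : R := c * u + (1 - c) / 2.

Lemma shrink_itv c u : 0 < c < 1 -> 0 <= u <= 1 ->
  (1 - c) / 2 <= shrink c u <= 1 - (1 - c) / 2.
Proof. by move=> /andP[? ?] /andP[? ?]; rewrite /shrink; apply/andP; split; nra. Qed.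

Lemma logit_shrink_bound c u : 0 < c < 1 -> 0 <= u <= 1 ->
  `|logit (shrink c u)| <= - ln ((1 - c) / 2).
Proof.
move=> c01 u01; have /andP[v0 v1] := shrink_itv c01 u01.
have d0 : 0 < (1 - c) / 2 by case/andP: c01 => ? ?; lra.
rewrite /logit; set v := shrink c u in v0 v1 *.
have h (x : R) : (1 - c) / 2 <= x <= 1 -> ln ((1 - c) / 2) <= ln x <= 0.
  move=> /andP[x0 x1]; rewrite ln_le0// andbT ler_ln ?posrE//.
  exact: lt_le_trans x0.
have /h/andP[a1 a2] : (1 - c) / 2 <= v <= 1 by apply/andP; split => //; lra.
have /h/andP[b1 b2] : (1 - c) / 2 <= 1 - v <= 1 by apply/andP; split => //; lra.
by rewrite ler_norml; apply/andP; split; lra.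
Qed.

(** The logit of a shrunk probability is almost optimal in [entropy_ge]: the
    likelihood ratios of [u] and [1 - u] to their shrunk values are at most
    [c^-1], so that only [ln c] is lost. *)
Lemma logit_shrink_ge c u : 0 < c < 1 -> 0 <= u <= 1 ->
  entropy u + 2^-1 * ln c <= logit (shrink c u) * u - logpart (logit (shrink c u)).
Proof.
move=> c01 u01; have /andP[v0 v1] := shrink_itv c01 u01.
have /andP[c0 c1] := c01; have /andP[u0 u1] := u01.
have v01 : 0 < shrink c u < 1 by apply/andP; split; lra.
have /andP[vv0 vv1] := v01.
rewrite logpart_logistic logitK// /entropy /logit.
have h (x y : R) : 0 <= x -> c * x <= y -> 0 < y -> x * ln x + x * ln c <= x * ln y.
  rewrite le_eqVlt => /predU1P[<-|x0] xy y0; first by rewrite !mul0r addr0.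
  rewrite -mulrDr ler_pM2l// -lnM ?posrE// ler_ln ?posrE ?mulr_gt0//; lra.
have := h u (shrink c u) u0 _ vv0; have := h (1 - u) (1 - shrink c u) _ _ _.
set v := shrink c u in v0 v1 v01 vv0 vv1 *.
have e1 : c * u <= v by rewrite /v /shrink; lra.
have e2 : c * (1 - u) <= 1 - v by rewrite /v /shrink; nra.
move=> H1 /(_ e1) H2; have {}H1 := H1 _ e2 _.
have {H1} : (1 - u) * ln (1 - u) + (1 - u) * ln c <= (1 - u) * ln (1 - v).
  by apply: H1; lra.
by nra.
Qed.

(** [entropy] is a supremum of affine functions, and bounded slopes suffice up to
    [e], uniformly in [u], although [entropy] has infinite slope at 0 and 1. *)
Lemma entropy_dual e : 0 < e -> exists K : R, forall u, 0 <= u <= 1 ->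
  exists2 l, `|l| <= K & entropy u - e <= l * u - logpart l.
Proof.
move=> e0; set c := expR (- (2 * e)).
have c01 : 0 < c < 1 by rewrite expR_gt0/= /c expR_lt1; lra.
exists (- ln ((1 - c) / 2)) => u u01.
exists (logit (shrink c u)); first exact: logit_shrink_bound.
apply: le_trans (logit_shrink_ge c01 u01).
by rewrite /c expRK; lra.
Qed.

(** A Lipschitz bound up to an additive error: it turns L1 convergence of graphons
    into convergence of the integrals of [entropy]. *)
Lemma entropy_cont e : 0 < e -> exists2 K : R, 0 <= K & forall u w,
  0 <= u <= 1 -> 0 <= w <= 1 -> entropy u - entropy w <= K * `|u - w| + e.
Proof.
move=> e0; have [K HK] := entropy_dual e0.
have K0 : 0 <= K.
  by have [|l lK _] := HK 0; [rewrite lexx ler01|exact: le_trans lK].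
exists K => // u w u01 w01; have [l lK lu] := HK u u01.
have lw := @entropy_ge l w w01.
have : l * (u - w) <= K * `|u - w|.
  by rewrite (le_trans (ler_norm _))// normrM ler_wpM2r.
by rewrite mulrBr; lra.
Qed.

(** At the shrunk probability the left-hand side is [entropy (shrink c q)], by
    [logpart_logistic].  The right-hand side is affine in [q], so that it can be
    averaged over a cell and then compared with [entropy] by [entropy_ge]. *)
Lemma entropy_shrink c q l : 0 < c < 1 -> l = logit (shrink c q) ->
  l * shrink c q - logpart l <= c * (l * q - logpart l).
Proof.
move=> /andP[c0 c1] _; have := logpart_ge l.
rewrite /shrink; set L := logpart l => h.
have : (1 - c) * (l / 2 - L) <= 0 by rewrite mulr_ge0_le0; lra.
lra.
Qed.

(** Jensen's inequality: by [logpart_logistic] and [entropy_ge], [logpart] lies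
    above its tangent line at the barycentre. *)
Lemma logpart_convex (I : finType) (w x : I -> R) : (forall i, 0 <= w i) ->
  \sum_i w i = 1 ->
  logpart (\sum_i w i * x i) <= \sum_i w i * logpart (x i).
Proof.
move=> w0 w1; set m := \sum_i w i * x i.
rewrite logpart_logistic; set v := logistic m.
have v01 : 0 <= v <= 1 by have /andP[/ltW -> /ltW ->] := logistic_itv m.
have -> : m * v - entropy v = \sum_i w i * (x i * v - entropy v).
  rewrite -[entropy v in LHS]mul1r -w1 !mulr_suml -sumrB.
  by apply: eq_bigr => i _; ring.
apply: ler_sum => i _; rewrite ler_wpM2l//.
by have := entropy_ge (x i) v01; lra.
Qed.

(** Convexity of [ln (1 + exp)] at the midpoint of [2 a] and [2 b]; it spares us
    from assuming that edge weights are symmetric. *)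
Lemma ln_one_expD a b : ln (1 + expR (a + b)) <= logpart a + logpart b.
Proof.
rewrite /logpart -mulrDr -lnM ?posrE ?addr_gt0 ?expR_gt0//.
rewrite -(@ler_pM2l _ 2)// mulrA divff// mul1r.
rewrite mulr2n mulrDl !mul1r -lnM ?posrE ?addr_gt0 ?expR_gt0//.
rewrite ler_ln ?posrE ?mulr_gt0 ?addr_gt0 ?expR_gt0//.
rewrite ![2 * _]mulrC expRD !expRM_natr.
have := sqr_ge0 (expR a - expR b).
move: (expR a) (expR b) => A B; nra.
Qed.

(** The exponential moment of one edge, as used in the Chernoff bound. *)
Lemma logistic_mgf l x : `|x| <= 2^-1 ->
  1 + expR (2 * l + x) <= (1 + expR (2 * l)) * expR (logistic l * x + 2 * x ^+ 2).
Proof.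
move=> hx; have /andP[v0 v1] := logistic_itv l.
have e20 := expR_gt0 (2 * l).
have -> : 1 + expR (2 * l + x) = (1 + expR (2 * l)) * (1 + logistic l * (expR x - 1)).
  by rewrite /logistic expRD; field; rewrite gt_eqF// addr_gt0.
rewrite ler_pM2l ?addr_gt0//.
have ex : expR x <= 1 + x + 2 * x ^+ 2.
  have xb : - 2^-1 <= x <= 2^-1 by rewrite -ler_norml.
  have /andP[xb1 xb2] := xb.
  have h : 1 - x <= expR (- x) by have := expR_ge1Dx (- x); lra.
  rewrite expRN in h; have ex0 := expR_gt0 x.
  have {h} : (1 - x) * expR x <= 1.
    by rewrite -(ler_pM2r ex0) mulVf ?gt_eqF// in h.
  move=> h.
  have h2 : 1 <= (1 - x) * (1 + x + 2 * x ^+ 2).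
    have -> : (1 - x) * (1 + x + 2 * x ^+ 2) = 1 + x ^+ 2 * (1 - 2 * x) by ring.
    by rewrite lerDl mulr_ge0 ?sqr_ge0//; lra.
  rewrite -(@ler_pM2l _ (1 - x)); [exact: le_trans h h2|lra].
apply: le_trans (expR_ge1Dx _).
rewrite lerD2l; have := sqr_ge0 x; move: (x ^+ 2) ex => y ex y0.
have : logistic l * (expR x - 1) <= logistic l * (x + 2 * y).
  by rewrite ler_pM2l//; lra.
move=> h; apply: le_trans h _.
rewrite mulrDr lerD2l; nra.
Qed.

End entropy_duality.

(** * Exponential sums over graphs *)

Section graph_partition_function.
Context {R : realType}.
Variable n : nat.
Implicit Types (x l c : 'I_n -> 'I_n -> R) (G : sgraph n).

Lemma sum_pairs (F : 'I_n * 'I_n -> R) :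
  \sum_p F p = \sum_(p : 'I_n * 'I_n | (p.1 < p.2)%N) (F p + F (p.2, p.1)) + \sum_i F (i, i).
Proof.
rewrite (bigID (fun p : 'I_n * 'I_n => (p.1 < p.2)%N))/= big_split/= -addrA.
congr (_ + _).
rewrite (bigID (fun p : 'I_n * 'I_n => (p.2 < p.1)%N))/=; congr (_ + _).
  rewrite [RHS](reindex_inj (h := fun p : 'I_n * 'I_n => (p.2, p.1)))/=; last first.
    by move=> [a b] [a' b'] [-> ->].
  by apply: eq_big => -[a b]//=; rewrite -leqNgt andb_idl// => /ltnW.
rewrite (reindex_onto (fun i : 'I_n => (i, i)) (@fst _ _))/=; last first.
  by move=> [i j]/=; rewrite -!leqNgt -eqn_leq => /eqP/val_inj ->.
by apply: eq_bigl => i; rewrite ltnn eqxx.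
Qed.

(** A graph is determined by its adjacencies above the diagonal, which are
    arbitrary: this makes sums over graphs factor. *)
Definition upper_adj G : {ffun 'I_n * 'I_n -> bool} :=
  [ffun p : 'I_n * 'I_n => (p.1 < p.2)%N && adj G p.1 p.2].

Definition of_upper_adj (f : {ffun 'I_n * 'I_n -> bool}) : sgraph n :=
  insubd (empty_sgraph n) [ffun p : 'I_n * 'I_n => f p || f (p.2, p.1)].

Lemma upper_adjK : cancel upper_adj of_upper_adj.
Proof.
move=> G; apply: val_inj; rewrite val_insubd.
have -> : [ffun p : 'I_n * 'I_n => upper_adj G p || upper_adj G (p.2, p.1)] = val G.
  apply/ffunP => -[i j]; rewrite !ffunE/= (adj_sym G j i) -andb_orl.
  case: (ltngtP i j) => //= /val_inj ->; symmetry; exact: (adj_irrefl G j).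
by rewrite (valP G).
Qed.

Lemma of_upper_adjK f :
  f \in pfamily false (fun p : 'I_n * 'I_n => (p.1 < p.2)%N) (fun => predT) ->
  upper_adj (of_upper_adj f) = f.
Proof.
move=> /pfamilyP[sf _].
have f0 (p : 'I_n * 'I_n) : ~~ (p.1 < p.2)%N -> f p = false.
  by move=> pN; apply/negbTE/negP => fp; move/fintype.subsetP: sf => /(_ p);
    rewrite !inE fp => /(_ isT) h; rewrite /in_mem /= in h; rewrite h in pN.
apply/ffunP => -[i j]; rewrite !ffunE/= /adj val_insubd.
have -> : simple_adj [ffun p : 'I_n * 'I_n => f p || f (p.2, p.1)].
  apply/andP; split; apply/forallP => a.
    by rewrite ffunE/= orbb f0//= ltnn.
  by apply/forallP => b; rewrite !ffunE/= orbC.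
rewrite ffunE/=; have [ij|ij] := ltnP i j; last by rewrite f0//= -leqNgt.
by rewrite (f0 (j, i)) ?orbF//= -leqNgt ltnW.
Qed.

(** Expanding the product over the pairs [i < j] amounts to choosing the edges of a
    graph. *)
Lemma sgraph_partition x :
  \sum_(G : sgraph n) expR (\sum_(p : 'I_n * 'I_n) x p.1 p.2 * (adj G p.1 p.2)%:R) =
  \prod_(p : 'I_n * 'I_n | (p.1 < p.2)%N) (1 + expR (x p.1 p.2 + x p.2 p.1)).
Proof.
transitivity (\prod_(p : 'I_n * 'I_n | (p.1 < p.2)%N)
    \sum_(b : bool) expR ((x p.1 p.2 + x p.2 p.1) * b%:R)); last first.
  by apply: eq_bigr => p _; rewrite big_bool/= mulr1 mulr0 expR0 addrC.
rewrite (big_distr_big_dep false)/=.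
rewrite (reindex_onto upper_adj of_upper_adj)/=; last exact: of_upper_adjK.
apply: eq_big => G.
  rewrite upper_adjK eqxx andbT; apply/esym/pfamilyP; split => //.
  apply/fintype.subsetP => p; rewrite !inE ffunE /in_mem/=; case: (p.1 < p.2)%N => //=; rewrite eqxx.
move=> _; rewrite sum_pairs [X in _ + X]big1 ?addr0; last first.
  by move=> i _; rewrite adj_irrefl mulr0.
rewrite expR_sum; apply: eq_bigr => -[i j]/= ij; rewrite ffunE/= ij/=.
by rewrite (adj_sym G j i) mulrDl.
Qed.

(** Diagonal entries are left out: a graph has no loops, whereas [v] may be positive
    there. *)
Definition off_diag_dev (v c : 'I_n -> 'I_n -> R) (G : sgraph n) : R :=
  \sum_(p : 'I_n * 'I_n | p.1 != p.2) c p.1 p.2 * ((adj G p.1 p.2)%:R - v p.1 p.2).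

Lemma off_diagE (F : 'I_n * 'I_n -> R) :
  \sum_(p | p.1 != p.2) F p =
  \sum_(p : 'I_n * 'I_n | (p.1 < p.2)%N) (F p + F (p.2, p.1)).
Proof.
rewrite big_mkcond sum_pairs/= [X in _ + X]big1 ?addr0; last first.
  by move=> i _; rewrite eqxx.
apply: eq_bigr => -[i j]/= ij.
by rewrite [j == i]eq_sym; have [ji|//] := eqVneq i j; rewrite ji ltnn in ij.
Qed.

(** The unnormalized law of a graph with independent edges, of probabilities
    [logistic (l i j)] when [l] is symmetric. *)
Definition edge_weight l (G : sgraph n) : R :=
  expR (\sum_(p : 'I_n * 'I_n) l p.1 p.2 * (adj G p.1 p.2)%:R).

(** The Chernoff bound for independent edges.  Tilting by [t c] is again a product
    law, so its total weight is given by [sgraph_partition]. *)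
Lemma off_diag_dev_tail l c (K eta : R) : (forall i j, l i j = l j i) ->
  0 < K -> (forall i j, `|c i j| <= K) -> 0 < eta -> eta <= 4 * K ->
  \sum_(G : sgraph n |
      eta * n%:R ^+ 2 <= off_diag_dev (fun i j => logistic (l i j)) c G)
    edge_weight l G <=
  expR (- (eta ^+ 2 / (32 * K ^+ 2)) * n%:R ^+ 2) * \sum_(G : sgraph n) edge_weight l G.
Proof.
move=> lC K0 cK eta0 etaK.
(* The minimizer of [- t eta + 8 t^2 K^2]; as [eta <= 4 K], [|t c|] is at most 1/4. *)
set t := eta / (16 * K ^+ 2).
have t0 : 0 < t by rewrite divr_gt0// mulr_gt0// exprn_gt0.
have tK : 4 * (t * K) <= 1.
  have -> : 4 * (t * K) = eta / (4 * K) by rewrite /t; field; rewrite gt_eqF.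
  by rewrite ler_pdivrMr ?mulr_gt0// mul1r.
pose v i j := logistic (l i j).
pose V : R := \sum_(p : 'I_n * 'I_n | p.1 != p.2) c p.1 p.2 * v p.1 p.2.
pose x i j := l i j + t * c i j.
apply: (@le_trans _ _ (\sum_(G : sgraph n)
    expR (- (t * V) - t * (eta * n%:R ^+ 2)) * edge_weight x G)).
  rewrite big_mkcond/=; apply: ler_sum => G _; case: ifPn => [dev|_]; last first.
    by rewrite mulr_ge0 ?expR_ge0.
  rewrite /edge_weight -expRD ler_expR.
  have -> : \sum_(p : 'I_n * 'I_n) x p.1 p.2 * (adj G p.1 p.2)%:R =
      \sum_(p : 'I_n * 'I_n) l p.1 p.2 * (adj G p.1 p.2)%:R +
      t * \sum_(p : 'I_n * 'I_n | p.1 != p.2) c p.1 p.2 * (adj G p.1 p.2)%:R.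
    rewrite mulr_sumr [X in _ = _ + X]big_mkcond -big_split/=.
    apply: eq_bigr => -[i j] _ /=; case: eqVneq => [->|_].
      by rewrite adj_irrefl !mulr0 addr0.
    by rewrite /x /=; ring.
  have : t * (eta * n%:R ^+ 2) <= t * off_diag_dev v c G by rewrite ler_pM2l.
  rewrite /off_diag_dev.
  under eq_bigr do rewrite mulrBr.
  by rewrite sumrB -/V; lra.
rewrite -mulr_sumr !sgraph_partition.
apply: (@le_trans _ _ (expR (- (t * V) - t * (eta * n%:R ^+ 2)) *
  \prod_(p : 'I_n * 'I_n | (p.1 < p.2)%N)
    ((1 + expR (l p.1 p.2 + l p.2 p.1)) *
     expR (t * (v p.1 p.2 * c p.1 p.2 + v p.2 p.1 * c p.2 p.1)
       + 8 * (t * K) ^+ 2)))).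
  rewrite ler_pM2l ?expR_gt0//; apply: ler_prod => -[i j] /= ij.
  rewrite addr_ge0 ?expR_ge0//=.
  rewrite /x (lC j i) (_ : _ + _ + _ = 2 * l i j + t * (c i j + c j i)); last by ring.
  rewrite (_ : l i j + l i j = 2 * l i j); last by ring.
  have cc : `|t * (c i j + c j i)| <= 2 * (t * K).
    rewrite normrM gtr0_norm// mulrCA ler_pM2l//.
    by rewrite (le_trans (ler_normD _ _))//; have := cK i j; have := cK j i; lra.
  apply: le_trans (logistic_mgf _ _) _; first by apply: le_trans cc _; lra.
  rewrite ler_pM2l ?addr_gt0 ?expR_gt0// ler_expR /v (lC j i).
  have : (t * (c i j + c j i)) ^+ 2 <= (2 * (t * K)) ^+ 2.
    move: cc; rewrite ler_norml => /andP[].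
    by move: (t * (_ + _)) (2 * (t * K)) => y z; nra.
  by rewrite (exprMn 2); lra.
rewrite big_split/= -expR_sum mulrCA mulrC ler_pM2r; last first.
  by rewrite prodr_gt0// => p _; rewrite addr_gt0 ?expR_gt0.
rewrite -expRD ler_expR big_split/= -mulr_sumr.
have -> : \sum_(p : 'I_n * 'I_n | (p.1 < p.2)%N)
  (v p.1 p.2 * c p.1 p.2 + v p.2 p.1 * c p.2 p.1) = V.
  by rewrite /V off_diagE; apply: eq_bigr => p _ /=; rewrite ![v _ _ * _]mulrC.
have : \sum_(i : 'I_n * 'I_n | (i.1 < i.2)%N) 8 * (t * K) ^+ 2 <=
    n%:R ^+ 2 * (8 * (t * K) ^+ 2).
  rewrite big_mkcond/=; apply: (@le_trans _ _
      (\sum_(i : 'I_n * 'I_n) 8 * (t * K) ^+ 2)).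
    by apply: ler_sum => i _; case: ifP => // _; rewrite mulr_ge0// sqr_ge0.
  by rewrite sumr_const card_prod card_ord mulnn -natrX [leRHS]mulr_natl.
have -> : 8 * (t * K) ^+ 2 = t * eta / 2.
  by rewrite /t; field; rewrite gt_eqF.
have -> : eta ^+ 2 / (32 * K ^+ 2) = t * eta / 2.
  by rewrite /t; field; rewrite gt_eqF.
lra.
Qed.

End graph_partition_function.

(** * The weak regularity lemma *)

Section frieze_kannan.
Context {R : realType} {P : finType} (rect : {set P} -> Prop).
Hypothesis rect0 : rect finset.set0.

(** Energy decrement.  As long as some admissible [Y] correlates with the residual,
    subtracting [t] times the indicator of [Y], with [t] the correlation divided
    by [#|P|], lowers the energy of the residual by at least [e^2 #|P|]; the
    energy starts at most at [#|P|], so that [m] steps suffice.  Dividing by [#|P|]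
    rather than by the size of [Y] keeps the coefficients in [-1,1]. *)
Lemma frieze_kannan (a : P -> R) (e : R) (m : nat) :
  (forall p, `|a p| <= 1) -> 0 < e -> 1 < m%:R * e ^+ 2 ->
  exists (c : nat -> R) (X : nat -> {set P}),
  [/\ forall k, `|c k| <= 1, forall k, rect (X k) &
      forall Y : {set P}, rect Y ->
      `| \sum_(p in Y) (a p - \sum_(k < m) c k * (p \in X k)%:R) | <= e * #|P|%:R].
Proof.
move=> a1 e0 me.
pose res (c : nat -> R) (X : nat -> {set P}) k p := a p - \sum_(k < k) c k * (p \in X k)%:R.
pose small r := forall Y : {set P}, rect Y -> `| \sum_(p in Y) (r p : R) | <= e * #|P|%:R.
suff H k : exists (c : nat -> R) (X : nat -> {set P}),
    [/\ forall k, `|c k| <= 1, forall k, rect (X k) &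
      small (res c X k) \/
      \sum_p (res c X k p) ^+ 2 <= #|P|%:R * (1 - k%:R * e ^+ 2)].
  have [c [X [c1 rX [sm|en]]]] := H m; first by exists c, X.
  have [P0|P0] := posnP #|P|.
    exists c, X; split => // Y rY; rewrite big1 ?normr0 ?P0 ?mulr0//.
    by move=> p; have := fintype0 p P0.
  have : 0 <= \sum_p res c X m p ^+ 2 by apply: sumr_ge0 => p _; exact: sqr_ge0.
  move=> /le_trans/(_ en); rewrite pmulr_rge0 ?ltr0n//; lra.
elim: k => [|k [c [X [c1 rX H]]]].
  exists (fun => 0), (fun => finset.set0); split => //; first by move=> _; rewrite normr0.
  right; rewrite mul0r subr0 mulr1.
  apply: (@le_trans _ _ (\sum_(p : P) 1)).
    apply: ler_sum => p _; rewrite /res big_ord0 subr0.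
    by rewrite -real_normK ?num_real// expr_le1.
  by rewrite sumr_const.
pose upd T (f : nat -> T) (y : T) : nat -> T := fun j => if j == k then y else f j.
have updE T (f : nat -> T) y : upd T f y k = y by rewrite /upd eqxx.
have updN T (f : nat -> T) y (j : 'I_k) : upd T f y j = f j.
  by rewrite /upd; case: eqP => // jk; have := ltn_ord j; rewrite jk ltnn.
have resE t Y p : res (upd _ c t) (upd _ X Y) k.+1 p = res c X k p - t * (p \in Y)%:R.
  rewrite /res big_ord_recr/= !updE opprD addrA; congr (_ - _ - _).
  by apply: eq_bigr => i _; rewrite !updN.
have rU Y : rect Y -> forall j, rect (upd _ X Y j).
  by move=> rY j; rewrite /upd; case: ifP.
have cU t : `|t| <= 1 -> forall j, `|upd _ c t j| <= 1.
  by move=> rY j; rewrite /upd; case: ifP.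
have [sm|nsm] := pselect (small (res c X k)).
  exists (upd _ c 0), (upd _ X finset.set0); split; [by apply: cU; rewrite normr0|exact: rU|].
  left => Y rY; under eq_bigr do rewrite resE mul0r subr0; exact: sm.
have {H} en : \sum_p (res c X k p) ^+ 2 <= #|P|%:R * (1 - k%:R * e ^+ 2) by case: H.
have [Y rY big] : exists2 Y, rect Y & e * #|P|%:R < `| \sum_(p in Y) res c X k p |.
  apply: contrapT => nY; apply: nsm => Y rY; rewrite leNgt; apply/negP => ?.
  by apply: nY; exists Y.
set D := \sum_(p in Y) res c X k p in big.
have N0 : 0 < #|P|%:R :> R.
  rewrite ltr0n lt0n; apply/negP => /eqP P0.
  by move: big; rewrite P0 mulr0 /D big1 ?normr0 ?ltxx// => p; have := fintype0 p P0.
pose t := D / #|P|%:R.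
have Dt : D = t * #|P|%:R by rewrite /t divfK ?gt_eqF.
have ener : \sum_p (res (upd _ c t) (upd _ X Y) k.+1 p) ^+ 2 <=
    \sum_p (res c X k p) ^+ 2 - t ^+ 2 * #|P|%:R.
  have -> : \sum_p (res (upd _ c t) (upd _ X Y) k.+1 p) ^+ 2 =
    \sum_p (res c X k p) ^+ 2 - 2 * t * D + t ^+ 2 * #|Y|%:R.
    rewrite /D -sum1_card natr_sum !mulr_sumr.
    rewrite (big_mkcond (fun p => p \in Y) (fun p => 2 * t * _)).
    rewrite (big_mkcond (fun p => p \in Y) (fun p => t ^+ 2 * _)).
    rewrite -sumrB -big_split/=; apply: eq_bigr => p _; rewrite resE.
    by case: (p \in Y) => /=; ring.
  have : t ^+ 2 * #|Y|%:R <= t ^+ 2 * #|P|%:R.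
    by rewrite ler_wpM2l ?sqr_ge0// ler_nat max_card.
  by rewrite Dt; lra.
have en0 : 0 <= \sum_p (res (upd _ c t) (upd _ X Y) k.+1 p) ^+ 2.
  by apply: sumr_ge0 => p _; exact: sqr_ge0.
have ke : 0 <= k%:R * e ^+ 2 by rewrite mulr_ge0// sqr_ge0.
(* The new energy is nonnegative, hence the decrement is at most the old energy. *)
have t1 : `|t| <= 1.
  have : t ^+ 2 <= 1.
    rewrite -(ler_pM2r N0) mul1r.
    have : #|P|%:R * (1 - k%:R * e ^+ 2) <= #|P|%:R * 1 by rewrite ler_pM2l//; lra.
    lra.
  by rewrite -real_normK ?num_real// expr_le1.
exists (upd _ c t), (upd _ X Y); split; [exact: cU|exact: rU|right].
apply: le_trans ener _; rewrite -natr1.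
have : e ^+ 2 * #|P|%:R <= t ^+ 2 * #|P|%:R.
  rewrite ler_pM2r// -[leRHS]real_normK ?num_real// ler_pXn2r ?nnegrE//; last first.
    exact: ltW.
  move: big; rewrite Dt normrM (gtr0_norm N0) ltr_pM2r//; exact: ltW.
lra.
Qed.

End frieze_kannan.

(** * Rectangles and fractional cuts *)

Section fractional_cut.
Context {R : realType}.

Definition rectangle n (Y : {set 'I_n * 'I_n}) : Prop :=
  exists S A : {set 'I_n}, Y = finset.setX S A.

Lemma rectangle0 n : rectangle (finset.set0 : {set 'I_n * 'I_n}).
Proof.
by exists finset.set0, finset.set0; apply/setP => p; rewrite !inE.
Qed.

Lemma sum_weights_le (I : finType) (s x : I -> R) :
  (forall i, 0 <= s i <= 1) -> exists S : {set I}, \sum_i s i * x i <= \sum_(i in S) x i.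
Proof.
move=> s01; exists [set i | 0 < x i]%SET.
rewrite [leRHS]big_mkcond; apply: ler_sum => i _; rewrite inE.
have /andP[s0 s1] := s01 i; case: ltP => x0; last by rewrite mulr_ge0_le0.
by rewrite ler_piMl// ltW.
Qed.

(** A bilinear form on a product of cubes is extremal at vertices, that is, at
    indicators of sets. *)
Lemma fractional_cut n (B : 'I_n * 'I_n -> R) (e : R) (s t : 'I_n -> R) :
  (forall Y, rectangle Y -> `|\sum_(p in Y) B p| <= e) ->
  (forall i, 0 <= s i <= 1) -> (forall i, 0 <= t i <= 1) ->
  `|\sum_p s p.1 * t p.2 * B p| <= e.
Proof.
move=> He s01 t01.
have H (B' : 'I_n * 'I_n -> R) :
    (forall Y, rectangle Y -> \sum_(p in Y) B' p <= e) ->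
    \sum_p s p.1 * t p.2 * B' p <= e.
  move=> {}He.
  have [S hS] := sum_weights_le (fun i => \sum_j t j * B' (i, j)) s01.
  have [A hA] := sum_weights_le (fun j => \sum_(i in S) B' (i, j)) t01.
  have -> : \sum_p s p.1 * t p.2 * B' p = \sum_i s i * \sum_j t j * B' (i, j).
    rewrite (eq_bigr (fun p : 'I_n * 'I_n => s p.1 * (t p.2 * B' (p.1, p.2)))); last first.
      by move=> [i j] _; rewrite mulrA.
    rewrite -(pair_bigA _ (fun i j => s i * (t j * B' (i, j)))).
    by apply: eq_bigr => i _; rewrite mulr_sumr.
  apply: le_trans hS _; rewrite exchange_big/=.
  apply: le_trans (_ : \sum_j t j * \sum_(i in S) B' (i, j) <= e).
    by apply: ler_sum => j _; rewrite mulr_sumr.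
  apply: le_trans hA _; rewrite exchange_big/= pair_big_dep/=.
  apply: le_trans (He (finset.setX S A) _); last by exists S, A.
  rewrite le_eqVlt; apply/orP; left; apply/eqP; apply: eq_big => -[i j]//=.
  by rewrite finset.in_setX.
rewrite ler_norml lerNl; apply/andP; split.
  rewrite -sumrN; under eq_bigr do rewrite -mulrN.
  apply: (H (fun p => - B p)) => Y rY; rewrite sumrN.
  by have := He Y rY; rewrite ler_norml => /andP[]; lra.
by apply: H => Y rY; have := He Y rY; rewrite ler_norml => /andP[].
Qed.

End fractional_cut.

(** * Counting graphs from above *)

Section quantization.
Context {R : realType}.

Definition quantize (M : nat) (x : R) : 'I_M.+1 := inord (Num.truncn (M%:R * x)).

(** Rounding to a grid with [M + 1] points turns approximate equality of numbers in
    [0,1] into equality in a finite type. *)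
Lemma quantize_close (M : nat) (x y : R) : (0 < M)%N -> 0 <= x <= 1 -> 0 <= y <= 1 ->
  quantize M x = quantize M y -> `|x - y| <= M%:R^-1.
Proof.
rewrite -(ltr0n R) => M0 /andP[x0 x1] /andP[y0 y1] /(congr1 val)/=.
have b (t : R) : 0 <= t -> t <= 1 -> 0 <= M%:R * t <= M%:R.
  by move=> t0 t1; rewrite mulr_ge0 ?ler_piMr// ltW.
have tb (t : R) : 0 <= t -> t <= 1 -> (Num.truncn (M%:R * t) < M.+1)%N.
  move=> t0 t1; have /andP[b0 b1] := b t t0 t1; rewrite ltnS -(ler_nat R).
  by apply: le_trans b1; rewrite truncn_le.
rewrite !inordK ?tb// => tt.
have /andP[bx _] := b x x0 x1; have /andP[by' _] := b y y0 y1.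
have := truncn_itv bx; have := truncn_itv by'; rewrite tt -natr1 => /andP[? ?] /andP[? ?].
rewrite -(ler_pM2l M0) -[X in X * `|_| <= _]gtr0_norm// -normrM mulfV ?gt_eqF//.
by rewrite mulrBr ler_norml; apply/andP; split; lra.
Qed.

End quantization.

Section upper_count.
Context {R : realType}.

(** [p u i] is the fraction of the cell of the vertex [u] that a rearrangement of
    [0,1] sends to the [i]-th of [N] equal intervals. *)
Record fractional_partition (N n : nat) (p : 'I_n -> 'I_N -> R) : Prop := {
  fp_ge0 : forall u i, 0 <= p u i ;
  fp_sum1 : forall u, \sum_i p u i = 1 ;
  fp_mass : forall i, \sum_u p u i = n%:R / N%:R }.

(** The average over the cell of [(u, v)] of the rearranged step function [lam]. *)
Definition blend N n (lam : 'I_N -> 'I_N -> R) (p : 'I_n -> 'I_N -> R) (u v : 'I_n) : R :=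
  \sum_i \sum_j p u i * p v j * lam i j.

Lemma fp_le1 N n (p : 'I_n -> 'I_N -> R) u i : fractional_partition p -> p u i <= 1.
Proof.
move=> [p0 p1 _]; rewrite -(p1 u) (bigD1 i)//= lerDl.
by apply: sumr_ge0 => j _; exact: p0.
Qed.

(** Jensen's inequality in each cell; the right-hand side no longer depends on the
    rearrangement, because rearrangements preserve the measure. *)
Lemma logpart_blend N n (lam : 'I_N -> 'I_N -> R) (p : 'I_n -> 'I_N -> R) :
  fractional_partition p ->
  \sum_(q : 'I_n * 'I_n) logpart (blend lam p q.1 q.2) <=
  n%:R ^+ 2 / N%:R ^+ 2 * \sum_i \sum_j logpart (lam i j).
Proof.
move=> [p0 p1 pm].
apply: (@le_trans _ _ (\sum_(q : 'I_n * 'I_n) blend (fun i j => logpart (lam i j)) p q.1 q.2)).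
  apply: ler_sum => -[u v] _ /=; rewrite /blend !pair_bigA/=.
  apply: (@logpart_convex _ _ (fun k : 'I_N * 'I_N => p u k.1 * p v k.2)).
    by move=> k; rewrite mulr_ge0.
  rewrite -(pair_bigA _ (fun i j => p u i * p v j))/=.
  by under eq_bigr do rewrite -mulr_sumr p1 mulr1.
rewrite -(pair_bigA _ (fun u v => blend _ p u v))/= /blend.
under eq_bigr do rewrite exchange_big/=.
rewrite exchange_big/= mulr_sumr le_eqVlt; apply/orP; left; apply/eqP.
apply: eq_bigr => i _; rewrite mulr_sumr.
under eq_bigr do rewrite exchange_big/=.
rewrite exchange_big/=; apply: eq_bigr => j _.
under eq_bigr do rewrite -mulr_suml -mulr_sumr pm.
rewrite -mulr_suml -mulr_suml pm [X in X * _ = _]mulrACA -invfM.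
by rewrite -!expr2.
Qed.

Lemma blend_lipschitz N n (lam : 'I_N -> 'I_N -> R) (p p' : 'I_n -> 'I_N -> R) (e : R) u v :
  fractional_partition p -> fractional_partition p' ->
  (forall u i, `|p u i - p' u i| <= e) ->
  `|blend lam p u v - blend lam p' u v| <= 2 * e * \sum_i \sum_j `|lam i j|.
Proof.
move=> fp fp' pp'; rewrite /blend -sumrB mulr_sumr.
apply: le_trans (ler_norm_sum _ _ _) _; apply: ler_sum => i _.
rewrite -sumrB mulr_sumr; apply: le_trans (ler_norm_sum _ _ _) _.
apply: ler_sum => j _; rewrite -mulrBl normrM ler_wpM2r//.
have -> : p u i * p v j - p' u i * p' v j =
   p u i * (p v j - p' v j) + p' v j * (p u i - p' u i) by ring.
rewrite (le_trans (ler_normD _ _))// !normrM.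
have -> : 2 * e = e + e by ring.
have pn (q : 'I_n -> 'I_N -> R) x k : fractional_partition q -> `|q x k| <= 1.
  by move=> fq; rewrite ger0_norm ?(fp_ge0 fq)// fp_le1.
by apply: lerD; (rewrite -[leRHS]mul1r ler_pM//; exact: pn).
Qed.

(** Markov's inequality for the exponential of the hypothesis, for each rounded
    value of the weights [p].  There are at most [(m + 1)^(n N)] of these, which
    is negligible compared with [exp (n^2 e)]. *)
Lemma graph_count_le N (lam : 'I_N -> 'I_N -> R) (c e : R) : 0 < e ->
  exists n0 : nat, forall n, (n0 <= n)%N -> forall E : {set sgraph n},
  (forall G, G \in E -> exists2 p : 'I_n -> 'I_N -> R, fractional_partition p &
     n%:R ^+ 2 * (c - e) <=
     \sum_(q : 'I_n * 'I_n) blend lam p q.1 q.2 * (adj G q.1 q.2)%:R) ->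
  #|E|%:R <= expR (n%:R ^+ 2 *
    ((N%:R ^+ 2)^-1 * (\sum_i \sum_j logpart (lam i j)) - c + 3 * e)).
Proof.
move=> e0; set L : R := \sum_i \sum_j `|lam i j|.
have L0 : 0 <= L by apply: sumr_ge0 => i _; apply: sumr_ge0.
pose m := (Num.truncn (2 * L / e)).+1.
have mL : 2 * L <= e * m%:R.
  rewrite [leRHS]mulrC -ler_pdivrMr//; exact/ltW/truncnS_gt.
exists (Num.truncn (N%:R * ln m.+1%:R / e : R)).+1 => n nn E HE.
have Nn : n%:R * (N%:R * ln m.+1%:R) <= n%:R ^+ 2 * e :> R.
  rewrite expr2 -mulrA ler_wpM2l// -ler_pdivrMr//.
  by apply: le_trans (_ : _ <= (Num.truncn (N%:R * ln m.+1%:R / e : R)).+1%:R) _;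
    [exact/ltW/truncnS_gt|rewrite ler_nat].
have /choice[pG HpG] : forall G : sgraph n, exists p : 'I_n -> 'I_N -> R, G \in E ->
    fractional_partition p /\ n%:R ^+ 2 * (c - e) <=
     \sum_(q : 'I_n * 'I_n) blend lam p q.1 q.2 * (adj G q.1 q.2)%:R.
  move=> G; have [GE|GE] := boolP (G \in E); last by exists (fun _ _ => 0).
  by have [p ? ?] := HE _ GE; exists p.
pose rho (G : sgraph n) : {ffun 'I_n * 'I_N -> 'I_m.+1} :=
  [ffun q => quantize m (pG G q.1 q.2)].
have rhoP G G' : G \in E -> G' \in E -> rho G = rho G' ->
    forall u i, `|pG G u i - pG G' u i| <= m%:R^-1.
  move=> /HpG[fp _] /HpG[fp' _] /ffunP rr u i; have := rr (u, i); rewrite !ffunE/=.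
  by apply: quantize_close => //; rewrite (fp_ge0, fp_le1) ?fp_le1 ?fp_ge0.
set B := expR (n%:R ^+ 2 *
    ((N%:R ^+ 2)^-1 * (\sum_i \sum_j logpart (lam i j)) - c + 2 * e)).
(* Within a class the weights of one member [G0] serve for all the members, at
   the cost of [e] per entry. *)
have cls r : \sum_(G in E | rho G == r) 1 <= B.
  have [[G0 /andP[G0E /eqP rG0]]|nG] := pselect (exists G, (G \in E) && (rho G == r)); last first.
    rewrite big_pred0 ?expR_ge0// => G; apply/negbTE/negP => GE.
    by apply: nG; exists G.
  set y := blend lam (pG G0); have [fp0 _] := HpG _ G0E.
  apply: (@le_trans _ _ (\sum_(G : sgraph n) expR (- (n%:R ^+ 2 * (c - 2 * e))) *
     expR (\sum_(q : 'I_n * 'I_n) y q.1 q.2 * (adj G q.1 q.2)%:R))).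
    rewrite big_mkcond; apply: ler_sum => G _; case: ifP => [/andP[GE /eqP rG]|_]; last first.
      by rewrite mulr_ge0 ?expR_ge0.
    rewrite -expRD -[leLHS]expR0 ler_expR.
    have [fp HG] := HpG _ GE.
    have : \sum_(q : 'I_n * 'I_n) blend lam (pG G) q.1 q.2 * (adj G q.1 q.2)%:R <=
       \sum_(q : 'I_n * 'I_n) (y q.1 q.2 * (adj G q.1 q.2)%:R + e).
      apply: ler_sum => -[a b] _ /=.
      have d : `|blend lam (pG G) a b - y a b| <= e.
        apply: le_trans (blend_lipschitz lam a b fp fp0 (rhoP _ _ GE G0E _)) _.
          by rewrite rG rG0.
        rewrite -/L mulrAC ler_pdivrMr ?ltr0n// mulrC; lra.
      move: d; rewrite ler_norml => /andP[d1 d2].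
      by case: (adj G a b); rewrite ?mulr1 ?mulr0; lra.
    rewrite big_split/= sumr_const card_prod card_ord mulnn -[e *+ _]mulr_natl natrX.
    lra.
  rewrite -mulr_sumr sgraph_partition.
  have -> : B = expR (- (n%:R ^+ 2 * (c - 2 * e))) *
     expR (n%:R ^+ 2 / N%:R ^+ 2 * (\sum_i \sum_j logpart (lam i j))).
    by rewrite -expRD /B; congr expR; ring.
  rewrite ler_pM2l ?expR_gt0//.
  apply: (@le_trans _ _ (expR (\sum_(q : 'I_n * 'I_n) logpart (y q.1 q.2)))); last first.
    by rewrite ler_expR; exact: logpart_blend.
  rewrite sum_pairs.
  apply: (@le_trans _ _ (expR (\sum_(p : 'I_n * 'I_n | (p.1 < p.2)%N)
      (logpart (y p.1 p.2) + logpart (y p.2 p.1))))); last first.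
    by rewrite ler_expR lerDl sumr_ge0// => i _; exact: logpart_ge0.
  rewrite expR_sum; apply: ler_prod => -[a b] ab /=.
  rewrite addr_ge0 ?expR_ge0//=.
  rewrite -[leLHS]lnK ?posrE ?addr_gt0 ?expR_gt0// ler_expR.
  exact: ln_one_expD.
rewrite -sum1_card natr_sum (partition_big rho predT)//=.
apply: (@le_trans _ _ (\sum_(r : {ffun 'I_n * 'I_N -> 'I_m.+1}) B)).
  by apply: ler_sum => r _; exact: cls.
rewrite sumr_const card_ffun card_prod !card_ord -[B *+ _]mulr_natl natrX.
have -> : m.+1%:R ^+ (n * N) = expR (n%:R * (N%:R * ln m.+1%:R)) :> R.
  rewrite mulrA -natrM mulrC expRM_natr lnK//.
  by rewrite posrE ltr0n.
rewrite /B -expRD ler_expR.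
lra.
Qed.

End upper_count.

(** * Integrals of bounded functions on the square *)

Section bounded_measurable.
Context {R : realType}.
Local Notation mR := (measurableTypeR R).
Local Notation mu2 := (leb2 R).
Implicit Types (f g : mR * mR -> R) (B : set (mR * mR)).

Let mQ := @measurable_unit_square R.
Let mI := @measurable_unit_itv R.

(** Everything on the unit square is bounded, so this is all that integrability needs. *)
Definition bounded_mfun f : Prop :=
  measurable_fun unit_square f /\ exists M : R, forall z, unit_square z -> `|f z| <= M.

Lemma bmf_integrable f B : bounded_mfun f -> measurable B -> B `<=` unit_square ->
  mu2.-integrable B (EFin \o f).
Proof.
move=> [mf [M fM]] mB BQ; apply: (integrableS mQ) => //.
apply: measurable_bounded_integrable => //.
- by rewrite /= leb2_unit_square ltry.
- exists M; split; first exact: num_real.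
  by move=> M' MM' z Qz /=; rewrite (le_trans (fM _ Qz))// ltW.
Qed.

Lemma bmf_graphon (h : graphon R) : bounded_mfun h.
Proof.
split; first exact: gfun_meas.
by exists 1 => z /(gfun_range h)/andP[h0 h1]; rewrite ger0_norm.
Qed.

Lemma bmf_cst (c : R) : bounded_mfun (cst c).
Proof. by split; [exact: measurable_cst|exists `|c|]. Qed.

Lemma bmfD f g : bounded_mfun f -> bounded_mfun g -> bounded_mfun (fun z => f z + g z).
Proof.
move=> [mf [M fM]] [mg [M' gM']]; split; first exact: measurable_funD.
exists (M + M') => z Qz; rewrite (le_trans (ler_normD _ _))// lerD//.
  exact: fM.
exact: gM'.
Qed.

Lemma bmfM f g : bounded_mfun f -> bounded_mfun g -> bounded_mfun (fun z => f z * g z).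
Proof.
move=> [mf [M fM]] [mg [M' gM']]; split; first exact: measurable_funM.
by exists (M * M') => z Qz; rewrite normrM ler_pM//; [exact: fM|exact: gM'].
Qed.

Lemma bmfZ (c : R) f : bounded_mfun f -> bounded_mfun (fun z => c * f z).
Proof. by move=> bf; apply: bmfM => //; exact: bmf_cst. Qed.

Lemma bmfB f g : bounded_mfun f -> bounded_mfun g -> bounded_mfun (fun z => f z - g z).
Proof.
move=> bf bg; have := bmfD bf (bmfZ (-1) bg).
by rewrite (_ : (fun z => f z + -1 * g z) = (fun z => f z - g z))//;
  apply/funext => z; rewrite mulN1r.
Qed.

Lemma bmf_norm f : bounded_mfun f -> bounded_mfun (fun z => `|f z|).
Proof.
move=> [mf [M fM]]; split; last by exists M => z Qz; rewrite normr_id; exact: fM.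
exact: (measurableT_comp (@normr_measurable R setT) mf).
Qed.

Lemma bmf_sum (I : Type) (r : seq I) (F : I -> mR * mR -> R) :
  (forall i, bounded_mfun (F i)) -> bounded_mfun (fun z => \sum_(i <- r) F i z).
Proof.
move=> bF; elim: r => [|i r IH].
  by rewrite (_ : (fun _ => _) = cst 0) ?funeqE => [|z]; [exact: bmf_cst|rewrite big_nil].
rewrite (_ : (fun _ => _) = (fun z => F i z + \sum_(j <- r) F j z)).
  exact: bmfD.
by apply/funext => z; rewrite big_cons.
Qed.

Lemma bmf_eq f g : {in unit_square, f =1 g} -> bounded_mfun f -> bounded_mfun g.
Proof.
move=> fg [mf [M fM]]; split; first exact: (eq_measurable_fun _ fg).
by exists M => z Qz; rewrite -fg ?inE//; exact: fM.
Qed.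

Lemma bmf_indic B : measurable B -> bounded_mfun (\1_B).
Proof.
move=> mB; split; first by apply: measurable_funTS; exact: measurable_indic.
by exists 1 => z _; rewrite indicE; case: (_ \in _); rewrite ?normr1 ?normr0.
Qed.

Lemma bmf_intD f g B : bounded_mfun f -> bounded_mfun g -> measurable B ->
  B `<=` unit_square ->
  \int[mu2]_(z in B) (f z + g z) = \int[mu2]_(z in B) f z + \int[mu2]_(z in B) g z.
Proof. by move=> bf bg mB BQ; rewrite RintegralD//; exact: bmf_integrable. Qed.

Lemma bmf_intB f g B : bounded_mfun f -> bounded_mfun g -> measurable B ->
  B `<=` unit_square ->
  \int[mu2]_(z in B) (f z - g z) = \int[mu2]_(z in B) f z - \int[mu2]_(z in B) g z.
Proof. by move=> bf bg mB BQ; rewrite RintegralB//; exact: bmf_integrable. Qed.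

Lemma bmf_intZ c f B : bounded_mfun f -> measurable B ->
  B `<=` unit_square ->
  \int[mu2]_(z in B) (c * f z) = c * \int[mu2]_(z in B) f z.
Proof. by move=> bf mB BQ; rewrite RintegralZl//; exact: bmf_integrable. Qed.

Lemma bmf_int_sum (I : Type) (r : seq I) (F : I -> mR * mR -> R) B :
  (forall i, bounded_mfun (F i)) -> measurable B -> B `<=` unit_square ->
  \int[mu2]_(z in B) (\sum_(i <- r) F i z) = \sum_(i <- r) \int[mu2]_(z in B) F i z.
Proof.
move=> bF mB BQ; elim: r => [|i r IH].
  rewrite big_nil; under eq_Rintegral do rewrite big_nil.
  by rewrite Rintegral_cst// mul0r.
rewrite big_cons -IH -bmf_intD//; last exact: bmf_sum.
by apply: eq_Rintegral => z _; rewrite big_cons.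
Qed.

Lemma bmf_int_le f g B : bounded_mfun f -> bounded_mfun g -> measurable B ->
  B `<=` unit_square -> (forall z, B z -> f z <= g z) ->
  \int[mu2]_(z in B) f z <= \int[mu2]_(z in B) g z.
Proof. by move=> bf bg mB BQ fg; apply: le_Rintegral => //; exact: bmf_integrable. Qed.

Lemma bmf_int_norm f B : bounded_mfun f -> measurable B -> B `<=` unit_square ->
  `|\int[mu2]_(z in B) f z| <= \int[mu2]_(z in B) `|f z|.
Proof. by move=> bf mB BQ; apply: le_normr_Rintegral => //; exact: bmf_integrable. Qed.

Lemma bmf_int_indic B D : measurable B -> measurable D ->
  \int[mu2]_(z in B) \1_D z = fine (mu2 (D `&` B)).
Proof. by move=> mB mD; rewrite /Rintegral integral_indic. Qed.

Lemma bmf_int_restrict f B D : bounded_mfun f -> measurable B -> measurable D ->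
  \int[mu2]_(z in B) (f z * \1_D z) = \int[mu2]_(z in B `&` D) f z.
Proof.
move=> bf mB mD; rewrite Rintegral_mkcondr.
by apply: eq_Rintegral => z _; rewrite patchE indicE; case: (_ \in _);
  rewrite ?mulr1 ?mulr0.
Qed.

Lemma bmf_int_sub f B B' : bounded_mfun f -> measurable B -> measurable B' ->
  B `<=` B' -> B' `<=` unit_square -> (forall z, unit_square z -> 0 <= f z) ->
  \int[mu2]_(z in B) f z <= \int[mu2]_(z in B') f z.
Proof.
move=> bf mB mB' BB' BQ f0; rewrite -(setIidr BB') -bmf_int_restrict//.
apply: bmf_int_le => //; first by apply: bmfM => //; exact: bmf_indic.
move=> z /BQ Qz; rewrite indicE; case: (_ \in _); rewrite ?mulr1 ?mulr0//.
exact: f0.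
Qed.

Lemma bmf_int_norm_square f B : bounded_mfun f -> measurable B -> B `<=` unit_square ->
  `|\int[mu2]_(z in B) f z| <= \int[mu2]_(z in unit_square) `|f z|.
Proof.
move=> bf mB BQ; apply: le_trans (bmf_int_norm bf mB BQ) _.
by apply: bmf_int_sub => //; exact: bmf_norm.
Qed.

Lemma int_square_cst (c : R) : \int[mu2]_(z in unit_square) c = c.
Proof.
by rewrite Rintegral_cst//= leb2_unit_square/= mulr1.
Qed.

(** The cut norm is dominated by the L1 norm. *)
Lemma cutdist_le_int (f g : graphon R) :
  cutdist f g <= \int[mu2]_(z in unit_square) `|f z - g z|.
Proof.
apply: cutdist_leP => S A mS mA SI AI.
apply: bmf_int_norm_square; first by apply: bmfB; exact: bmf_graphon.
  exact: measurableX.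
exact: sub_rect.
Qed.

Lemma measurable_entropy (h : graphon R) :
  measurable_fun unit_square (fun z => entropy (h z)).
Proof.
have mh := gfun_meas h.
have m1 : measurable_fun unit_square (fun z => 1 - h z).
  by apply: measurable_funB => //; exact: measurable_cst.
apply: measurable_funD; apply: measurable_funM.
- by apply: measurable_funM => //; exact: measurable_cst.
- exact: (measurableT_comp (@measurable_ln R) mh).
- by apply: measurable_funM => //; exact: measurable_cst.
- exact: (measurableT_comp (@measurable_ln R) m1).
Qed.

Lemma bmf_entropy (h : graphon R) : bounded_mfun (fun z => entropy (h z)).
Proof.
split; first exact: measurable_entropy.
exists (2^-1 * ln 2) => z /(gfun_range h) h01.
have := entropy_le0 h01; have := entropy_ge_half h01.
by rewrite ler_norml => ? ?; apply/andP; split; lra.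
Qed.

End bounded_measurable.

(** * Step functions on a grid *)

Lemma measure_fibers d (T : measurableType d) (R : realType)
    (m : {measure set T -> \bar R}) k (c : T -> 'I_k.+1) (S : set T) :
  (forall i, measurable (S `&` [set x | c x = i])) ->
  m S = (\sum_i m (S `&` [set x | c x = i]))%E.
Proof.
move=> mF; rewrite -(measure_bigsetU_ord _ predT)//; last first.
  by apply/trivIsetP => i j _ _ ij; apply/seteqP; split => // x [[_ /= xi] [_ /= xj]];
    move: ij; rewrite -xi -xj eqxx.
congr (m _); rewrite -bigcup_mkord_ord; apply/seteqP; split => [x Sx|x [i _ []]//].
by exists (c x) => //=; split => //=; rewrite inord_val.
Qed.

Section grid.
Context {R : realType}.
Local Notation mR := (measurableTypeR R).
Local Notation mu := (@lebesgue_measure R).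
Local Notation mu2 := (leb2 R).
Variable n : nat.
Let mQ := @measurable_unit_square R.
Let mI := @measurable_unit_itv R.

(** The index of [x] in the subdivision of (0,1] into [n + 1] intervals closed on the
    right; 0 is put in the first one. *)
Definition cell (x : mR) : 'I_n.+1 :=
  inord `|Num.ceil (n.+1%:R * (x : R))|%N.-1.

Let n0 : 0 < n.+1%:R :> R. Proof. by rewrite ltr0n. Qed.

Lemma cellP (x : mR) (k : nat) : unit_itv x ->
  (k < cell x)%N = (k.+1%:R / n.+1%:R < x).
Proof.
rewrite /unit_itv/= in_itv/= => /andP[x0 x1].
have nx0 : 0 <= n.+1%:R * x by rewrite mulr_ge0.
have nx1 : n.+1%:R * x <= n.+1%:R by rewrite ler_piMr.
have c0 : (0 <= Num.ceil (n.+1%:R * x))%R.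
  by rewrite ceil_ge0 (lt_le_trans _ nx0).
have cn : (Num.ceil (n.+1%:R * x) <= n.+1%:Z)%R.
  by rewrite ceil_le_int.
have H : (k.+1%:R / n.+1%:R < x) = (k.+1%:Z < Num.ceil (n.+1%:R * x)).
  by rewrite ltr_pdivrMr// mulrC ceil_gt_int.
rewrite H /cell inordK; last by move: c0 cn; lia.
by apply/idP/idP; move: c0 cn; lia.
Qed.

Lemma ceil_cell (x : mR) : unit_itv x -> 0 < x ->
  Num.ceil (n.+1%:R * (x : R)) = (cell x).+1.
Proof.
rewrite /unit_itv/= in_itv/= => /andP[x0 x1] xp.
have nx0 : 0 < n.+1%:R * x by rewrite mulr_gt0.
have nx1 : n.+1%:R * x <= n.+1%:R by rewrite ler_piMr.
have c0 : (0 < Num.ceil (n.+1%:R * x))%R by rewrite ceil_gt_int.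
have cn : (Num.ceil (n.+1%:R * x) <= n.+1%:Z)%R by rewrite ceil_le_int.
by rewrite /cell inordK; move: c0 cn; lia.
Qed.

Definition cset (i : 'I_n.+1) : set mR := unit_itv `&` [set x | cell x = i].

Lemma csetE (i : 'I_n.+1) (x : mR) : cset i x <->
  [/\ unit_itv x, (0 < i)%N -> i%:R / n.+1%:R < x & x <= i.+1%:R / n.+1%:R].
Proof.
split.
  move=> [Ix /= xi]; split => //.
    by case: i xi => [[|i] Hi] //= xi _; rewrite -cellP// xi.
  by rewrite leNgt -cellP// xi ltnn.
move=> [Ix xi1 xi2]; split => //=; apply/val_inj => /=; apply/eqP.
rewrite eqn_leq; apply/andP; split.
  by rewrite leqNgt cellP// -leNgt.
case: i xi1 {xi2} => [[|i] Hi] //= xi1.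
by rewrite cellP// xi1.
Qed.

Lemma cset_itv (i : 'I_n.+1) : cset i =
  if (0 < i)%N then [set` `]i%:R / n.+1%:R : R, i.+1%:R / n.+1%:R]]
  else [set` `[0 : R, i.+1%:R / n.+1%:R]].
Proof.
have i1 : i.+1%:R / n.+1%:R <= 1 :> R by rewrite ler_pdivrMr// mul1r ler_nat.
have i0 : 0 <= i%:R / n.+1%:R :> R by rewrite divr_ge0.
apply/seteqP; split => x.
  move=> /csetE[]; rewrite /unit_itv/= in_itv/= => /andP[x0 x1] xi1 xi2.
  case: ifPn => ip; rewrite /= in_itv/= xi2 ?xi1//.
  by rewrite x0.
case: ifPn => ip; rewrite /= in_itv/= => /andP[x1 x2]; apply/csetE; split => //.
- by rewrite /unit_itv/= in_itv/= (le_trans i0 (ltW x1)) (le_trans x2 i1).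
- by rewrite /unit_itv/= in_itv/= x1 (le_trans x2 i1).
- by move=> ip'; rewrite ip' in ip.
Qed.

Lemma measurable_cset i : measurable (cset i).
Proof. by rewrite cset_itv; case: ifP => _; exact: measurable_itv. Qed.

Lemma cset_sub i : cset i `<=` unit_itv. Proof. by move=> x []. Qed.

Lemma mu_cset i : mu (cset i) = (n.+1%:R^-1)%:E.
Proof.
have d : i.+1%:R / n.+1%:R - i%:R / n.+1%:R = n.+1%:R^-1 :> R.
  by rewrite -mulrBl -natrB// subSnn mul1r.
rewrite cset_itv; case: ifPn => i0.
  have -> := @lebesgue_measure_itv R `]i%:R / n.+1%:R, i.+1%:R / n.+1%:R].
  by rewrite /= lte_fin ltr_pM2r ?invr_gt0// ltr_nat ltnSn -EFinB d.
have {}i0 : i = 0%N :> nat by case: (nat_of_ord i) i0.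
have -> := @lebesgue_measure_itv R `[0, i.+1%:R / n.+1%:R].
by rewrite /= i0 mul1r lte_fin invr_gt0 n0 -EFinB subr0.
Qed.

Lemma cset_cell x : unit_itv x -> cset (cell x) x. Proof. by []. Qed.

(** The mass of [S] in a cell: step functions see a set only through these. *)
Definition wt (S : set mR) (i : 'I_n.+1) : R := fine (mu (S `&` cset i)).

Lemma mu_fin (S : set mR) : measurable S -> S `<=` unit_itv -> mu S \is a fin_num.
Proof.
move=> mS SI; rewrite ge0_fin_numE//.
apply: (@le_lt_trans _ _ (mu unit_itv)); first by rewrite le_measure ?inE.
by rewrite /= leb_unit_itv ltry.
Qed.

Lemma wt_itv (S : set mR) i : measurable S -> S `<=` unit_itv ->
  0 <= wt S i <= n.+1%:R^-1.
Proof.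
move=> mS SI; rewrite /wt fine_ge0//= -lee_fin fineK; last first.
  apply: mu_fin; first by apply: measurableI => //; exact: measurable_cset.
  by move=> x [/SI].
rewrite -(mu_cset i) le_measure ?inE//; first by apply: measurableI => //; exact: measurable_cset.
exact: measurable_cset.
Qed.

Lemma wt_sum (S : set mR) : measurable S -> S `<=` unit_itv ->
  \sum_i wt S i = fine (mu S).
Proof.
move=> mS SI; have fibE i : S `&` [set x | cell x = i] = S `&` cset i.
  by apply/seteqP; split => [x [Sx xi]|x [Sx []]//]; split => //; split => //; exact: SI.
apply: EFin_inj; rewrite fineK ?mu_fin// -sumEFin.
rewrite (@measure_fibers _ _ _ mu _ cell)/=.
  apply: eq_bigr => i _; rewrite fibE fineK// mu_fin//; last by move=> x [/SI].
  by apply: measurableI => //; exact: measurable_cset.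
by move=> i; rewrite fibE; apply: measurableI => //; exact: measurable_cset.
Qed.

Definition step (a : 'I_n.+1 -> 'I_n.+1 -> R) (z : mR * mR) : R :=
  a (cell z.1) (cell z.2).

Definition box (p : 'I_n.+1 * 'I_n.+1) : set (mR * mR) := cset p.1 `*` cset p.2.

Lemma measurable_box p : measurable (box p).
Proof. by apply: measurableX; exact: measurable_cset. Qed.

Lemma box_sub p : box p `<=` unit_square.
Proof. by apply: sub_rect; exact: cset_sub. Qed.

Lemma box_indic (z : mR * mR) p : unit_square z ->
  \1_(box p) z = ((cell z.1, cell z.2) == p)%:R :> R.
Proof.
case: z p => x y [i j] [/= Ix Iy]; rewrite indicE; congr (_ : bool)%:R.
apply/idP/eqP; first by rewrite inE => -[[_ /= ->] [_ /= ->]].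
by move=> [xi yj]; rewrite inE; split; split.
Qed.

Lemma sum_box (z : mR * mR) (F : 'I_n.+1 * 'I_n.+1 -> R) : unit_square z ->
  \sum_p F p * \1_(box p) z = F (cell z.1, cell z.2).
Proof.
move=> Qz; rewrite (bigD1 (cell z.1, cell z.2))//= box_indic// eqxx mulr1.
rewrite big1 ?addr0// => p pz.
by rewrite box_indic// eq_sym (negbTE pz) mulr0.
Qed.

Lemma bmf_step a : bounded_mfun (step a).
Proof.
apply: (@bmf_eq _ (fun z => \sum_p a p.1 p.2 * \1_(box p) z)).
  move=> z; rewrite inE => Qz.
  by rewrite (sum_box (fun p => a p.1 p.2)).
apply: bmf_sum => p; apply: bmfZ; apply: bmf_indic; exact: measurable_box.
Qed.

Lemma int_boxes (f : mR * mR -> R) B : bounded_mfun f -> measurable B ->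
  B `<=` unit_square ->
  \int[mu2]_(z in B) f z = \sum_p \int[mu2]_(z in B `&` box p) f z.
Proof.
move=> bf mB BQ.
under [RHS]eq_bigr => p _ do rewrite -(bmf_int_restrict bf mB (measurable_box p)).
rewrite -bmf_int_sum//; last first.
  by move=> p; apply: bmfM => //; apply: bmf_indic; exact: measurable_box.
apply: eq_Rintegral => z; rewrite inE => Bz.
by rewrite (sum_box (fun p => f z))//; exact: BQ.
Qed.

Lemma mu2_box p : fine (mu2 (box p)) = (n.+1%:R ^+ 2)^-1.
Proof.
rewrite product_measure1E//=; try exact: measurable_cset.
by rewrite !mu_cset -EFinM/= expr2 invfM.
Qed.

Lemma int_step (S A : set mR) a : measurable S -> measurable A ->
  S `<=` unit_itv -> A `<=` unit_itv ->
  \int[mu2]_(z in S `*` A) step a z = \sum_p wt S p.1 * wt A p.2 * a p.1 p.2.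
Proof.
move=> mS mA SI AI.
have mB : measurable (S `*` A) by exact: measurableX.
rewrite int_boxes//; [|exact: bmf_step|exact: sub_rect].
apply: eq_bigr => -[i j] _ /=.
have mSi : measurable (S `&` cset i) by apply: measurableI => //; exact: measurable_cset.
have mAj : measurable (A `&` cset j) by apply: measurableI => //; exact: measurable_cset.
have -> : (S `*` A) `&` box (i, j) = (S `&` cset i) `*` (A `&` cset j).
  by apply/seteqP; split => -[x y] /= [[? ?] [? ?]].
rewrite (@eq_Rintegral _ _ _ _ _ (cst (a i j))); last first.
  by move=> [x y]; rewrite inE => -[/= [_ [_ /= xi]] [_ [_ /= yj]]]; rewrite /step/= xi yj.
rewrite Rintegral_cst//=; last exact: measurableX.
rewrite product_measure1E// fineM; first by rewrite mulrC.
  by apply: mu_fin => // x [/SI].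
by apply: mu_fin => // x [/AI].
Qed.

Lemma int_square_step a :
  \int[mu2]_(z in unit_square) step a z = (n.+1%:R ^+ 2)^-1 * \sum_p a p.1 p.2.
Proof.
rewrite int_step// mulr_sumr; apply: eq_bigr => -[i j] _ /=.
have w k : wt unit_itv k = n.+1%:R^-1.
  by rewrite /wt setIidr ?mu_cset//; exact: cset_sub.
by rewrite !w expr2 invfM.
Qed.

Definition avg (f : mR * mR -> R) (i j : 'I_n.+1) : R :=
  n.+1%:R ^+ 2 * \int[mu2]_(z in box (i, j)) f z.

Lemma avg_itv (h : graphon R) i j : 0 <= avg h i j <= 1.
Proof.
have mb := measurable_box (i, j); have bs := @box_sub (i, j).
rewrite /avg mulr_ge0 ?exprn_ge0//=; last first.
  by apply: Rintegral_ge0 => z /bs/(gfun_range h)/andP[].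
have : \int[mu2]_(z in box (i, j)) h z <= \int[mu2]_(z in box (i, j)) 1.
  apply: bmf_int_le => //; [exact: bmf_graphon|exact: bmf_cst|].
  by move=> z /bs/(gfun_range h)/andP[].
rewrite Rintegral_cst// mul1r mu2_box => H.
apply: le_trans (_ : n.+1%:R ^+ 2 * (n.+1%:R ^+ 2)^-1 <= 1).
  by rewrite ler_pM2l// exprn_gt0.
by rewrite divff// expf_neq0.
Qed.

Lemma int_avg (f : mR * mR -> R) : bounded_mfun f ->
  \sum_p avg f p.1 p.2 = n.+1%:R ^+ 2 * \int[mu2]_(z in unit_square) f z.
Proof.
move=> bf; rewrite int_boxes// mulr_sumr; apply: eq_bigr => -[i j] _.
by rewrite setIidr//; exact: box_sub.
Qed.

Lemma int_box_step a p :
  \int[mu2]_(z in box p) step a z = (n.+1%:R ^+ 2)^-1 * a p.1 p.2.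
Proof.
rewrite (@eq_Rintegral _ _ _ _ _ (cst (a p.1 p.2))); last first.
  by move=> [x y]; rewrite inE => -[/= [_ /= xi] [_ /= yj]]; rewrite /step/= xi yj.
by rewrite Rintegral_cst ?mu2_box 1?mulrC//; exact: measurable_box.
Qed.

(** Averaging over cells contracts the L1 norm and fixes step functions.  Hence
    averages approximate [f] as well as any step function does, up to a factor
    of 2. *)
Lemma step_avg_contract (f : mR * mR -> R) a : bounded_mfun f ->
  \int[mu2]_(z in unit_square) `|step (avg f) z - step a z| <=
  \int[mu2]_(z in unit_square) `|f z - step a z|.
Proof.
move=> bf.
have bfa : bounded_mfun (fun z => f z - step a z) by apply: bmfB => //; exact: bmf_step.
rewrite (int_square_step (fun i j => `|avg f i j - a i j|)).
rewrite (int_boxes (bmf_norm bfa))// mulr_sumr; apply: ler_sum => p _.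
have mb := @measurable_box p; have bs := @box_sub p.
rewrite (setIidr bs) -ler_pdivlMl ?invr_gt0 ?exprn_gt0// invrK.
have -> : avg f p.1 p.2 - a p.1 p.2 =
    n.+1%:R ^+ 2 * \int[mu2]_(z in box p) (f z - step a z).
  rewrite bmf_intB//; last exact: bmf_step.
  by rewrite int_box_step mulrBr mulVKf ?expf_neq0//; case: p {mb bs}.
rewrite normrM ger0_norm ?exprn_ge0// ler_pM2l ?exprn_gt0//.
exact: bmf_int_norm.
Qed.

End grid.

(** * Convergence of cell averages *)

Section step_approximation.
Context {R : realType}.
Local Notation mR := (measurableTypeR R).
Local Notation mu := (@lebesgue_measure R).
Local Notation mu2 := (leb2 R).
Implicit Types (f g : mR * mR -> R) (E : set (mR * mR)).
Let mQ := @measurable_unit_square R.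
Let mI := @measurable_unit_itv R.

(** Approximable in L1 by step functions on every fine enough grid.  This is stable
    under limits and linear combinations; a priori it is not clear for the
    averages themselves, but [step_avg_contract] reduces them to it. *)
Definition steppable f : Prop := forall e : R, 0 < e ->
  exists n0 : nat, forall n, (n0 <= n)%N ->
  exists a : 'I_n.+1 -> 'I_n.+1 -> R,
    \int[mu2]_(z in unit_square) `|f z - step a z| <= e.

Lemma steppable_eq f g : {in unit_square, f =1 g} -> steppable f -> steppable g.
Proof.
move=> fg sf e /sf[n0 Hn]; exists n0 => n /Hn[a Ha]; exists a.
apply: le_trans Ha; rewrite le_eqVlt; apply/orP; left; apply/eqP.
by apply: eq_Rintegral => z Qz; rewrite fg.
Qed.

Lemma steppable_cst (c : R) : steppable (cst c).
Proof.
move=> e e0; exists 0%N => n _; exists (fun _ _ => c).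
rewrite (_ : (fun z => _) = cst 0); first by rewrite Rintegral_cst// mul0r ltW.
by apply/funext => z; rewrite /step subrr normr0.
Qed.

Lemma int_square_normD f g : bounded_mfun f -> bounded_mfun g ->
  \int[mu2]_(z in unit_square) `|f z + g z| <=
  \int[mu2]_(z in unit_square) `|f z| + \int[mu2]_(z in unit_square) `|g z|.
Proof.
move=> bf bg; rewrite -bmf_intD//; try exact: bmf_norm.
apply: bmf_int_le => //; first by apply: bmf_norm; exact: bmfD.
  by apply: bmfD; exact: bmf_norm.
by move=> z _; exact: ler_normD.
Qed.

Lemma steppable_lim f : bounded_mfun f ->
  (forall e : R, 0 < e -> exists g, [/\ bounded_mfun g, steppable g &
     \int[mu2]_(z in unit_square) `|f z - g z| <= e]) ->
  steppable f.
Proof.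
move=> bf H e e0; have e20 : 0 < e / 2 by rewrite divr_gt0.
have [g [bg sg fg]] := H _ e20; have [n0 Hn] := sg _ e20.
exists n0 => n /Hn[a ga]; exists a.
have -> : (fun z => `|f z - step a z|) = (fun z => `|(f z - g z) + (g z - step a z)|).
  by apply/funext => z; rewrite addrA subrK.
apply: le_trans (int_square_normD _ _) _; last by lra.
  exact: bmfB.
by apply: bmfB => //; exact: bmf_step.
Qed.

Lemma steppableD f g : bounded_mfun f -> bounded_mfun g ->
  steppable f -> steppable g -> steppable (fun z => f z + g z).
Proof.
move=> bf bg sf sg e e0; have e20 : 0 < e / 2 by rewrite divr_gt0.
have [n0 Hn] := sf _ e20; have [n1 Hn1] := sg _ e20.
exists (maxn n0 n1) => n; rewrite geq_max => /andP[/Hn[a fa] /Hn1[b gb]].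
exists (fun i j => a i j + b i j).
have -> : (fun z => `|f z + g z - step (fun i j => a i j + b i j) z|) =
   (fun z => `|(f z - step a z) + (g z - step b z)|).
  by apply/funext => z; rewrite /step opprD addrACA.
apply: le_trans (int_square_normD _ _) _; last by lra.
  by apply: bmfB => //; exact: bmf_step.
by apply: bmfB => //; exact: bmf_step.
Qed.

Lemma steppableZ (c : R) f : bounded_mfun f -> steppable f -> steppable (fun z => c * f z).
Proof.
move=> bf sf e e0; have d0 : 0 < e / (1 + `|c|) by rewrite divr_gt0// ltr_pwDl.
have [n0 Hn] := sf _ d0; exists n0 => n /Hn[a fa].
exists (fun i j => c * a i j).
have -> : (fun z => `|c * f z - step (fun i j => c * a i j) z|) =
   (fun z => `|c| * `|f z - step a z|).
  by apply/funext => z; rewrite /step -mulrBr normrM.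
rewrite bmf_intZ//; last by apply: bmf_norm; apply: bmfB => //; exact: bmf_step.
apply: le_trans (ler_wpM2l _ fa) _ => //.
by rewrite mulrCA ler_piMr ?(ltW e0)// ler_pdivrMr ?ltr_pwDl// mul1r lerDr.
Qed.

Lemma steppable_sum (I : Type) (r : seq I) (F : I -> mR * mR -> R) :
  (forall i, bounded_mfun (F i)) -> (forall i, steppable (F i)) ->
  steppable (fun z => \sum_(i <- r) F i z).
Proof.
move=> bF sF; elim: r => [|i r IH].
  by apply: steppable_eq (steppable_cst 0) => z _; rewrite big_nil.
apply: (@steppable_eq (fun z => F i z + \sum_(j <- r) F j z)).
  by move=> z _; rewrite big_cons.
by apply: steppableD => //; exact: bmf_sum.
Qed.

Lemma steppable_indicD E E' : measurable E -> measurable E' -> E' `<=` E ->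
  steppable (\1_E) -> steppable (\1_E') -> steppable (\1_(E `\` E')).
Proof.
move=> mE mE' EE' sE sE'.
apply: (@steppable_eq (fun z => \1_E z + -1 * \1_E' z)).
  move=> z _; rewrite !indicE in_setD; case: (boolP (z \in E')) => zE'.
    by rewrite (mem_set (EE' _ (set_mem zE')))/= mulr1 subrr.
  by rewrite mulr0 addr0 andbT.
apply: steppableD => //; try exact: bmf_indic.
  by apply: bmfZ; exact: bmf_indic.
by apply: steppableZ => //; exact: bmf_indic.
Qed.

Lemma steppable_indicU E E' : measurable E -> measurable E' -> [disjoint E & E'] ->
  steppable (\1_E) -> steppable (\1_E') -> steppable (\1_(E `|` E')).
Proof.
move=> mE mE' /disj_setPS EE' sE sE'.
apply: (@steppable_eq (fun z => \1_E z + \1_E' z)).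
  move=> z _; rewrite !indicE in_setU; case: (boolP (z \in E)) => zE //=.
    case: (boolP (z \in E')) => zE'; last by rewrite addr0.
    by have := EE' z (conj (set_mem zE) (set_mem zE')).
  by rewrite add0r.
by apply: steppableD => //; exact: bmf_indic.
Qed.

(** Continuity of the measure along an increasing sequence. *)
Lemma steppable_indic_incr (F : nat -> set (mR * mR)) :
  (forall k, measurable (F k)) -> {homo F : i j / (i <= j)%N >-> i `<=` j} ->
  (forall k, steppable (\1_(F k))) -> steppable (\1_(\bigcup_k F k)).
Proof.
move=> mF ndF sF.
have mU : measurable (\bigcup_k F k) by exact: bigcupT_measurable.
apply: steppable_lim; first exact: bmf_indic.
move=> e e0.
pose D k := (\bigcup_k F k `&` unit_square) `\` F k.
have mD k : measurable (D k) by apply: measurableD => //; exact: measurableI.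
have : mu2 \o D @ \oo --> mu2 (\bigcap_k D k).
  apply: nonincreasing_cvg_mu => //.
  - apply: (@le_lt_trans _ _ (mu2 unit_square)).
      by rewrite le_measure ?inE// => z [[]].
    by rewrite /= leb2_unit_square ltry.
  - exact: bigcapT_measurable.
  - move=> i j ij; apply/subsetPset => z [? nz]; split => // /(ndF _ _ ij).
    exact: nz.
have -> : \bigcap_k D k = set0.
  apply/seteqP; split => // z Dz; have [[[k _ Fk] _] _] := Dz 0%N I.
  by have [_ /(_ Fk)] := Dz k I.
rewrite measure0 => /fine_cvgP[_] /cvgrPdist_le/(_ _ e0)[k _ /(_ k (leqnn _))].
rewrite /= sub0r normrN => Dk.
exists (\1_(F k)); split => //; first exact: bmf_indic.
rewrite (@eq_Rintegral _ _ _ _ _ (\1_(D k))).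
  rewrite bmf_int_indic// setIidl; last by move=> z [[]].
  exact: le_trans (ler_norm _) Dk.
move=> z Qz; rewrite !indicE /D in_setD in_setI Qz andbT.
case: (boolP (z \in F k)) => Fz /=; last by rewrite subr0 andbT ger0_norm.
by rewrite mem_set ?subrr ?normr0//; exists k => //; exact: set_mem.
Qed.

(** The pi-lambda theorem.  The map [pre] and the set [W] allow one coordinate to be
    treated at a time: first half-open intervals in both, then a measurable set
    in the first, then in the second, then all measurable sets of the plane. *)
Lemma steppable_dynkin d (U : measurableType d) (pre : mR * mR -> U) W (G : set_system U) :
  @measurable _ U = <<s G>> -> setI_closed G -> measurable W ->
  measurable_fun setT pre -> steppable (\1_W) ->
  (forall S, G S -> steppable (\1_(W `&` pre @^-1` S))) ->
  forall S, measurable S -> steppable (\1_(W `&` pre @^-1` S)).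
Proof.
move=> GE GI mW mpre sW sG S; rewrite GE.
have mp S' : measurable S' -> measurable (W `&` pre @^-1` S').
  by move=> mS'; apply: measurableI => //; rewrite -[X in measurable X]setTI; exact: mpre.
apply: (dynkin_induction (P := fun S => steppable (\1_(W `&` pre @^-1` S))) GE GI) => //.
- by rewrite preimage_setT setIT.
- move=> S' mS' sS'.
  have -> : W `&` pre @^-1` (~` S') = W `\` (W `&` pre @^-1` S').
    by rewrite setDIr setDv set0U setDE.
  by apply: steppable_indicD => //; exact: mp.
- move=> F mF tF sF.
  pose H k := \bigcup_(i < k) (W `&` pre @^-1` (F i)).
  have mH k : measurable (H k) by apply: bigcup_measurable => i _; exact: mp.
  have -> : W `&` pre @^-1` (\bigcup_k F k) = \bigcup_k H k.
    apply/seteqP; split => z.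
      by move=> [Wz [k _ Fk]]; exists k.+1 => //; exists k => //=.
    by move=> [k _ [i _ [Wz Fi]]]; split => //; exists i.
  apply: steppable_indic_incr => //.
    by move=> i j ij z [l /= li Hl]; exists l => //=; exact: leq_trans ij.
  elim=> [|k IH].
    by rewrite /H bigcup_mkord big_ord0 indic0; exact: steppable_cst.
  have -> : H k.+1 = H k `|` (W `&` pre @^-1` (F k)).
    by rewrite /H !bigcup_mkord big_ord_recr.
  apply: steppable_indicU => //; first exact: mp.
  apply/disj_setPS => z [[i /= ik [_ Fi]] [_ Fk]].
  move/trivIsetP: tF => /(_ i k I I); rewrite (ltn_eqF ik) => /(_ isT) /seteqP[+ _].
  by apply; split; [exact: Fi|exact: Fk].
Qed.

Lemma int_strip (a d : R) (B : set (mR * mR)) : 0 <= d ->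
  (B = (unit_itv `&` [set` `[a - d, a + d]]) `*` unit_itv \/
   B = unit_itv `*` (unit_itv `&` [set` `[a - d, a + d]])) ->
  measurable B /\ \int[mu2]_(z in unit_square) \1_B z <= 2 * d.
Proof.
move=> d0 HB; set J : set mR := unit_itv `&` [set` `[a - d, a + d]].
have mJ0 : measurable ([set` `[a - d, a + d]] : set mR) by exact: measurable_itv.
have mJ : measurable J by exact: measurableI.
have muJ : (mu J <= (2 * d)%:E)%E.
  apply: (@le_trans _ _ (mu [set` `[a - d, a + d]])); first by rewrite le_measure ?inE//; exact: subIsetr.
  have -> := @lebesgue_measure_itv R `[a - d, a + d].
  rewrite /= lte_fin; case: ifP => _; last by rewrite lee_fin mulr_ge0.
  by rewrite -EFinB lee_fin; lra.
have mB : measurable B by case: HB => ->; exact: measurableX.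
split=> //; rewrite bmf_int_indic// setIidl; last first.
  by case: HB => ->; apply: sub_rect => // x [].
have -> : mu2 B = mu J.
  by case: HB => ->; rewrite product_measure1E//= ?leb_unit_itv ?mule1 ?mul1e.
rewrite -lee_fin fineK// ge0_fin_numE//.
by rewrite (le_lt_trans muJ)// ltry.
Qed.

(** Sampling the indicator of an interval at the right end of each cell is wrong
    only within distance [n.+1^-1] of its endpoints. *)
Lemma oc_step n (a b x : R) : unit_itv x ->
  `| (x \in `]a, b])%:R - ((cell n x).+1%:R / n.+1%:R \in `]a, b])%:R | <=
  (x \in `[a - n.+1%:R^-1, a + n.+1%:R^-1])%:R +
  (x \in `[b - n.+1%:R^-1, b + n.+1%:R^-1])%:R :> R.
Proof.
move=> Ix; have [_ _ x1] := (csetE (cell n x) x).1 (@cset_cell R n x Ix).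
have x0 : (cell n x).+1%:R / n.+1%:R - n.+1%:R^-1 <= x.
  rewrite -[X in _ - X]mul1r -mulrBl -natr1 addrK.
  have [c0|c0] := posnP (cell n x).
    by rewrite c0 mul0r; move: Ix; rewrite /unit_itv/= in_itv/= => /andP[].
  by have [_ /(_ c0)/ltW] := (csetE (cell n x) x).1 (@cset_cell R n x Ix).
move: ((cell n x).+1%:R / n.+1%:R) x0 x1 => y x0 x1.
have i0 : 0 < n.+1%:R^-1 :> R by rewrite invr_gt0.
move: (n.+1%:R^-1) i0 x0 => d i0 x0.
rewrite !in_itv/=.
case: (boolP (a - d <= x <= a + d)) => [_|A].
  by case: (_ && _); case: (_ && _); case: (_ && _);
    rewrite /= ?subrr ?subr0 ?sub0r ?normrN ?normr0 ?normr1; lra.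
case: (boolP (b - d <= x <= b + d)) => [_|B].
  by case: (_ && _); case: (_ && _);
    rewrite /= ?subrr ?subr0 ?sub0r ?normrN ?normr0 ?normr1; lra.
have -> : (a < x) = (a < y).
  apply/idP/idP => h; first by lra.
  by rewrite ltNge; apply: contra A => h'; apply/andP; split; lra.
have -> : (x <= b) = (y <= b).
  apply/idP/idP => h; last by lra.
  by rewrite leNgt; apply: contra B => h'; apply/andP; split; lra.
by rewrite subrr normr0 addr0.
Qed.

Lemma steppable_ocitv (a b a' b' : R) :
  steppable (\1_([set` `]a, b]] `*` [set` `]a', b']] : set (mR * mR))).
Proof.
move=> e e0; exists (Num.truncn (8 / e)) => n nn.
have ne : 8 * n.+1%:R^-1 <= e.
  rewrite ler_pdivrMr ?ltr0n// mulrC -ler_pdivrMr//.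
  apply: ltW; apply: lt_le_trans (truncnS_gt _) _.
  by rewrite ler_nat.
pose d := n.+1%:R^-1 : R; have d0 : 0 <= d by rewrite invr_ge0.
pose s (a b : R) (i : 'I_n.+1) : R := (i.+1%:R / n.+1%:R \in `]a, b])%:R.
exists (fun i j => s a b i * s a' b' j).
pose J (c : R) : set mR := unit_itv `&` [set` `[c - d, c + d]].
have [m1 h1] := @int_strip a d (J a `*` unit_itv) d0 (or_introl erefl).
have [m2 h2] := @int_strip b d (J b `*` unit_itv) d0 (or_introl erefl).
have [m3 h3] := @int_strip a' d (unit_itv `*` J a') d0 (or_intror erefl).
have [m4 h4] := @int_strip b' d (unit_itv `*` J b') d0 (or_intror erefl).
apply: (@le_trans _ _ (\int[mu2]_(z in unit_square)
  ((\1_(J a `*` unit_itv) z + \1_(J b `*` unit_itv) z) +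
   (\1_(unit_itv `*` J a') z + \1_(unit_itv `*` J b') z)))).
  apply: bmf_int_le => //.
  - apply: bmf_norm; apply: bmfB; last exact: bmf_step.
    by apply: bmf_indic; apply: measurableX; exact: measurable_itv.
  - by apply: bmfD; apply: bmfD; exact: bmf_indic.
  move=> [x y] [/= Ix Iy].
  have H1 := @oc_step n a b x Ix; have H2 := @oc_step n a' b' y Iy.
  have -> : \1_(J a `*` unit_itv) (x, y) = (x \in `[a - d, a + d])%:R :> R.
    rewrite indicE; congr (_ : bool)%:R; apply/idP/idP.
      by rewrite inE => -[[_ +] _].
    by move=> h; rewrite inE; split.
  have -> : \1_(J b `*` unit_itv) (x, y) = (x \in `[b - d, b + d])%:R :> R.
    rewrite indicE; congr (_ : bool)%:R; apply/idP/idP.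
      by rewrite inE => -[[_ +] _].
    by move=> h; rewrite inE; split.
  have -> : \1_(unit_itv `*` J a') (x, y) = (y \in `[a' - d, a' + d])%:R :> R.
    rewrite indicE; congr (_ : bool)%:R; apply/idP/idP.
      by rewrite inE => -[_ [_ +]].
    by move=> h; rewrite inE; split.
  have -> : \1_(unit_itv `*` J b') (x, y) = (y \in `[b' - d, b' + d])%:R :> R.
    rewrite indicE; congr (_ : bool)%:R; apply/idP/idP.
      by rewrite inE => -[_ [_ +]].
    by move=> h; rewrite inE; split.
  have -> : \1_([set` `]a, b]] `*` [set` `]a', b']]) (x, y) =
     (x \in `]a, b])%:R * (y \in `]a', b'])%:R :> R.
    rewrite indicE -natrM mulnb; congr (_ : bool)%:R; apply/idP/andP.
      by rewrite inE => -[/= -> ->].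
    by move=> [h1' h2']; rewrite inE; split.
  apply: le_trans _ (lerD H1 H2).
  have key (p q r t : bool) : `|p%:R * q%:R - r%:R * t%:R| <= `|p%:R - r%:R| + `|q%:R - t%:R| :> R.
    case: p q r t => [] [] [] [];
      rewrite /= ?(mulr1, mulr0, subrr, normr0, subr0, sub0r, normrN, normr1); lra.
  exact: key.
rewrite !bmf_intD//; try (by apply: bmfD; exact: bmf_indic); try exact: bmf_indic.
rewrite -/d in ne; lra.
Qed.

Lemma measurable_ocitvE : @measurable _ mR = <<s @ocitv R>>.
Proof. by []. Qed.

Let unit_oc x : unit_itv x -> x \in `]-1, 1 : R].
Proof.
rewrite /unit_itv/= !in_itv/= => /andP[x0 x1]; rewrite x1 andbT.
by apply: lt_le_trans x0; rewrite ltrN10.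
Qed.

Lemma steppable_oc_rect (S : set mR) (a b : R) : measurable S ->
  steppable (\1_(S `*` [set` `]a, b]])).
Proof.
move=> mS; have mab : measurable ([set` `]a, b]] : set mR) by exact: measurable_itv.
have -> : S `*` [set` `]a, b]] = (setT `*` [set` `]a, b]]) `&` fst @^-1` S.
  by apply/seteqP; split => z; [case|move=> [[_ ?] ?]; split].
apply: (steppable_dynkin measurable_ocitvE (@ocitvI R)) => //.
- by apply: measurableX.
- apply: (@steppable_eq (\1_([set` `]-1, 1]] `*` [set` `]a, b]]))); last exact: steppable_ocitv.
  move=> [x y]; rewrite inE => -[/= /unit_oc Ix _]; rewrite !indicE; congr (_ : bool)%:R.
  by apply/idP/idP; rewrite !inE => -[/= ? ?]; split.
- move=> _ [[c d] _ <-].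
  apply: steppable_eq (steppable_ocitv c d a b) => z _; congr (\1__ z).
  by apply/seteqP; split => z'; [case|move=> [[_ ?] ?]; split].
Qed.

Lemma steppable_rect (S A : set mR) : measurable S -> measurable A ->
  steppable (\1_(S `*` A)).
Proof.
move=> mS mA.
have -> : S `*` A = (S `*` setT) `&` snd @^-1` A.
  by apply/seteqP; split => z; [case|move=> [[? _] ?]; split].
apply: (steppable_dynkin measurable_ocitvE (@ocitvI R)) => //.
- by apply: measurableX.
- apply: (@steppable_eq (\1_(S `*` [set` `]-1, 1]]))); last exact: steppable_oc_rect.
  move=> [x y]; rewrite inE => -[/= _ /unit_oc Iy]; rewrite !indicE; congr (_ : bool)%:R.
  by apply/idP/idP; rewrite !inE => -[/= ? ?]; split.
- move=> _ [[c d] _ <-].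
  apply: steppable_eq (steppable_oc_rect c d mS) => z _; congr (\1__ z).
  by apply/seteqP; split => z'; [case|move=> [[? _] ?]; split].
Qed.

Lemma steppable_indic E : measurable E -> steppable (\1_E).
Proof.
move=> mE; have -> : E = setT `&` id @^-1` E by rewrite setTI.
apply: (steppable_dynkin (measurable_prod_measurableType mR mR)) => //.
- move=> _ _ [A mA [B mB <-]] [C mC [D mD <-]].
  exists (A `&` C); first exact: measurableI.
  exists (B `&` D); first exact: measurableI.
  by apply/seteqP; split => -[x y] /= [[? ?] [? ?]].
- by rewrite indicT; exact: steppable_cst.
- by move=> _ [A mA [B mB <-]]; rewrite setTI; exact: steppable_rect.
Qed.

Lemma sum_ltn_nat m t : (t <= m)%N -> (\sum_(k < m) (k < t))%N = t.
Proof.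
elim: m t => [|m IH] t; first by rewrite leqn0 big_ord0 => /eqP.
rewrite big_ord_recr/= leq_eqVlt => /predU1P[->|tm].
  rewrite ltnSn (eq_bigr (fun=> 1%N)) ?sum1_card ?card_ord ?addn1// => i _.
  by rewrite (ltn_trans (ltn_ord i)).
by rewrite IH// ltnNge -ltnS tm addn0.
Qed.

(** Layer-cake decomposition: [h] is within [m^-1] of the average of the indicators
    of [h >= k / m], for [k] from 1 to [m]. *)
Lemma steppable_graphon (h : graphon R) : steppable h.
Proof.
apply: steppable_lim; first exact: bmf_graphon.
move=> e e0; pose m := (Num.truncn e^-1).+1.
have m0 : 0 < m%:R :> R by rewrite ltr0n.
have me : m%:R^-1 <= e by rewrite invf_ple ?posrE// ltW// truncnS_gt.
pose E (k : nat) : set (mR * mR) := unit_square `&` h @^-1` [set` `[k.+1%:R / m%:R, +oo[].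
have mE k : measurable (E k) by apply: gfun_meas => //; exact: measurable_itv.
have bE k : bounded_mfun (fun z => m%:R^-1 * \1_(E k) z).
  by apply: bmfZ; exact: bmf_indic.
exists (fun z => \sum_(k < m) m%:R^-1 * \1_(E k) z); split.
- by apply: bmf_sum => k.
- apply: steppable_sum => // k; apply: steppableZ; first exact: bmf_indic.
  exact: steppable_indic.
rewrite -[leRHS]int_square_cst; apply: bmf_int_le => //.
- by apply: bmf_norm; apply: bmfB; [exact: bmf_graphon|exact: bmf_sum].
- exact: bmf_cst.
move=> z Qz; apply: le_trans me; have /andP[u0 u1] := gfun_range h Qz.
set u := h z in u0 u1 *; set t := Num.truncn (m%:R * u).
have mu0 : 0 <= m%:R * u by rewrite mulr_ge0// ltW.
have tm : (t <= m)%N.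
  by rewrite -(ler_nat R) (le_trans (_ : _ <= m%:R * u))// ?truncn_le// ler_piMr// ltW.
have -> : \sum_(k < m) m%:R^-1 * \1_(E k) z = m%:R^-1 * t%:R :> R.
  rewrite -mulr_sumr; congr (_ * _).
  rewrite -[in RHS](sum_ltn_nat tm) natr_sum; apply: eq_bigr => k _.
  rewrite indicE; congr (_ : bool)%:R; rewrite /t truncn_ge_nat//.
  rewrite -ler_pdivrMl// mulrC; apply/idP/idP.
    by rewrite inE => -[_ /=]; rewrite in_itv/= andbT.
  by move=> h1; rewrite inE; split => //=; rewrite in_itv/= andbT.
have -> : u - m%:R^-1 * t%:R = m%:R^-1 * (m%:R * u - t%:R).
  by rewrite mulrBr mulKf ?gt_eqF.
rewrite normrM gtr0_norm ?invr_gt0// ler_piMr ?invr_ge0 ?(ltW m0)//.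
have := truncn_itv mu0; rewrite -/t -natr1 => /andP[t0 t1].
by rewrite ler_norml; apply/andP; split; lra.
Qed.

Lemma avg_converges (h : graphon R) (e : R) : 0 < e ->
  exists n0 : nat, forall n, (n0 <= n)%N ->
    \int[mu2]_(z in unit_square) `|h z - step (@avg R n h) z| <= e.
Proof.
move=> e0; have e20 : 0 < e / 2 by rewrite divr_gt0.
have bh := bmf_graphon h.
have [n0 Hn] := steppable_graphon h e20; exists n0 => n /Hn[a Ha].
have -> : (fun z => `|h z - step (@avg R n h) z|) =
    (fun z => `|(h z - step a z) + (step a z - step (@avg R n h) z)|).
  by apply/funext => z; rewrite addrA subrK.
have bs (b : 'I_n.+1 -> 'I_n.+1 -> R) := bmf_step b.
apply: le_trans (int_square_normD _ _) _; try exact: bmfB.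
under [X in _ + X]eq_Rintegral do rewrite distrC.
have := step_avg_contract a bh; lra.
Qed.

End step_approximation.

(** * Counting graphs from below *)

Section lower_count.
Context {R : realType}.

Lemma eventually_natr_ge (B : R) : exists n0 : nat, forall n, (n0 <= n)%N -> B <= n%:R.
Proof.
exists (Num.truncn B).+1 => n nn; apply/ltW/(lt_le_trans (truncnS_gt B)).
by rewrite ler_nat.
Qed.

(** The sign [s] gives both sides of the deviation inequality from the one-sided
    bound [off_diag_dev_tail]. *)
Definition rect_weight n (s : R) (k : {set 'I_n} * {set 'I_n}) (i j : 'I_n) : R :=
  s * ((i, j) \in finset.setX k.1 k.2)%:R.

(** The diagonal contributes at most [n] to any rectangle. *)
Lemma rectangle_dev_le n (v : 'I_n -> 'I_n -> R) (G : sgraph n) (e : R) :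
  (forall i j, 0 <= v i j <= 1) -> n%:R <= e ->
  (forall k, off_diag_dev v (rect_weight 1 k) G <= e) ->
  (forall k, off_diag_dev v (rect_weight (-1) k) G <= e) ->
  forall Y, rectangle Y ->
  `|\sum_(p in Y) ((adj G p.1 p.2)%:R - v p.1 p.2)| <= e + e.
Proof.
move=> v01 ne H1 H2 _ [S [A ->]].
have E s : off_diag_dev v (rect_weight s (S, A)) G =
  s * \sum_(p in finset.setX S A | p.1 != p.2) ((adj G p.1 p.2)%:R - v p.1 p.2).
  rewrite /off_diag_dev /rect_weight mulr_sumr [RHS]big_mkcondl/=.
  apply: eq_bigr => -[i j] _ /=.
  by case: (_ \in _); rewrite ?mulr1 ?mulr0 ?mul0r.
have := H1 (S, A); have := H2 (S, A); rewrite !E mulN1r mul1r => h2 h1.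
rewrite (bigID (fun p : 'I_n * 'I_n => p.1 != p.2))/=.
apply: le_trans (ler_normD _ _) _; apply: lerD.
  by rewrite ler_norml lerNl h2 h1.
apply: le_trans ne; apply: le_trans (ler_norm_sum _ _ _) _.
apply: (@le_trans _ _ (\sum_(p : 'I_n * 'I_n | p.1 == p.2) (1 : R))).
  rewrite [leLHS]big_mkcondl/=.
  apply: (@le_trans _ _ (\sum_(p : 'I_n * 'I_n | ~~ (p.1 != p.2)) (1 : R))).
    apply: ler_sum => -[i j] /= _; case: ifP => // _.
    have /andP[? ?] := v01 i j; case: (adj G i j);
    by rewrite /= ler_norml; apply/andP; split; lra.
  by rewrite le_eqVlt; apply/orP; left; apply/eqP; apply: eq_bigl => p; rewrite negbK.
rewrite (reindex_onto (fun i : 'I_n => (i, i)) (@fst _ _))/=; last first.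
  by move=> [i j]/= /eqP ->.
under eq_bigl do rewrite !eqxx.
by rewrite sumr_const card_ord.
Qed.

Lemma partition_function_exp n (l : 'I_n -> 'I_n -> R) : (forall i j, l i j = l j i) ->
  \sum_(G : sgraph n) edge_weight l G =
  expR (\sum_(p : 'I_n * 'I_n | p.1 != p.2) logpart (l p.1 p.2)).
Proof.
move=> lC; rewrite sgraph_partition off_diagE expR_sum.
apply: eq_bigr => -[i j] /= _; rewrite (lC j i) /logpart -mulrDl.
have -> : (2^-1 + 2^-1 : R) = 1 by field.
rewrite mul1r lnK ?posrE ?addr_gt0 ?expR_gt0//.
by rewrite mulr2n mulrDl mul1r.
Qed.

(** Under the law with independent edges, [S] (the graphs where all rectangle sums
    and the log-likelihood are close to their means) has probability at least
    1/2, by [off_diag_dev_tail] and a union bound over [4^n] rectangles.  Each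
    graph in [S] has a probability close to the exponential of the mean
    log-likelihood, so there must be many of them. *)
Lemma graph_count_ge (K e : R) : 1 <= K -> 0 < e <= 1 ->
  exists n0 : nat, forall n, (n0 <= n)%N -> forall l : 'I_n -> 'I_n -> R,
  (forall i j, l i j = l j i) -> (forall i j, `|l i j| <= K) ->
  let v i j := logistic (l i j) in
  exists S : {set sgraph n},
  (forall G, G \in S -> forall Y, rectangle Y ->
     `|\sum_(p in Y) ((adj G p.1 p.2)%:R - v p.1 p.2)| <= 2 * e * n%:R ^+ 2) /\
  expR (- (\sum_(p : 'I_n * 'I_n | p.1 != p.2)
      (l p.1 p.2 * v p.1 p.2 - logpart (l p.1 p.2))) - 2 * e * n%:R ^+ 2)
  <= #|S|%:R.
Proof.
move=> K1 /andP[e0 e1].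
set k1 := e ^+ 2 / (32 * K ^+ 2); set k2 := e ^+ 2 / (32 * 1 ^+ 2).
have K0 : 0 < K by lra.
have k10 : 0 < k1 by rewrite divr_gt0 ?exprn_gt0// mulr_gt0// exprn_gt0.
have k20 : 0 < k2 by rewrite divr_gt0 ?exprn_gt0// mulr_gt0// exprn_gt0.
have [na Ha] := eventually_natr_ge (1 + e^-1 + e^-1 * ln 2).
have [nb Hb] := eventually_natr_ge (k1^-1 * ln 4).
have [nc Hc] := eventually_natr_ge (k2^-1 * (ln 4 + ln 8)).
exists (maxn na (maxn nb nc)) => n; rewrite !geq_max => /and3P[/Ha {}Ha /Hb {}Hb /Hc {}Hc].
move=> l lC lK v.
set N := n%:R ^+ 2 : R.
have ln2 : 0 <= ln 2 :> R by rewrite ln_ge0// ler1n.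
have ei0 : 0 < e^-1 by rewrite invr_gt0.
have n1 : 1 <= n%:R :> R.
  by apply: le_trans Ha; rewrite -addrA lerDl addr_ge0 ?mulr_ge0// ltW.
have nN : n%:R <= N by rewrite /N expr2 ler_peMl//; lra.
have v01 i j : 0 <= v i j <= 1 by have /andP[/ltW -> /ltW ->] := logistic_itv (l i j).
have neN : n%:R <= e * N.
  rewrite /N expr2 mulrA ler_peMl//.
  rewrite -ler_pdivrMl// mulr1; apply: le_trans Ha.
  by rewrite addrAC lerDr addr_ge0 ?mulr_ge0// ltW.
pose T := ({set 'I_n} * {set 'I_n})%type.
pose bad0 : {set sgraph n} := [set G | e * N <= off_diag_dev v l G]%SET.
pose bad (s : R) (k : T) : {set sgraph n} := [set G | e * N <= off_diag_dev v (rect_weight s k) G]%SET.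
pose S : {set sgraph n} := ~: (bad0 :|: \bigcup_k bad 1 k :|: \bigcup_k bad (-1) k)%SET.
exists S.
have SP G : G \in S -> [/\ off_diag_dev v l G < e * N,
   forall k, off_diag_dev v (rect_weight 1 k) G <= e * N &
   forall k, off_diag_dev v (rect_weight (-1) k) G <= e * N].
  rewrite !inE !negb_or -!andbA -ltNge => /and3P[g0 g1 g2]; split => // k.
    rewrite leNgt; apply: contra g1 => h; apply/bigcupP; exists k => //.
    by rewrite inE ltW.
  rewrite leNgt; apply: contra g2 => h; apply/bigcupP; exists k => //.
  by rewrite inE ltW.
split.
  move=> G /SP[_ G1 G2] Y rY.
  by rewrite -mulrA mulr2n mulrDl !mul1r; exact: (rectangle_dev_le v01 neN G1 G2).
set Z := \sum_(G : sgraph n) edge_weight l G.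
have Z0 : 0 < Z by rewrite /Z partition_function_exp// expR_gt0.
have w0 G : 0 <= edge_weight l G by exact: expR_ge0.
have half : 2^-1 * Z <= \sum_(G in S) edge_weight l G.
  have b0 : \sum_(G in bad0) edge_weight l G <= 4^-1 * Z.
    under eq_bigl do rewrite inE.
    apply: le_trans (off_diag_dev_tail lC K0 lK e0 _) _; first by lra.
    rewrite ler_pM2r// -[leRHS]lnK ?posrE// lnV ?posrE// ler_expR mulNr lerN2.
    rewrite -ler_pdivrMl//; exact: le_trans nN.
  have bk s k : `|s| = 1 -> \sum_(G in bad s k) edge_weight l G <= expR (- k2 * N) * Z.
    move=> s1; under eq_bigl do rewrite inE.
    apply: off_diag_dev_tail => //; last by lra.
    move=> i j; rewrite /rect_weight normrM s1 mul1r.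
    by case: (_ \in _); rewrite ?normr1 ?normr0.
  have bU s : `|s| = 1 -> \sum_(G in (\bigcup_k bad s k)%SET) edge_weight l G <= 8^-1 * Z.
    move=> s1.
    apply: (@le_trans _ _ (\sum_k \sum_(G in bad s k) edge_weight l G)).
      rewrite [leLHS]big_mkcond/=.
      under [leRHS]eq_bigr do rewrite big_mkcond.
      rewrite exchange_big/=; apply: ler_sum => G _.
      case: ifPn => [/bigcupP[k _ Gk]|_]; last by apply: sumr_ge0 => k _; case: ifP.
      rewrite (bigD1 k)//= Gk lerDl; apply: sumr_ge0 => k' _.
      by case: ifP.
    apply: le_trans (ler_sum _ (fun k _ => bk s k s1)) _.
    have cs : #|{: {set 'I_n}}| = (2 ^ n)%N.
      by have := card_powerset [set: 'I_n]%SET; rewrite finset.powersetT !cardsT card_ord.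
    rewrite sumr_const card_prod !cs -[_ *+ _]mulr_natl mulrA ler_pM2r//.
    rewrite -expnD addnn -mul2n expnM natrX.
    have -> : (2 ^ 2)%:R ^+ n = expR (n%:R * ln 4) :> R.
      by rewrite mulrC expRM_natr lnK// posrE.
    rewrite -expRD -[leRHS]lnK ?posrE// lnV ?posrE// ler_expR mulNr.
    have h : ln 4 + ln 8 <= k2 * n%:R by rewrite -ler_pdivrMl.
    have := ler_wpM2l (ler0n R n) h.
    have : 0 <= ln 8 :> R by rewrite ln_ge0// ler1n.
    by rewrite /N; nra.
  have ZE : Z = \sum_(G in S) edge_weight l G + \sum_(G in ~: S) edge_weight l G.
    rewrite /Z (bigID (mem S))/=; congr (_ + _).
    by apply: eq_bigl => G; exact/esym/finset.in_setC.
  have : \sum_(G in ~: S) edge_weight l G <= \sum_(G in bad0) edge_weight l G +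
     \sum_(G in (\bigcup_k bad 1 k)%SET) edge_weight l G +
     \sum_(G in (\bigcup_k bad (-1) k)%SET) edge_weight l G.
    rewrite ![X in _ <= X + _ + _]big_mkcond ![X in _ <= _ + X + _]big_mkcond
       ![X in _ <= _ + _ + X]big_mkcond [leLHS]big_mkcond -!big_split/=.
    apply: ler_sum => G _; rewrite finset.setCK !inE.
    have := w0 G.
    by case: (e * N <= _); case: (G \in _); case: (G \in _) => /= ?; lra.
  have := bU 1 (normr1 _); have := bU (-1) _; rewrite normrN normr1 => /(_ erefl).
  lra.
set W := \sum_(p : 'I_n * 'I_n | p.1 != p.2) (l p.1 p.2 * v p.1 p.2 - logpart (l p.1 p.2)).
have up : \sum_(G in S) edge_weight l G <= #|S|%:R * (Z * expR (e * N + W)).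
  rewrite -sum1_card natr_sum mulr_suml; apply: ler_sum => G /SP[G1 _ _].
  rewrite mul1r /Z partition_function_exp// -expRD ler_expR.
  move: G1; rewrite /off_diag_dev /W; under eq_bigr do rewrite mulrBr.
  rewrite !sumrB.
  have -> : \sum_(p : 'I_n * 'I_n) l p.1 p.2 * (adj G p.1 p.2)%:R =
    \sum_(p : 'I_n * 'I_n | p.1 != p.2) l p.1 p.2 * (adj G p.1 p.2)%:R.
    rewrite [RHS]big_mkcond; apply: eq_bigr => -[i j] _ /=.
    by case: eqVneq => //= ->; rewrite adj_irrefl mulr0.
  lra.
have {half up} : 2^-1 <= #|S|%:R * expR (e * N + W).
  have := le_trans half up; by rewrite mulrCA [leRHS]mulrC ler_pM2r.
rewrite -ler_pdivrMr ?expR_gt0// -expRN => h; apply: le_trans h.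
have -> : 2^-1 = expR (- ln 2) :> R by rewrite expRN lnK// posrE.
rewrite -expRD ler_expR.
have : ln 2 <= e * N.
  apply: (@le_trans _ _ (e * n%:R)); last by rewrite ler_pM2l.
  rewrite -ler_pdivrMl//; apply: le_trans Ha.
  by rewrite lerDr addr_ge0// ltW.
rewrite -/N; lra.
Qed.

End lower_count.

(** * Graphs as step graphons *)

Section step_graphons.
Context {R : realType}.
Local Notation mR := (measurableTypeR R).
Local Notation mu2 := (leb2 R).
Let mQ := @measurable_unit_square R.
Let mI := @measurable_unit_itv R.

(** The symmetry of [h] and of the product measure; it makes cell averages symmetric. *)
Lemma int_swap (h : graphon R) (S A : set mR) : measurable S -> measurable A ->
  S `<=` unit_itv -> A `<=` unit_itv ->
  \int[mu2]_(z in S `*` A) h z = \int[mu2]_(z in A `*` S) h z.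
Proof.
move=> mS mA SI AI.
pose phi (z : mR * mR) := (z.2, z.1).
have mphi : measurable_fun setT phi.
  by apply: measurable_fun_pair; [exact: measurable_snd|exact: measurable_fst].
pose F : mR * mR -> \bar R := (EFin \o h) \_ unit_square.
have mF : measurable_fun setT F.
  apply/(measurable_restrictT _ _).1; first exact: mQ.
  by have /integrableP[] := integrable_graphon h mQ (@subset_refl _ _).
have mB : measurable (S `*` A) by exact: measurableX.
have mB' : measurable (A `*` S) by exact: measurableX.
have preB : phi @^-1` (A `*` S) = S `*` A.
  by apply/seteqP; split => -[x y] /= [].
have FphiE : {in S `*` A, (EFin \o h) =1 F \o phi}.
  move=> [x y]; rewrite inE => -[/= /SI Ix /AI Iy].
  by rewrite /F patchE mem_set//= gfun_sym.
have iF : mu2.-integrable (phi @^-1` (A `*` S)) (F \o phi).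
  rewrite preB; apply: (eq_integrable mB _ _ FphiE).
  exact: (integrable_graphon h mB (sub_rect SI AI)).
have mpres (X : set (mR * mR)) : measurable X ->
    mu2 X = pushforward mu2 phi X.
  pose mphi_mixin := isMeasurableFun.Build _ _ _ _ _ mphi.
  pose mphi_pack : {mfun _ >-> _} := HB.pack phi mphi_mixin.
  move=> mX; rewrite (_ : phi = mphi_pack)//.
  apply: product_measure_unique => // C D mC mD.
  rewrite /= /pushforward.
  rewrite (_ : _ @^-1` _ = D `*` C); last first.
    by apply/seteqP; split => -[x y] /= [].
  by rewrite product_measure1E// muleC.
congr fine.
transitivity (\int[mu2]_(z in S `*` A) (F \o phi) z)%E.
  by apply: eq_integral => z zB; rewrite -FphiE.
rewrite -preB; transitivity
    (\int[pushforward mu2 phi]_(z in A `*` S) F z)%E.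
  exact/esym/(integral_pushforward mphi mF iF mB').
transitivity (\int[mu2]_(z in A `*` S) F z)%E.
  by apply: eq_measure_integral => X mX _; exact/esym/mpres.
apply: eq_integral => z; rewrite inE => /(sub_rect AI SI) Qz.
by rewrite /F patchE mem_set.
Qed.

Lemma avg_sym n (h : graphon R) (i j : 'I_n.+1) : avg h i j = avg h j i.
Proof.
by rewrite /avg /box/= int_swap//; (exact: measurable_cset || exact: cset_sub).
Qed.

Section step_graphon.
Variables (n : nat) (a : 'I_n.+1 -> 'I_n.+1 -> R).
Hypotheses (aC : forall i j, a i j = a j i) (a01 : forall i j, 0 <= a i j <= 1).

Definition step_graphon : graphon R :=
  @Graphon R (step a) (bmf_step a).1 (fun _ _ _ _ => aC _ _) (fun _ _ => a01 _ _).

End step_graphon.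

Definition adj_mx n (G : sgraph n) (i j : 'I_n) : R := (adj G i j)%:R.

Lemma adj_mxC n (G : sgraph n) i j : adj_mx G i j = adj_mx G j i.
Proof. by rewrite /adj_mx adj_sym. Qed.

Lemma adj_mx01 n (G : sgraph n) i j : 0 <= adj_mx G i j <= 1.
Proof. by rewrite /adj_mx; case: adj; rewrite ?lexx ler01. Qed.

Definition graph_step n (G : sgraph n.+1) : graphon R :=
  step_graphon (adj_mxC G) (adj_mx01 G).

(** The axes are null sets.  They matter because the cells are half-open: 0 belongs
    to no cell of [graph_graphon]. *)
Lemma cutdist_off_axes (f g : graphon R) :
  (forall x y : mR, unit_itv x -> unit_itv y -> 0 < (x : R) -> 0 < (y : R) ->
     f (x, y) = g (x, y)) ->
  cutdist f g = 0.
Proof.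
move=> fg; apply/eqP; rewrite eq_le cutdist_ge0 andbT.
apply: le_trans (cutdist_le_int f g) _.
pose J : set mR := unit_itv `&` [set` `[0 - 0, 0 + 0]].
have [m1 h1] := @int_strip R 0 0 (J `*` unit_itv) (lexx _) (or_introl erefl).
have [m2 h2] := @int_strip R 0 0 (unit_itv `*` J) (lexx _) (or_intror erefl).
apply: (@le_trans _ _ (\int[mu2]_(z in unit_square)
  (\1_(J `*` unit_itv) z + \1_(unit_itv `*` J) z))); last first.
  by rewrite bmf_intD//; [lra|exact: bmf_indic|exact: bmf_indic].
apply: bmf_int_le => //.
- by apply: bmf_norm; apply: bmfB; exact: bmf_graphon.
- by apply: bmfD; exact: bmf_indic.
move=> [x y] Qz; have [/= Ix Iy] := Qz.
have p0 (B : set (mR * mR)) : 0 <= (\1_B (x, y) : R) by rewrite indicE.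
have fg1 : `|f (x, y) - g (x, y)| <= 1.
  have /andP[? ?] := gfun_range f Qz; have /andP[? ?] := gfun_range g Qz.
  by rewrite ler_norml; apply/andP; split; lra.
have Jz (t : mR) : unit_itv t -> ~ (0 < (t : R)) -> J t.
  move=> It t0; split => //=; rewrite in_itv/= subr0 addr0.
  move: It; rewrite /unit_itv/= in_itv/= => /andP[-> _] /=.
  by rewrite leNgt; exact/negP.
have [x0|/(Jz _ Ix) Jx] := pselect (0 < (x : R)); last first.
  have -> : \1_(J `*` unit_itv) (x, y) = 1 :> R by rewrite indicE mem_set.
  by apply: le_trans fg1 _; rewrite lerDl.
have [y0|/(Jz _ Iy) Jy] := pselect (0 < (y : R)); last first.
  have -> : \1_(unit_itv `*` J) (x, y) = 1 :> R by rewrite indicE mem_set.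
  by apply: le_trans fg1 _; rewrite lerDr.
by rewrite fg// subrr normr0 addr_ge0.
Qed.

Lemma cutdist_graph_step n (G : sgraph n.+1) :
  cutdist (graph_graphon G) (graph_step G) = 0.
Proof.
apply: cutdist_off_axes => x y Ix Iy x0 y0 /=.
rewrite /step/= /adj_mx indicE; congr (_ : bool)%:R; apply/idP/idP.
  rewrite inE => -[i [j [Gij /=]]].
  rewrite !ceil_cell// => -[] /val_inj -> [] /val_inj ->.
  exact: Gij.
move=> Gxy; rewrite inE; exists (cell n x), (cell n y).
by split => //=; exact: ceil_cell.
Qed.

Lemma cutdist_eq0l (f f' g : graphon R) : cutdist f f' = 0 -> cutdist f g = cutdist f' g.
Proof.
move=> H; apply/eqP; rewrite eq_le; apply/andP; split.
  by have := cutdist_triangle f' f g; rewrite H add0r.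
by have := cutdist_triangle f f' g; rewrite (cutdistC f' f) H add0r.
Qed.

Lemma deltacut_eq0l (f f' g : graphon R) : cutdist f f' = 0 -> deltacut f g = deltacut f' g.
Proof.
move=> H; congr inf; apply/seteqP; split => _ [s _ <-]; exists s => //; last first.
  exact: cutdist_eq0l.
by apply/esym; exact: cutdist_eq0l.
Qed.

Lemma deltacut_ltP (f g : graphon R) (r : R) : deltacut f g < r ->
  exists s, cutdist f (gact g s) < r.
Proof.
move=> fgr; apply: contrapT => H.
suff : r <= deltacut f g by rewrite leNgt fgr.
apply: deltacut_ge => s; rewrite leNgt; apply/negP => ?.
by apply: H; exists s.
Qed.

(** Measurable rectangles act on step functions as fractional ones, so the
    combinatorial cut bound passes to the cut norm. *)
Lemma int_rect_step_le n (a b : 'I_n.+1 -> 'I_n.+1 -> R) (e : R) (S A : set mR) :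
  measurable S -> measurable A -> S `<=` unit_itv -> A `<=` unit_itv ->
  (forall Y, rectangle Y -> `|\sum_(p in Y) (a p.1 p.2 - b p.1 p.2)| <= e * n.+1%:R ^+ 2) ->
  `|\int[mu2]_(z in S `*` A) (step a z - step b z)| <= e.
Proof.
move=> mS mA SI AI H.
rewrite (int_step (fun i j => a i j - b i j))//.
have N0 : 0 < n.+1%:R :> R by rewrite ltr0n.
have w01 B : measurable B -> B `<=` unit_itv -> forall i, 0 <= n.+1%:R * @wt R n B i <= 1.
  move=> mB BI i; have /andP[w0 w1] := @wt_itv R n B i mB BI.
  by rewrite mulr_ge0// -ler_pdivlMl// mulr1.
have := fractional_cut H (w01 _ mS SI) (w01 _ mA AI).
have -> : \sum_(p : 'I_n.+1 * 'I_n.+1) n.+1%:R * wt S p.1 * (n.+1%:R * wt A p.2) * (a p.1 p.2 - b p.1 p.2) =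
   n.+1%:R ^+ 2 * \sum_(p : 'I_n.+1 * 'I_n.+1) wt S p.1 * wt A p.2 * (a p.1 p.2 - b p.1 p.2).
  by rewrite mulr_sumr; apply: eq_bigr => p _; ring.
by rewrite normrM ger0_norm ?exprn_ge0// mulrC ler_pM2r// exprn_gt0.
Qed.

End step_graphons.

(** * The number of graphs near a graphon *)

Section counting.
Context {R : realType}.
Local Notation mR := (measurableTypeR R).
Local Notation mu := (@lebesgue_measure R).
Local Notation mu2 := (leb2 R).
Let mQ := @measurable_unit_square R.
Let mI := @measurable_unit_itv R.

Definition entropy_int (h : graphon R) : R :=
  \int[mu2]_(z in unit_square) entropy (h z).

(** The integral of [entropy_ge] over a cell. *)
Lemma avg_entropy_ge n (h : graphon R) (l : R) (i j : 'I_n.+1) :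
  l * avg h i j - logpart l <= avg (fun z => entropy (h z)) i j.
Proof.
have mb := @measurable_box R n (i, j); have bs := @box_sub R n (i, j).
have N0 : 0 < n.+1%:R ^+ 2 :> R by rewrite exprn_gt0.
have H : \int[mu2]_(z in box (i, j)) (l * h z - logpart l) <=
    \int[mu2]_(z in box (i, j)) entropy (h z).
  apply: bmf_int_le => //; last by move=> z /bs/(gfun_range h); exact: entropy_ge.
    apply: bmfB; last exact: bmf_cst.
    by apply: bmfZ; exact: bmf_graphon.
  exact: bmf_entropy.
rewrite /avg; apply: le_trans (ler_wpM2l (ltW N0) H).
rewrite bmf_intB//; [|by apply: bmfZ; exact: bmf_graphon|exact: bmf_cst].
rewrite bmf_intZ//; last exact: bmf_graphon.
rewrite Rintegral_cst// mu2_box mulrBr [_ * (logpart l / _)]mulrCA divff ?gt_eqF//.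
by rewrite mulr1 mulrCA.
Qed.

Lemma avg_entropy_diag n (h : graphon R) :
  - (n.+1%:R * (2^-1 * ln 2)) <= \sum_i @avg R n (fun z => entropy (h z)) i i.
Proof.
apply: (@le_trans _ _ (\sum_(i < n.+1) - (2^-1 * ln 2))); last first.
  apply: ler_sum => i _; apply: le_trans (avg_entropy_ge h 0 i i).
  by rewrite mul0r sub0r /logpart mulr0 expR0 -natr1.
by rewrite sumrN sumr_const card_ord [X in - X <= _]mulr_natl.
Qed.

(** The graphs produced by [graph_count_ge] for the shrunk averages of [h]: by
    [entropy_shrink] and Jensen's inequality on cells ([avg_entropy_ge]) their
    number has the right exponent, and they are near [h] because the averages
    are. *)
Lemma graphs_near_ge (h : graphon R) (r e : R) : 0 < r -> 0 < e ->
  exists n0 : nat, forall n, (n0 <= n)%N ->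
  expR (n.+1%:R ^+ 2 * (- entropy_int h - e)) <=
  #|[set G : sgraph n.+1 | cutdist (graph_graphon G) h < r]%SET|%:R.
Proof.
move=> r0 e0.
have ln2 : 0 < ln 2 :> R by rewrite ln_gt0// ltr1n.
pose del := Num.min (Num.min (2^-1) (r / 4)) (e / (4 * ln 2)) : R.
have d0 : 0 < del.
  have l4 : 0 < 4 * ln 2 :> R by rewrite mulr_gt0.
  by rewrite !lt_min invr_gt0 ltr0n/= (divr_gt0 r0)//= divr_gt0.
have d1 : del <= 2^-1 by rewrite !ge_min lexx.
have dr : del <= r / 4 by rewrite !ge_min lexx orbT.
have de : del * ln 2 <= e / 4.
  by rewrite -ler_pdivlMr// -mulrA -invfM ge_min lexx orbT.
pose c := 1 - del; have c01 : 0 < c < 1 by apply/andP; split; rewrite /c; lra.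
pose K := 1 - ln ((1 - c) / 2).
have lnK0 : ln ((1 - c) / 2) <= 0 by apply: ln_le0; rewrite /c; lra.
have K1 : 1 <= K by rewrite /K; lra.
pose e1 := Num.min (Num.min 1 (r / 8)) (e / 8) : R.
have e10 : 0 < e1 by rewrite !lt_min ltr01 !divr_gt0.
have e1r : e1 <= r / 8 by rewrite !ge_min lexx orbT.
have e1e : e1 <= e / 8 by rewrite !ge_min lexx orbT.
have e101 : 0 < e1 <= 1 by rewrite e10 !ge_min lexx.
have [n0 Hn0] := graph_count_ge K1 e101.
have [n1 Hn1] := avg_converges h (divr_gt0 r0 (ltr0n R 4)).
have [n2 Hn2] := eventually_natr_ge (e^-1 * (4 * ln 2)).
exists (maxn n0 (maxn n1 n2)) => n; rewrite !geq_max => /and3P[nn0 nn1 nn2].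
have {}Hn2 := Hn2 n.+1 (leqW nn2).
have {}Hn1 := Hn1 n nn1.
pose q (i j : 'I_n.+1) := avg h i j.
have q01 i j : 0 <= q i j <= 1 by exact: avg_itv.
have qC i j : q i j = q j i by exact: avg_sym.
pose v i j := shrink c (q i j).
have v01 i j : 0 < v i j < 1.
  by have /andP[? ?] := shrink_itv c01 (q01 i j); case/andP: c01 => ? ?; apply/andP; split; rewrite /v; lra.
have v01w i j : 0 <= v i j <= 1 by have /andP[/ltW -> /ltW ->] := v01 i j.
have vC i j : v i j = v j i by rewrite /v qC.
pose l i j := logit (v i j).
have lC i j : l i j = l j i by rewrite /l vC.
have lK i j : `|l i j| <= K.
  by apply: le_trans (logit_shrink_bound c01 (q01 i j)) _; rewrite /K; lra.
have lv i j : logistic (l i j) = v i j by rewrite logitK.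
have [S [S1 S2]] := Hn0 _ (leqW nn0) l lC lK.
set N := n.+1%:R ^+ 2 : R in S1 S2 *.
have nN : n.+1%:R <= N by rewrite /N expr2 ler_peMl// ler1n.
have SP G : G \in S -> cutdist (graph_graphon G) h < r.
  move=> GS; rewrite (cutdist_eq0l h (cutdist_graph_step G)).
  pose sv := step_graphon vC v01w.
  apply: le_lt_trans (cutdist_triangle sv _ _) _.
  have h1 : cutdist (graph_step G) sv <= 2 * e1.
    apply: cutdist_leP => A B mA mB AI BI; apply: int_rect_step_le => // Y rY.
    have := S1 G GS Y rY.
    rewrite (eq_bigr (fun p => adj_mx G p.1 p.2 - v p.1 p.2))// => p _.
    by rewrite lv.
  have h2 : cutdist sv h <= r / 4 + r / 4.
    apply: le_trans (cutdist_le_int sv h) _.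
    have bq := @bmf_step R n q; have bh := bmf_graphon h; have bv := bmf_graphon sv.
    have -> : (fun z => `|sv z - h z|) = (fun z => `|(sv z - step q z) + (step q z - h z)|).
      by apply/funext => z; rewrite addrA subrK.
    apply: le_trans (int_square_normD _ _) _; try exact: bmfB.
    apply: lerD; last first.
      by under eq_Rintegral do rewrite distrC.
    rewrite -[leRHS]int_square_cst; apply: bmf_int_le => //.
      by apply: bmf_norm; exact: bmfB.
      exact: bmf_cst.
    move=> [x y] _ /=; apply: le_trans dr; rewrite /step/= /v /shrink /c.
    have /andP[? ?] := q01 (cell n x) (cell n y).
    by rewrite ler_norml; apply/andP; split; nra.
  lra.
apply: (@le_trans _ _ #|S|%:R); last first.
  by rewrite ler_nat subset_leq_card//; apply/fintype.subsetP => G /SP; rewrite inE.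
apply: le_trans S2; rewrite ler_expR.
set W := \sum_(p | _) _.
have HW : W <= c * (N * entropy_int h + n.+1%:R * (2^-1 * ln 2)).
  apply: (@le_trans _ _ (c * \sum_(p : 'I_n.+1 * 'I_n.+1 | p.1 != p.2)
      avg (fun z => entropy (h z)) p.1 p.2)).
    rewrite /W mulr_sumr; apply: ler_sum => -[i j] _ /=; rewrite lv.
    apply: le_trans (entropy_shrink (q := q i j) c01 (erefl (l i j))) _.
    rewrite ler_pM2l; first exact: avg_entropy_ge.
    by case/andP: c01.
  rewrite ler_pM2l; last by case/andP: c01.
  have := int_avg n (bmf_entropy h); rewrite -/N -/(entropy_int h).
  rewrite sum_pairs -(off_diagE (fun p => avg (fun z => entropy (h z)) p.1 p.2))/=.
  have := avg_entropy_diag n h; lra.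
have Ih : - (2^-1 * ln 2) <= entropy_int h.
  rewrite -[leLHS]int_square_cst; apply: bmf_int_le => //.
  - exact: bmf_cst.
  - exact: bmf_entropy.
  - by move=> z /(gfun_range h); exact: entropy_ge_half.
have Hn : n.+1%:R * (4 * ln 2) <= e * N.
  have h4 : 4 * ln 2 <= e * n.+1%:R by rewrite -ler_pdivrMl.
  by rewrite /N expr2 [leRHS]mulrCA; exact: ler_wpM2l.
have N0 : 0 <= N by exact: sqr_ge0.
have t1 : c * (n.+1%:R * (2^-1 * ln 2)) <= n.+1%:R * (2^-1 * ln 2).
  rewrite ler_piMl//; last by rewrite /c; lra.
  by rewrite mulr_ge0// mulr_ge0// ltW.
have t2 : c * (N * entropy_int h) <= N * entropy_int h + N * (e / 8).
  rewrite /c mulrBl mul1r lerD2l mulrCA -mulrN ler_wpM2l//.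
  have : del * - (2^-1 * ln 2) <= del * entropy_int h by rewrite ler_pM2l.
  by rewrite mulrN mulrCA; lra.
have t3 : N * e1 <= N * (e / 8) by rewrite ler_wpM2l.
have Ne : 0 <= N * e by rewrite mulr_ge0// ltW.
lra.
Qed.

(** A graph near [h] up to the rearrangement [s] has nearly the integral of [h]
    against every rearranged step function.  Testing with the step function
    whose slopes are almost optimal for the averages of [h] reduces the claim
    to [graph_count_le]. *)
Lemma graphs_near_le (h : graphon R) (e : R) : 0 < e ->
  exists2 r : R, 0 < r & exists n0 : nat, forall n, (n0 <= n)%N ->
  #|[set G : sgraph n.+1 | deltacut (graph_graphon G) h < r]%SET|%:R <=
  expR (n.+1%:R ^+ 2 * (- entropy_int h + e)).
Proof.
move=> e0; pose e1 := e / 6; have e10 : 0 < e1 by rewrite divr_gt0.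
have [K K0 HK] := entropy_cont e10.
have [K' HK'] := entropy_dual e10.
have eK : 0 < e1 / (1 + K) by rewrite divr_gt0// ltr_pwDl.
have [m /(_ m (leqnn _)) Hm] := avg_converges h eK.
pose q (i j : 'I_m.+1) := avg h i j.
have q01 i j : 0 <= q i j <= 1 by exact: avg_itv.
have /choice[lam0 Hlam0] : forall p : 'I_m.+1 * 'I_m.+1, exists l : R,
    entropy (q p.1 p.2) - e1 <= l * q p.1 p.2 - logpart l.
  by move=> p; have [l _ ?] := HK' _ (q01 p.1 p.2); exists l.
pose lam i j := lam0 (i, j).
have Hlam i j : entropy (q i j) - e1 <= lam i j * q i j - logpart (lam i j) by exact: (Hlam0 (i, j)).
set M := m.+1%:R ^+ 2 : R; have M0 : 0 < M by rewrite exprn_gt0.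
pose c := M^-1 * \sum_i \sum_j lam i j * q i j.
pose L : R := \sum_i \sum_j `|lam i j|.
have L0 : 0 <= L by apply: sumr_ge0 => i _; apply: sumr_ge0.
have [n0 Hn0] := graph_count_le lam c e10.
have bh := bmf_graphon h.
have sq :
  entropy_int h - 3 * e1 <= c - M^-1 * (\sum_i \sum_j logpart (lam i j)).
  have bsq : bounded_mfun (fun z => entropy (step q z)).
    exact: (@bmf_step R m (fun i j => entropy (q i j))).
  have h1 : entropy_int h <= \int[mu2]_(z in unit_square) entropy (step q z) +
       (K * \int[mu2]_(z in unit_square) `|h z - step q z| + e1).
    have bd : bounded_mfun (fun z => `|h z - step q z|).
      by apply: bmf_norm; apply: bmfB => //; exact: bmf_step.
    have bKd := bmfZ K bd.
    have be := bmf_cst (R := R) e1.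
    rewrite -(bmf_intZ K bd)// -[X in _ + (_ + X)]int_square_cst.
    rewrite -(bmf_intD bKd be)// -bmf_intD//; last exact: bmfD.
    apply: bmf_int_le => //; [exact: bmf_entropy|by apply: bmfD => //; exact: bmfD|].
    move=> [x y] Qz.
    have := HK _ _ (gfun_range h Qz) (q01 (cell m x) (cell m y)).
    by rewrite /step/=; lra.
  have h2 : K * \int[mu2]_(z in unit_square) `|h z - step q z| <= e1.
    apply: le_trans (ler_wpM2l K0 Hm) _.
    by rewrite mulrCA ler_piMr ?(ltW e10)// ler_pdivrMr ?ltr_pwDl// mul1r lerDr.
  have h3 : \int[mu2]_(z in unit_square) entropy (step q z) =
      M^-1 * \sum_(p : 'I_m.+1 * 'I_m.+1) entropy (q p.1 p.2).
    exact: (int_square_step (fun i j => entropy (q i j))).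
  have h4 : M^-1 * \sum_(p : 'I_m.+1 * 'I_m.+1) entropy (q p.1 p.2) - e1 <=
      c - M^-1 * (\sum_i \sum_j logpart (lam i j)).
    rewrite /c -mulrBr !pair_bigA/= -sumrB.
    have -> : e1 = M^-1 * \sum_(p : 'I_m.+1 * 'I_m.+1) e1.
      rewrite sumr_const card_prod card_ord mulnn -[e1 *+ _]mulr_natl natrX -/M.
      by rewrite mulKf ?gt_eqF.
    rewrite -mulrBr ler_pM2l ?invr_gt0// -sumrB.
    by apply: ler_sum => -[i j] _ /=; exact: Hlam.
  lra.
exists (e1 / (1 + L)); first by rewrite divr_gt0// ltr_pwDl.
set r := e1 / (1 + L).
have rL : r * L <= e1.
  by rewrite /r mulrAC -mulrA ler_piMr ?(ltW e10)// ler_pdivrMr ?ltr_pwDl// mul1r lerDr.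
exists n0 => n nn0; apply: le_trans (Hn0 n.+1 (leqW nn0) _ _) _; last first.
  rewrite ler_expR ler_wpM2l ?sqr_ge0//.
  have : 6 * e1 = e by rewrite /e1; field.
  rewrite -/M; lra.
move=> G; rewrite inE (deltacut_eq0l h (cutdist_graph_step G)) => /deltacut_ltP[s hs].
have N0 : 0 < n.+1%:R :> R by rewrite ltr0n.
pose T (i : 'I_m.+1) : set mR := unit_itv `&` s @^-1` (cset i).
have mT i : measurable (T i) by exact: (mpb_meas s mI (measurable_cset i)).
have TI i : T i `<=` unit_itv by move=> x [].
pose p (u : 'I_n.+1) (i : 'I_m.+1) : R := n.+1%:R * wt (T i) u.
have muT i : mu (T i) = (m.+1%:R^-1)%:E.
  by rewrite /T mpb_preserve ?mu_cset//; [exact: measurable_cset|exact: cset_sub].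
exists p.
  split.
  - move=> u i; have /andP[w0 _] := wt_itv u (mT i) (TI i).
    by rewrite /p mulr_ge0.
  - move=> u; rewrite /p -mulr_sumr.
    have fibE i : cset u `&` [set x | cell m (s x) = i] = T i `&` cset u.
      apply/seteqP; split => x.
        by move=> [cx six]; split => //; split; [exact: (cset_sub cx)|split => //; exact/mpb_in/(cset_sub cx)].
      by move=> [[Ix [_ six]] cx].
    have : mu (cset u) = (\sum_i mu (T i `&` cset u))%E.
      rewrite (@measure_fibers _ _ _ mu _ (fun x => cell m (s x)) (cset u)).
        by apply: eq_bigr => i _; rewrite fibE.
      by move=> i; rewrite fibE; apply: measurableI => //; exact: measurable_cset.
    rewrite mu_cset.
    rewrite (eq_bigr (fun i => (wt (T i) u)%:E)); last first.
      move=> i _; rewrite /wt fineK// mu_fin//; last by move=> x [/TI].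
      by apply: measurableI => //; exact: measurable_cset.
    by rewrite sumEFin => -[<-]; rewrite divff// gt_eqF.
  - by move=> i; rewrite /p -mulr_sumr wt_sum// muT.
(* The combinatorial sum is the integral of the graph against the rearranged step
   function. *)
have E : \sum_(x : 'I_n.+1 * 'I_n.+1) blend lam p x.1 x.2 * (adj G x.1 x.2)%:R =
    n.+1%:R ^+ 2 * \sum_i \sum_j lam i j * \int[mu2]_(z in T i `*` T j) graph_step G z.
  rewrite mulr_sumr.
  rewrite (eq_bigr (fun x : 'I_n.+1 * 'I_n.+1 => \sum_i \sum_j
      p x.1 i * p x.2 j * lam i j * (adj G x.1 x.2)%:R)); last first.
    move=> x _; rewrite /blend mulr_suml; apply: eq_bigr => i _.
    by rewrite mulr_suml.
  rewrite exchange_big/=; apply: eq_bigr => i _.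
  rewrite exchange_big/= mulr_sumr; apply: eq_bigr => j _.
  rewrite (int_step (adj_mx G))// !mulr_sumr; apply: eq_bigr => x _.
  by rewrite /p /adj_mx; ring.
rewrite E ler_pM2l ?exprn_gt0//.
have cE : c = \sum_i \sum_j lam i j * \int[mu2]_(z in box (i, j)) h z.
  rewrite /c mulr_sumr; apply: eq_bigr => i _; rewrite mulr_sumr; apply: eq_bigr => j _.
  by rewrite mulrCA /q /avg mulKf ?gt_eqF.
have gT i j : \int[mu2]_(z in T i `*` T j) gact h s z = \int[mu2]_(z in box (i, j)) h z.
  have z01 (_ _ : 'I_1) : 0 <= (0 : R) <= 1 by rewrite lexx ler01.
  have imT k : s @` T k = cset k.
    apply/seteqP; split => [_ [x [_ Bx] <-]//|y By].
    have [x Ix xy] := mpb_surj s (@cset_sub R m k y By).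
    by exists x => //; split; rewrite /= ?xy.
  have := @Rintegral_gact R h (@step_graphon R 0 (fun _ _ => 0) (fun _ _ => erefl) z01) s _ _ (mT i) (mT j) (@TI i) (@TI j).
  by rewrite !imT /= /step; under eq_Rintegral do rewrite subr0;
     under [in X in _ = X -> _]eq_Rintegral do rewrite subr0.
rewrite lerBlDr -lerBlDl cE.
apply: le_trans rL; rewrite /L mulr_sumr -sumrB.
apply: ler_sum => i _; rewrite mulr_sumr -sumrB; apply: ler_sum => j _.
rewrite -mulrBr mulrC -gT -bmf_intB//; try exact: bmf_graphon; last first.
- exact: sub_rect.
- exact: measurableX.
apply: le_trans (ler_norm _) _; rewrite normrM ler_wpM2r//.
apply: ltW; apply: le_lt_trans hs; rewrite cutdistC.
exact: cutset_le.
Qed.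

End counting.

(** * Rearrangements of [0,1] permuting the cells *)

Section cell_exchange.
Context {R : realType}.
Local Notation mR := (measurableTypeR R).
Local Notation mu := (@lebesgue_measure R).
Variable n : nat.
Let mI := @measurable_unit_itv R.
Implicit Types p : {perm 'I_n.+1}.

Lemma lebesgue_measure_shift (c : R) (A : set mR) : measurable A ->
  measurable ((fun x : mR => (x : R) + c : mR) @^-1` A) /\
  mu ((fun x : mR => (x : R) + c : mR) @^-1` A) = mu A.
Proof.
move=> mA.
have mf : measurable_fun setT (fun x : mR => (x : R) + c : mR).
  by apply: measurable_funD => //; exact: measurable_cst.
split; first by rewrite -[X in measurable X]setTI; exact: mf.
pose mixin := isMeasurableFun.Build _ _ _ _ _ mf.
pose pack : {mfun _ >-> _} := HB.pack (fun x : mR => (x : R) + c : mR) mixin.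
have -> : (fun x : mR => (x : R) + c : mR) = pack by [].
rewrite -[LHS]/(pushforward mu pack A); apply/esym/lebesgue_measure_unique => //= _ [[a b]] _ <-.
rewrite /pushforward /=.
have -> : (fun x : R => x + c) @^-1` [set` `]a, b]] = [set` `]a - c, b - c]].
  by apply/seteqP; split => x /=; rewrite !in_itv/= ltrBlDr lerBrDr.
rewrite !lebesgue_measure_itv/= !lte_fin ltrD2r.
by case: ifP => // _; rewrite -!EFinB; congr EFin; ring.
Qed.

Lemma lebesgue_measureD0 (A : set mR) : measurable A -> mu (A `\` [set 0]) = mu A.
Proof.
move=> mA; have m0 : measurable ([set 0] : set mR) by exact: measurable_set1.
rewrite -[in RHS](setDUK (_ : A `&` [set 0] `<=` A)); last by move=> x [].
rewrite measureU//; first last.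
- by apply/seteqP; split => // x [[? ?] [? ]] [].
- by apply: measurableD => //; exact: measurableI.
- exact: measurableI.
rewrite [X in _ = (X + _)%E](_ : _ = 0%E).
  by rewrite add0e setDIr setDv set0U.
apply/eqP; rewrite eq_le measure_ge0 andbT -(lebesgue_measure_set1 (0 : R)).
by apply: le_measure; [apply/mem_set; exact: measurableI|exact/mem_set|exact: subIsetr].
Qed.

Lemma shift_between (a b d x : R) : b < x -> x <= b + d ->
  a < x + (a - b) /\ x + (a - b) <= a + d.
Proof. by move=> ? ?; split; lra. Qed.

Lemma shift_betweenV (a b d x : R) : a < x + (a - b) -> x + (a - b) <= a + d ->
  b < x /\ x <= b + d.
Proof. by move=> ? ?; split; lra. Qed.

(** Translates each half-open cell onto the one prescribed by [p], and fixes 0, so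
    that it is a bijection of [0,1]. *)
Definition exchange p (x : mR) : mR :=
  if 0 < (x : R) then (x : R) + ((p (cell n x))%:R - (cell n x)%:R) / n.+1%:R else x.

Lemma cell_pos (i : 'I_n.+1) (x : R) : i%:R / n.+1%:R < x -> x <= i%:R / n.+1%:R + n.+1%:R^-1 ->
  [/\ unit_itv (x : mR), 0 < x & cell n x = i].
Proof.
have -> : i%:R / n.+1%:R + n.+1%:R^-1 = i.+1%:R / n.+1%:R :> R.
  by rewrite -[i.+1%:R]natr1 mulrDl mul1r.
move=> xi1 xi2; have x0 : 0 < x by apply: le_lt_trans xi1; rewrite divr_ge0.
suff [? ?] : cset i x by [].
apply/csetE; split => //; rewrite /unit_itv/= in_itv/= (ltW x0)/=.
by apply: le_trans xi2 _; rewrite ler_pdivrMr// mul1r ler_nat.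
Qed.

Lemma cell_posP (x : mR) : unit_itv x -> 0 < (x : R) ->
  (cell n x)%:R / n.+1%:R < (x : R) /\ (x : R) <= (cell n x)%:R / n.+1%:R + n.+1%:R^-1.
Proof.
have -> : (cell n x)%:R / n.+1%:R + n.+1%:R^-1 = (cell n x).+1%:R / n.+1%:R :> R.
  by rewrite -[(cell n x).+1%:R]natr1 mulrDl mul1r.
move=> Ix x0; have [_ h1 h2] := (csetE (cell n x) x).1 (@cset_cell R n x Ix).
split => //; have [c0|c0] := posnP (cell n x); last exact: h1.
by rewrite c0 mul0r.
Qed.

Lemma exchange_pos p (x : mR) : unit_itv x -> 0 < (x : R) ->
  [/\ unit_itv (exchange p x), 0 < (exchange p x : R) &
      cell n (exchange p x) = p (cell n x)].
Proof.
move=> Ix x0; have [h1 h2] := cell_posP Ix x0; rewrite /exchange x0.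
rewrite mulrBl; have [k1 k2] := shift_between ((p (cell n x))%:R / n.+1%:R) h1 h2.
exact: cell_pos.
Qed.

Lemma exchange_in p (x : mR) : unit_itv x -> unit_itv (exchange p x).
Proof.
move=> Ix; have [x0|x0] := pselect (0 < (x : R)).
  by have [] := exchange_pos p Ix x0.
by rewrite /exchange; case: ifP.
Qed.

Lemma exchangeK p (x : mR) : unit_itv x -> exchange p^-1%g (exchange p x) = x.
Proof.
move=> Ix; have [x0|x0] := pselect (0 < (x : R)); last first.
  have xE q : exchange q x = x by rewrite /exchange; case: ifP => // /x0.
  by rewrite !xE.
have [_ y0 cy] := exchange_pos p Ix x0.
rewrite {1}/exchange y0 cy permK /exchange x0.
by rewrite -addrA -mulrDl addrA subrK subrr mul0r addr0.
Qed.

Lemma exchangeKV p (x : mR) : unit_itv x -> exchange p (exchange p^-1%g x) = x.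
Proof. by move=> Ix; rewrite -{1}(invgK p); exact: exchangeK. Qed.

Definition exchange_shift p (i : 'I_n.+1) : R := ((p i)%:R - i%:R) / n.+1%:R.

(** Away from 0, [exchange p] is a translation on each cell; measurability and
    invariance of the measure follow cell by cell. *)
Lemma exchange_fiber p (A : set mR) (i : 'I_n.+1) :
  ((unit_itv `&` exchange p @^-1` A) `\` [set 0]) `&` cset i =
  (cset i `\` [set 0]) `&` (fun x : mR => (x : R) + exchange_shift p i : mR) @^-1` A.
Proof.
have pos (x : mR) : unit_itv x -> x <> 0 -> 0 < (x : R).
  rewrite /unit_itv/= in_itv/= => /andP[x0 _] /eqP nx.
  by rewrite lt_neqAle eq_sym nx.
apply/seteqP; split => x.
  move=> [[[Ix Ax] nx] ci]; split => //=; move: Ax ci => + [_ /= ci].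
  by rewrite /= /exchange (pos x Ix nx) ci.
move=> [[[Ix /= ci] nx] /= Ax]; split => //; split => //; split => //=.
by rewrite /exchange (pos x Ix nx) ci.
Qed.

Lemma measurable_exchange_fiber p (A : set mR) (i : 'I_n.+1) : measurable A ->
  measurable (((unit_itv `&` exchange p @^-1` A) `\` [set 0]) `&` cset i).
Proof.
move=> mA; rewrite exchange_fiber; apply: measurableI.
  by apply: measurableD; [exact: measurable_cset|exact: measurable_set1].
by have [] := lebesgue_measure_shift (exchange_shift p i) mA.
Qed.

Lemma exchange_meas p : measurable_fun unit_itv (exchange p).
Proof.
move=> _ A mA.
have -> : unit_itv `&` exchange p @^-1` A =
   (unit_itv `&` ([set 0] `&` A)) `|`
   \bigcup_(i in [set: 'I_n.+1]) (((unit_itv `&` exchange p @^-1` A) `\` [set 0]) `&` cset i).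
  apply/seteqP; split => x.
    move=> [Ix Ax]; have [x0|x0] := pselect (x = 0).
      left; split => //; split => //; move: Ax; rewrite /= /exchange x0 ltxx.
      by [].
    by right; exists (cell n x) => //; split.
  move=> [[Ix [/= x0 Ax]]|[i _ [[]]]//]; split => //=.
  by rewrite /exchange x0 ltxx -x0.
apply: measurableU.
  by apply: measurableI => //; apply: measurableI => //; exact: measurable_set1.
apply: fin_bigcup_measurable; first exact: finite_finset.
by move=> i _; exact: measurable_exchange_fiber.
Qed.

Lemma exchange_image p (A : set mR) : A `<=` unit_itv ->
  exchange p @` A = unit_itv `&` exchange p^-1%g @^-1` A.
Proof.
move=> AI; apply/seteqP; split => [_ [x Ax <-]|x [Ix Ax]].
  split; first exact/exchange_in/AI.
  by rewrite /= exchangeK//; exact: AI.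
by exists (exchange p^-1%g x) => //; exact: exchangeKV.
Qed.

Lemma exchange_preserve p (A : set mR) : measurable A -> A `<=` unit_itv ->
  mu (unit_itv `&` exchange p @^-1` A) = mu A.
Proof.
move=> mA AI.
have mE : measurable (unit_itv `&` exchange p @^-1` A) by exact: exchange_meas.
rewrite -lebesgue_measureD0// -[RHS]lebesgue_measureD0//.
have fibE (B : set mR) i : B `<=` unit_itv ->
    B `&` [set x | cell n x = i] = B `&` cset i.
  move=> BI; apply/seteqP; split => [x [Bx xi]|x [Bx []]//].
  by split => //; split => //; exact: BI.
have I1 : (unit_itv `&` exchange p @^-1` A) `\` [set 0] `<=` unit_itv by move=> x [[]].
have I2 : A `\` [set 0] `<=` unit_itv by move=> x [/AI].
have m0 : measurable ([set 0] : set mR) by exact: measurable_set1.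
have m2 (i : 'I_n.+1) : measurable ((A `\` [set 0]) `&` cset i).
  by apply: measurableI; [exact: measurableD|exact: measurable_cset].
rewrite (@measure_fibers _ _ _ mu _ (@cell R n) (_ `\` _)); last first.
  by move=> i; rewrite fibE//; exact: measurable_exchange_fiber.
rewrite [RHS](@measure_fibers _ _ _ mu _ (@cell R n)); last first.
  by move=> i; rewrite fibE.
rewrite [RHS](reindex_inj (@perm_inj _ p)); apply: eq_bigr => i _.
rewrite !fibE// exchange_fiber.
have [_ sh] := lebesgue_measure_shift (exchange_shift p i) (m2 (p i)).
apply: etrans sh; congr lebesgue_measure; apply/seteqP; split => x /=.
  move=> [[ci nx] Ax]; have [Ix /= cx] := ci.
  have x0 : 0 < (x : R).
    move: Ix; rewrite /unit_itv/= in_itv/= => /andP[x0 _].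
    by rewrite lt_neqAle x0 andbT eq_sym; exact/eqP.
  have [Iy y0 cy] := exchange_pos p Ix x0.
  move: Iy y0 cy; rewrite /exchange x0 cx -/(exchange_shift p i) => Iy y0 cy.
  by split; [split => //; apply/eqP; rewrite gt_eqF|split].
move=> [[Ax nx] [Ix cx]].
have y0 : 0 < (x : R) + exchange_shift p i.
  move: Ix; rewrite /unit_itv/= in_itv/= => /andP[x0 _].
  by rewrite lt_neqAle x0 andbT eq_sym; exact/eqP.
have [h1 h2] := cell_posP Ix y0.
have cx' : cell n ((x : R) + exchange_shift p i) = p i by exact: cx.
move: h1 h2; rewrite cx' /exchange_shift mulrBl => h1 h2.
have [Iz z0 cz] : [/\ unit_itv (x : mR), 0 < (x : R) & cell n x = i].
  by have [k1 k2] := shift_betweenV h1 h2; exact: cell_pos.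
split; last by rewrite -mulrBl.
by split; [split|apply/eqP; rewrite gt_eqF].
Qed.

Fact exchange_bij p : set_bij unit_itv unit_itv (exchange p).
Proof.
split.
- by move=> x; exact: exchange_in.
- move=> x y /set_mem Ix /set_mem Iy xy.
  by rewrite -(exchangeK p Ix) xy exchangeK.
- move=> x Ix; exists (exchange p^-1%g x); first exact: exchange_in.
  exact: exchangeKV.
Qed.

Fact exchange_meas_image p (A : set mR) : measurable A -> A `<=` unit_itv ->
  measurable (exchange p @` A).
Proof. by move=> mA AI; rewrite exchange_image//; exact: exchange_meas. Qed.

Definition cell_exchange p : mpbij R :=
  MPBij (exchange_bij p) (exchange_meas p) (@exchange_meas_image p) (@exchange_preserve p).

End cell_exchange.

(** * Total boundedness of the set of graphs *)

Section sorting.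

(** A down-closed set of ordinals is an initial segment, of length its cardinal. *)
Lemma down_closed_lt n (P : {pred 'I_n}) :
  (forall u v : 'I_n, (u <= v)%N -> P v -> P u) ->
  forall u, P u = (u < #|[set v | P v]%SET|)%N.
Proof.
move=> dP u.
have cardlt (t : 'I_n) : #|[set v : 'I_n | (v < t)%N]%SET| = t.
  rewrite -sum1_card big_mkcond/= -[RHS](sum_ltn_nat (ltnW (ltn_ord t))).
  by apply: eq_bigr => i _; rewrite inE; case: ltnP.
case: (boolP (P u)) => Pu; apply/esym.
  apply: (@leq_trans #|u |: [set v : 'I_n | (v < u)%N]%SET|).
    by rewrite finset.cardsU1 inE ltnn cardlt.
  apply: subset_leq_card; apply/fintype.subsetP => v; rewrite !inE => /predU1P[->//|vu].
  by apply: dP Pu; exact: ltnW.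
apply/negbTE; rewrite -leqNgt -[leqRHS]cardlt.
apply: subset_leq_card; apply/fintype.subsetP => v; rewrite !inE => Pv.
by rewrite ltnNge; apply: contra Pu => uv; exact: dP Pv.
Qed.

Lemma sort_perm n (t : 'I_n -> nat) :
  exists p : {perm 'I_n}, forall u v : 'I_n, (u <= v)%N -> (t (p u) <= t (p v))%N.
Proof.
pose s := sort leq [tuple t u | u < n].
have /tuple_permP[p sp] : perm_eq s [tuple t u | u < n] by rewrite perm_sort.
exists p => u v uv.
have E (w : 'I_n) : nth 0%N s w = t (p w).
  by rewrite sp -tnth_nth !tnth_mktuple.
rewrite -!E; have ss : sorted leq s by exact: (sort_sorted leq_total).
have szs : size s = n by rewrite size_sort size_tuple.
by apply: (sorted_leq_nth leq_trans leqnn 0%N ss) => //; rewrite inE szs.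
Qed.

End sorting.

Section sketches.
Context {R : realType}.
Variable m : nat.

(** The type of a vertex: for each of the [m] rectangles of the weak regularity
    lemma, whether the vertex belongs to its two sides. *)
Definition mark : finType := {ffun 'I_m -> bool * bool}.

(** The combination of rectangles, as a function of the types of both vertices. *)
Definition mark_sum (c : 'I_m -> R) (s t : mark) : R :=
  \sum_k c k * ((s k).1 && (t k).2)%:R.

Lemma mark_sum_le c s t : (forall k, `|c k| <= 1) -> `|mark_sum c s t| <= m%:R.
Proof.
move=> c1; apply: le_trans (ler_norm_sum _ _ _) _.
apply: (@le_trans _ _ (\sum_(k < m) (1 : R))); last by rewrite sumr_const card_ord.
by apply: ler_sum => k _; case: (_ && _); rewrite ?mulr1 ?mulr0 ?normr0.
Qed.

Lemma mark_sum_lipschitz c c' (d : R) s t s' t' :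
  (forall k, `|c k| <= 1) -> (forall k, `|c' k| <= 1) ->
  0 <= d -> (forall k, `|c k - c' k| <= d) ->
  `|mark_sum c s t - mark_sum c' s' t'| <=
  m%:R * d + 2 * m%:R * ((s != s')%:R + (t != t')%:R).
Proof.
move=> c1 c1' d0 cc.
have h : `|mark_sum c s t - mark_sum c' s t| <= m%:R * d.
  rewrite /mark_sum -sumrB; apply: le_trans (ler_norm_sum _ _ _) _.
  apply: (@le_trans _ _ (\sum_(k < m) d)); last by rewrite sumr_const card_ord mulr_natl.
  apply: ler_sum => k _; rewrite -mulrBl.
  by case: (_ && _); rewrite ?mulr1 ?mulr0 ?normr0.
have := mark_sum_le s t c1'; have := mark_sum_le s' t' c1'.
move: h; have [->|_] := eqVneq s s'; have [->|_] := eqVneq t t';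
  rewrite /= ?(addr0, add0r, mulr0, mulr1) //;
  set x := mark_sum c _ _; set y := mark_sum c' _ _ ; set z := mark_sum c' _ _;
  rewrite !ler_norml => /andP[? ?] /andP[? ?] /andP[? ?];
  by apply/andP; split; nra.
Qed.

(** A weak regularity decomposition of [G] whose vertices have been reordered so
    that the types, ranked by [enum_rank], are nondecreasing. *)
Record sketch n (e : R) (G : sgraph n) := Sketch {
  sk_perm : {perm 'I_n} ;
  sk_coef : 'I_m -> R ;
  sk_mark : 'I_n -> mark ;
  sk_coef1 : forall k, `|sk_coef k| <= 1 ;
  sk_sorted : forall u v : 'I_n, (u <= v)%N ->
    (enum_rank (sk_mark u) <= enum_rank (sk_mark v))%N ;
  sk_cut : forall Y, rectangle Y ->
    `|\sum_(q in Y) (adj_mx G (sk_perm q.1) (sk_perm q.2)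
        - mark_sum sk_coef (sk_mark q.1) (sk_mark q.2))| <= e * n%:R ^+ 2 }.

Lemma sketch_exists n (e : R) (G : sgraph n) : 0 < e -> 1 < m%:R * e ^+ 2 ->
  inhabited (sketch e G).
Proof.
move=> e0 me.
have a1 (q : 'I_n * 'I_n) : `|adj_mx G q.1 q.2 : R| <= 1.
  by rewrite /adj_mx; case: adj; rewrite ?normr1 ?normr0.
have [c [X [c1 rX H]]] := @frieze_kannan R _ (@rectangle n) (rectangle0 n) _ e m a1 e0 me.
have /choice[SA HSA] : forall k, exists SA : {set 'I_n} * {set 'I_n}, X k = finset.setX SA.1 SA.2.
  by move=> k; have [S [A ->]] := rX k; exists (S, A).
pose mk (u : 'I_n) : mark := [ffun k : 'I_m => (u \in (SA k).1, u \in (SA k).2)].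
have [p Hp] := sort_perm (fun u => enum_rank (mk u)).
have hcut : forall Y, rectangle Y ->
    `|\sum_(q in Y) (adj_mx G (p q.1) (p q.2)
        - mark_sum (fun k : 'I_m => c k) (mk (p q.1)) (mk (p q.2)))| <= e * n%:R ^+ 2.
  move=> Y [S [A ->]].
  have := H (finset.setX (p @: S)%SET (p @: A)%SET) _.
  rewrite card_prod card_ord mulnn natrX.
  have -> : \sum_(q in finset.setX (p @: S)%SET (p @: A)%SET)
       (adj_mx G q.1 q.2 - \sum_(k < m) c k * (q \in X k)%:R) =
     \sum_(q in finset.setX S A) (adj_mx G (p q.1) (p q.2)
        - mark_sum (fun k : 'I_m => c k) (mk (p q.1)) (mk (p q.2))).
    rewrite (reindex_inj (h := fun q : 'I_n * 'I_n => (p q.1, p q.2)))/=; last first.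
      by move=> [a b] [a' b'] [/perm_inj -> /perm_inj ->].
    apply: eq_big => -[a b].
      by rewrite !finset.in_setX /= !mem_imset//; exact: perm_inj.
    move=> _ /=; congr (_ - _); apply: eq_bigr => k _.
    by rewrite HSA finset.in_setX/= !ffunE.
  by apply; exists (p @: S)%SET, (p @: A)%SET.
exact: (inhabits (Sketch (fun k : 'I_m => c1 k) Hp hcut)).
Qed.

End sketches.

Section total_boundedness.
Context {R : realType}.
Local Notation mR := (measurableTypeR R).
Local Notation mu2 := (leb2 R).
Let mQ := @measurable_unit_square R.
Let mI := @measurable_unit_itv R.

Lemma deltacut_gact (f : graphon R) s : deltacut f (gact f s) = 0.
Proof.
apply/eqP; rewrite eq_le deltacut_ge0 andbT deltacutC.
by apply: le_trans (deltacut_le _ _ s) _; rewrite cutdist_eq0.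
Qed.

Section sorted_graphon.
Variables (m n : nat) (e : R) (G : sgraph n.+1) (k : sketch m e G).

Let pG (u v : 'I_n.+1) : R := adj_mx G (sk_perm k u) (sk_perm k v).

Fact sorted_adjC i j : pG i j = pG j i.
Proof. exact: adj_mxC. Qed.

Fact sorted_adj01 i j : 0 <= pG i j <= 1.
Proof. exact: adj_mx01. Qed.

Definition sorted_graphon : graphon R := step_graphon sorted_adjC sorted_adj01.

Lemma deltacut_sorted : deltacut (graph_graphon G) sorted_graphon = 0.
Proof.
rewrite (deltacut_eq0l _ (cutdist_graph_step G)).
pose f : graphon R := graph_step G; pose s := @cell_exchange R n (sk_perm k).
rewrite -/f.
apply/eqP; rewrite eq_le deltacut_ge0 andbT.
apply: le_trans (deltacut_triangle (gact f s) _ _) _.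
rewrite deltacut_gact add0r; apply: le_trans (deltacut_cutdist _ _) _.
rewrite cutdist_off_axes// => x y Ix Iy x0 y0 /=.
have [_ _ cx] := exchange_pos (sk_perm k) Ix x0.
have [_ _ cy] := exchange_pos (sk_perm k) Iy y0.
by rewrite /step/= cx cy.
Qed.

Definition mark_at (x : mR) : mark m := sk_mark k (cell n x).

Definition sketch_fun : mR * mR -> R :=
  step (fun u v => mark_sum (sk_coef k) (sk_mark k u) (sk_mark k v)).

Definition marks_below (j : nat) : nat :=
  #|[set u | (enum_rank (sk_mark k u) < j)%N]%SET|.

(** The proportion of vertices whose type ranks below [j].  As the types are sorted,
    these numbers determine where each type lives in [0,1]; see [mark_at_lt]. *)
Definition cumul (j : nat) : R := (marks_below j)%:R / n.+1%:R.

Lemma cumul_itv j : 0 <= cumul j <= 1.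
Proof.
rewrite /cumul divr_ge0//= ler_pdivrMr ?ltr0n// mul1r ler_nat.
by apply: leq_trans (max_card _) _; rewrite card_ord.
Qed.

Lemma mark_at_lt (x : mR) j : unit_itv x -> 0 < (x : R) ->
  (enum_rank (mark_at x) < j)%N = ((x : R) <= cumul j).
Proof.
move=> Ix x0.
rewrite (@down_closed_lt _ (fun u => (enum_rank (sk_mark k u) < j)%N)); last first.
  by move=> u v uv; apply: leq_ltn_trans; exact: sk_sorted.
rewrite -/(marks_below j) ltnNge leNgt; congr (~~ _).
rewrite /cumul; case: (marks_below j) => [|l]; first by rewrite mul0r x0.
exact: cellP.
Qed.

Lemma sorted_cut (S A : set mR) : measurable S -> measurable A ->
  S `<=` unit_itv -> A `<=` unit_itv ->
  `|\int[mu2]_(z in S `*` A) (sorted_graphon z - sketch_fun z)| <= e.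
Proof. by move=> mS mA SI AI; apply: int_rect_step_le => // Y; exact: sk_cut. Qed.

End sorted_graphon.

(** Two sorted sequences of types with close cumulative proportions differ only near
    the points where the type changes. *)
Lemma mark_at_neq m n n' (e : R) (G : sgraph n.+1) (G' : sgraph n'.+1)
    (k : sketch m e G) (k' : sketch m e G') (d : R) (x : mR) :
  (forall j : 'I_#|mark m|, `|cumul k j - cumul k' j| <= d) ->
  unit_itv x -> 0 < (x : R) -> mark_at k x != mark_at k' x ->
  exists j : 'I_#|mark m|, cumul k j - d <= (x : R) <= cumul k j + d.
Proof.
move=> cd Ix x0 kk.
have H j := mark_at_lt k j Ix x0; have H' j := mark_at_lt k' j Ix x0.
have : (enum_rank (mark_at k x) != enum_rank (mark_at k' x) :> nat).
  by apply: contra kk => /eqP/val_inj/enum_rank_inj ->.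
rewrite neq_ltn => /orP[lt|lt].
  exists (enum_rank (mark_at k' x)); have := cd (enum_rank (mark_at k' x)).
  move: lt (ltnn (enum_rank (mark_at k' x))); rewrite H H' => h1 /negbT.
  rewrite -ltNge => h2; rewrite ler_norml => /andP[? ?].
  by apply/andP; split; lra.
exists (enum_rank (mark_at k x)); have := cd (enum_rank (mark_at k x)).
move: lt (ltnn (enum_rank (mark_at k x))); rewrite H H' => h1 /negbT.
rewrite -ltNge => h2; rewrite ler_norml => /andP[? ?].
by apply/andP; split; lra.
Qed.

(** Both graphs are near their sketches in the cut norm, and the sketches differ
    by at most [d] in coefficients and, by [mark_at_neq], on a set of small
    measure, namely strips of width [2 d]. *)
Lemma sorted_close m n n' (e : R) (G : sgraph n.+1) (G' : sgraph n'.+1)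
    (k : sketch m e G) (k' : sketch m e G') (d : R) : 0 <= d ->
  (forall i, `|sk_coef k i - sk_coef k' i| <= d) ->
  (forall j : 'I_#|mark m|, `|cumul k j - cumul k' j| <= d) ->
  cutdist (sorted_graphon k) (sorted_graphon k') <=
  2 * e + m%:R * d * (1 + 8 * #|mark m|%:R).
Proof.
move=> d0 cc cd.
set D := #|mark m|.
pose J (a d : R) : set mR := unit_itv `&` [set` `[a - d, a + d]].
have S1 a d' (d'0 : 0 <= d') := @int_strip R a d' (J a d' `*` unit_itv) d'0 (or_introl erefl).
have S2 a d' (d'0 : 0 <= d') := @int_strip R a d' (unit_itv `*` J a d') d'0 (or_intror erefl).
(* [H] counts the strips that contain [z]; [H0] stands for the axes, where
   [mark_at_neq] says nothing. *)
pose H1 (j : 'I_D) (z : mR * mR) : R := \1_(J (cumul k j) d `*` unit_itv) z + \1_(unit_itv `*` J (cumul k j) d) z.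
pose H0 (z : mR * mR) : R := \1_(J 0 0 `*` unit_itv) z + \1_(unit_itv `*` J 0 0) z.
pose H (z : mR * mR) : R := H0 z + \sum_j H1 j z.
have bH1 j : bounded_mfun (H1 j).
  by apply: bmfD; apply: bmf_indic; [have [] := S1 (cumul k j) d d0|have [] := S2 (cumul k j) d d0].
have bH0 : bounded_mfun H0.
  by apply: bmfD; apply: bmf_indic; [have [] := S1 0 0 (lexx _)|have [] := S2 0 0 (lexx _)].
have bH : bounded_mfun H by apply: bmfD => //; exact: bmf_sum.
have iH : \int[mu2]_(z in unit_square) H z <= 4 * d * D%:R.
  rewrite /H bmf_intD//; last exact: bmf_sum.
  rewrite bmf_int_sum//.
  have [m1 h1] := S1 0 0 (lexx _); have [m2 h2] := S2 0 0 (lexx _).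
  have h0 : \int[mu2]_(z in unit_square) H0 z <= 0.
    by rewrite /H0 bmf_intD//; [lra|exact: bmf_indic|exact: bmf_indic].
  have : \sum_j \int[mu2]_(z in unit_square) H1 j z <= \sum_(j < D) 4 * d.
    apply: ler_sum => j _.
    have [m3 h3] := S1 (cumul k j) d d0; have [m4 h4] := S2 (cumul k j) d d0.
    by rewrite /H1 bmf_intD//; [lra|exact: bmf_indic|exact: bmf_indic].
  by rewrite sumr_const card_ord -[(4 * d) *+ D]mulr_natr; lra.
set w := sketch_fun k; set w' := sketch_fun k'.
have bw : bounded_mfun w by exact: bmf_step.
have bw' : bounded_mfun w' by exact: bmf_step.
have ww : \int[mu2]_(z in unit_square) `|w z - w' z| <= m%:R * d * (1 + 8 * D%:R).
  have bm := bmfZ (2 * m%:R) bH; have bd := bmf_cst (m%:R * d : R).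
  apply: (@le_trans _ _ (\int[mu2]_(z in unit_square) (m%:R * d + 2 * m%:R * H z))).
    apply: bmf_int_le => //; first by apply: bmf_norm; exact: bmfB.
      exact: bmfD bd bm.
    move=> [x y] [/= Ix Iy].
    apply: le_trans (mark_sum_lipschitz _ _ _ _ (sk_coef1 k) (sk_coef1 k') d0 cc) _.
    rewrite lerD2l ler_wpM2l ?mulr_ge0//.
    have p0 (B : set (mR * mR)) z : 0 <= (\1_B z : R) by rewrite indicE.
    have Jx (B : set mR) t : B t -> unit_itv y -> \1_(B `*` unit_itv) (t, y) = 1 :> R.
      by move=> Bt Iy'; rewrite indicE mem_set.
    have Jy (B : set mR) t : B t -> unit_itv x -> \1_(unit_itv `*` B) (x, t) = 1 :> R.
      by move=> Bt Iy'; rewrite indicE mem_set.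
    have z0 (t : mR) : unit_itv t -> ~ (0 < (t : R)) -> J 0 0 t.
      move=> It t0; split => //=; rewrite in_itv/= subr0 addr0.
      move: It; rewrite /unit_itv/= in_itv/= => /andP[-> _] /=.
      by rewrite leNgt; exact/negP.
    have -> : H (x, y) = (\1_(J 0 0 `*` unit_itv) (x, y) + \sum_(j : 'I_D) \1_(J (cumul k j) d `*` unit_itv) (x, y)) +
       (\1_(unit_itv `*` J 0 0) (x, y) + \sum_(j : 'I_D) \1_(unit_itv `*` J (cumul k j) d) (x, y)).
      by rewrite /H /H0 /H1 big_split/= addrACA.
    apply: lerD.
      case: (boolP (_ != _)) => [kx|_]; last by rewrite addr_ge0// sumr_ge0.
      have [x0|x0] := pselect (0 < (x : R)); last first.
        by rewrite Jx ?lerDl ?sumr_ge0//; exact: z0.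
      have [j hj] := mark_at_neq cd Ix x0 kx.
      rewrite (bigD1 j)//= [X in _ + (X + _)]Jx// addrCA lerDl.
      by rewrite addr_ge0// sumr_ge0.
    case: (boolP (_ != _)) => [ky|_]; last by rewrite addr_ge0// sumr_ge0.
    have [y0|y0] := pselect (0 < (y : R)); last first.
      by rewrite Jy ?lerDl ?sumr_ge0//; exact: z0.
    have [j hj] := mark_at_neq cd Iy y0 ky.
    rewrite (bigD1 j)//= [X in _ + (X + _)]Jy// addrCA lerDl.
    by rewrite addr_ge0// sumr_ge0.
  rewrite (bmf_intD bd bm)// int_square_cst bmf_intZ//.
  have : 2 * m%:R * \int[mu2]_(z in unit_square) H z <= 2 * m%:R * (4 * d * D%:R).
    by rewrite ler_wpM2l// mulr_ge0.
  lra.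
apply: cutdist_leP => S A mS mA SI AI.
have mB : measurable (S `*` A) by exact: measurableX.
have BQ := sub_rect SI AI.
have b1 := bmf_graphon (sorted_graphon k); have b2 := bmf_graphon (sorted_graphon k').
have c1 := sorted_cut k mS mA SI AI; have c2 := sorted_cut k' mS mA SI AI.
have c3 := le_trans (bmf_int_norm_square (bmfB bw bw') mB BQ) ww.
move: c1 c2 c3; rewrite !bmf_intB// -/w -/w'.
rewrite !ler_norml => /andP[? ?] /andP[? ?] /andP[? ?]; apply/andP; split; lra.
Qed.

(** The class of a graph consists of the rounded coefficients and cumulative
    proportions of a chosen sketch; the number of classes does not depend on the
    number of vertices. *)
Lemma graphs_totally_bounded (e : R) : 0 < e ->
  exists (I : finType) (cl : forall n, sgraph n.+1 -> I),
  forall n n' (G : sgraph n.+1) (G' : sgraph n'.+1), cl n G = cl n' G' ->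
    deltacut (graph_graphon G : graphon R) (graph_graphon G') <= e.
Proof.
move=> e0; pose e1 := e / 3; have e10 : 0 < e1 by rewrite divr_gt0.
have [m Hm] := eventually_natr_ge (2 / e1 ^+ 2).
have {Hm} me : 1 < m%:R * e1 ^+ 2.
  rewrite -ltr_pdivrMr ?exprn_gt0//; apply: lt_le_trans (Hm m (leqnn _)).
  by rewrite ltr_pM2r ?invr_gt0 ?exprn_gt0// ltr1n.
pose D := #|mark m|.
pose B : R := m%:R * 2 * (1 + 8 * D%:R).
have [M0 HM] := eventually_natr_ge (B / e1).
pose M := M0.+1; have {HM} BM : B / M%:R <= e1.
  by rewrite ler_pdivrMr ?ltr0n// mulrC -ler_pdivrMr//; exact/HM/leqnSn.
have sk n (G : sgraph n.+1) : sketch m e1 G.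
  by apply: inhabited_witness; exact: sketch_exists.
pose I := ({ffun 'I_D -> 'I_M.+1} * {ffun 'I_m -> 'I_M.+1})%type.
pose cl n (G : sgraph n.+1) : I :=
  ([ffun j : 'I_D => quantize M (cumul (sk n G) j)],
   [ffun i : 'I_m => quantize M ((sk_coef (sk n G) i + 1) / 2)]).
exists I, cl => n n' G G' [/ffunP cl1 /ffunP cl2].
set k := sk n G; set k' := sk n' G'.
have d0 : 0 <= 2 / M%:R :> R by rewrite divr_ge0.
have M0' : 0 < M%:R^-1 :> R by rewrite invr_gt0 ltr0n.
have := @sorted_close m n n' e1 G G' k k' (2 / M%:R) d0 _ _.
have cc i : `|sk_coef k i - sk_coef k' i| <= 2 / M%:R.
  have := cl2 i; rewrite !ffunE -/k -/k' => /(quantize_close (ltn0Sn _)).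
  have h (c : R) : `|c| <= 1 -> 0 <= (c + 1) / 2 <= 1.
    by rewrite ler_norml => /andP[? ?]; apply/andP; split; lra.
  move=> /(_ (h _ (sk_coef1 k i)) (h _ (sk_coef1 k' i))).
  move: (sk_coef k i) (sk_coef k' i) (M%:R^-1) => a b c.
  by rewrite !ler_norml => /andP[? ?]; apply/andP; split; lra.
have cd (j : 'I_D) : `|cumul k j - cumul k' j| <= 2 / M%:R.
  have := cl1 j; rewrite !ffunE -/k -/k' => /(quantize_close (ltn0Sn _)).
  move=> /(_ (cumul_itv k j) (cumul_itv k' j)) h.
  apply: le_trans h _; by move: (M%:R^-1) M0' => x ?; lra.
move=> /(_ cc cd) close.
apply: le_trans (deltacut_triangle (sorted_graphon k) _ _) _.
rewrite deltacut_sorted add0r.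
apply: le_trans (deltacut_triangle (sorted_graphon k') _ _) _.
rewrite [deltacut _ (graph_graphon G')]deltacutC deltacut_sorted addr0.
apply: le_trans (deltacut_cutdist _ _) _; apply: le_trans close _.
have -> : m%:R * (2 / M%:R) * (1 + 8 * #|mark m|%:R) = B / M%:R.
  by rewrite /B /D; ring.
have : 3 * e1 = e by rewrite /e1; field.
lra.
Qed.

End total_boundedness.

(** * Completeness *)

Section completeness.
Context {R : realType}.
Local Notation mu2 := (leb2 R).
Let mQ := @measurable_unit_square R.
Let mI := @measurable_unit_itv R.
Implicit Types c f g h : graphon R.

Lemma limn_sup_itv (u : nat -> R) (j : nat) (a b : R) :
  (forall k, `|u k| <= 1) -> (forall k, (j <= k)%N -> a <= u k <= b) ->
  a <= limn_sup u <= b.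
Proof.
move=> u1 uab.
have bu : bounded_fun u.
  by exists 1; split; [exact: num_real|move=> M M1 k _ /=; rewrite (le_trans (u1 k))// ltW].
have ub n : has_ubound (sdrop u n).
  by exists 1 => _ [k _ <-]; exact: le_trans (ler_norm _) (u1 k).
have lb : has_lbound (range (sups u)).
  exists (-1) => _ [n _ <-].
  apply: (@le_trans _ _ (u n)); first by have := u1 n; rewrite ler_norml => /andP[].
  by apply: ub_le_sup => //; exists n => //=.
rewrite limn_supE//; apply/andP; split.
  apply: lb_le_inf; first by exists (sups u 0%N), 0%N.
  move=> _ [n _ <-]; apply: (@le_trans _ _ (u (maxn n j))).
    by have /andP[] := uab (maxn n j) (leq_maxr _ _).
  by apply: ub_le_sup => //; exists (maxn n j) => //=; exact: leq_maxl.
apply: (@le_trans _ _ (sups u j)); first by apply: ge_inf => //; exists j.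
apply: ge_sup; first by exists (u j), j => //=.
by move=> _ [k /= jk <-]; have /andP[] := uab k jk.
Qed.

(** The upper limit is measurable, symmetric and [0,1]-valued at every point,
    whether or not the sequence converges there.  Its distance to [c j] is at
    most the series of the increments, pointwise in the extended reals, so
    monotone convergence gives the bound. *)
Lemma graphon_l1_limit (c : nat -> graphon R) :
  (forall k, \int[mu2]_(z in unit_square) `|c k z - c k.+1 z| <= (2 ^+ k.+1)^-1) ->
  exists h, forall j, \int[mu2]_(z in unit_square) `|c j z - h z| <= (2 ^+ j)^-1.
Proof.
move=> cc.
have u1 z : unit_square z -> forall k, `|c k z| <= 1.
  by move=> Qz k; have /andP[? ?] := gfun_range (c k) Qz; rewrite ger0_norm.
pose h z := limn_sup (fun k => c k z).
have mh : measurable_fun unit_square h.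
  apply: measurable_fun_limn_sup.
  - by move=> z Qz; exists 1 => _ [k _ <-]; exact: le_trans (ler_norm _) (u1 z Qz k).
  - move=> z Qz; exists (-1) => _ [k _ <-].
    by have := u1 z Qz k; rewrite ler_norml => /andP[].
  - by move=> k; exact: gfun_meas.
have hC x y : unit_itv x -> unit_itv y -> h (x, y) = h (y, x).
  move=> Ix Iy; rewrite /h; congr limn_sup; apply/funext => k.
  exact: gfun_sym.
have h01 z : unit_square z -> 0 <= h z <= 1.
  move=> Qz; apply: (@limn_sup_itv _ 0%N); first exact: u1.
  by move=> k _; exact: gfun_range.
exists (Graphon mh hC h01) => j /=.
pose d k z : \bar R := (`|c (k + j)%N z - c (k + j).+1 z|)%:E.
have bd k : bounded_mfun (fun z => `|c (k + j)%N z - c (k + j).+1 z|).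
  by apply: bmf_norm; apply: bmfB; exact: bmf_graphon.
have bcj : bounded_mfun (fun z => `|c j z - h z|).
  by apply: bmf_norm; apply: bmfB; [exact: bmf_graphon|exact: (bmf_graphon (Graphon mh hC h01))].
have d0 k z : (0 <= d k z)%E by rewrite lee_fin.
have dom z : unit_square z -> ((`|c j z - h z|)%:E <= \sum_(k <oo) d k z)%E.
  move=> Qz; case E : (\sum_(k <oo) d k z)%E => [s| |]; last 2 first.
  - exact: leey.
  - have : (0 <= \sum_(k <oo) d k z)%E by apply: nneseries_ge0 => k _ _; exact: d0.
    by rewrite E.
  have part n : \sum_(0 <= k < n) `|c (k + j)%N z - c (k + j).+1 z| <= s.
    have := @nneseries_lim_ge R (fun k => d k z) xpredT 0%N n.
    by rewrite E /d sumEFin lee_fin; apply => k _ _; exact: d0.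
  have close n : `|c j z - c (n + j)%N z| <= s.
    apply: le_trans (part n).
    elim: n => [|n IH]; first by rewrite add0n subrr normr0 big_geq.
    rewrite big_nat_recr//=.
    have -> : c j z - c (n.+1 + j)%N z =
       (c j z - c (n + j)%N z) + (c (n + j)%N z - c (n + j).+1 z).
      by rewrite addrA subrK.
    by apply: le_trans (ler_normD _ _) _; rewrite lerD2r.
  have := @limn_sup_itv (fun k => c k z) j (c j z - s) (c j z + s) (u1 z Qz).
  rewrite lee_fin -/(h z) ler_norml => H.
  have /andP[? ?] : c j z - s <= h z <= c j z + s.
    apply: H => k jk; have := close (k - j)%N; rewrite subnK// ler_norml.
    by move=> /andP[? ?]; apply/andP; split; lra.
  by apply/andP; split; lra.
rewrite -lee_fin /Rintegral fineK; last first.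
  by apply: integrable_fin_num => //; exact: (bmf_integrable bcj).
apply: (@le_trans _ _ (\int[mu2]_(z in unit_square) \sum_(k <oo) d k z)%E).
  apply: ge0_le_integral => //.
  - by apply/measurable_EFinP; exact: bcj.1.
  - apply: ge0_emeasurable_sum => //.
    by move=> k _; apply/measurable_EFinP; exact: (bd k).1.
rewrite integral_nneseries//; last first.
  by move=> k; apply/measurable_EFinP; exact: (bd k).1.
apply: le_trans (epsilon_trick0 xpredT (_ : 0 <= (2 ^+ j)^-1)); last first.
  by rewrite invr_ge0 exprn_ge0.
apply: lee_nneseries => [k _ _|k _].
  by apply: integral_ge0 => z _; exact: d0.
have := cc (k + j)%N; rewrite -lee_fin /Rintegral fineK.
  move=> /le_trans; apply; rewrite lee_fin natrX -invfM -exprD.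
  by rewrite addnS addnC.
by apply: integrable_fin_num => //; exact: (bmf_integrable (bd k)).
Qed.

(** The square of the L2 norm. *)
Definition energy (c : graphon R) : R := \int[mu2]_(z in unit_square) (c z * c z).

Let bg c := bmf_graphon c.
Let bsq c : bounded_mfun (fun z => c z * c z) := bmfM (bg c) (bg c).

Lemma energy_itv c : 0 <= energy c <= 1.
Proof.
have sq z : unit_square z -> 0 <= c z * c z <= 1.
  move=> /(gfun_range c)/andP[c0 c1]; rewrite mulr_ge0//=; nra.
apply/andP; split; first by apply: Rintegral_ge0 => z /sq/andP[].
rewrite -[leRHS]int_square_cst; apply: bmf_int_le => //; first exact: bmf_cst.
by move=> z /sq/andP[].
Qed.

Fact midpoint_meas c f : measurable_fun unit_square (fun z => 2^-1 * (c z + f z)).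
Proof. by have [] := bmfZ 2^-1 (bmfD (bg c) (bg f)). Qed.

Fact midpoint_sym c f x y : unit_itv x -> unit_itv y ->
  2^-1 * (c (x, y) + f (x, y)) = 2^-1 * (c (y, x) + f (y, x)).
Proof. by move=> Ix Iy; rewrite (gfun_sym c)// (gfun_sym f). Qed.

Fact midpoint_range c f z : unit_square z -> 0 <= 2^-1 * (c z + f z) <= 1.
Proof.
move=> Qz; have /andP[? ?] := gfun_range c Qz; have /andP[? ?] := gfun_range f Qz.
by apply/andP; split; lra.
Qed.

Definition midpoint c f : graphon R :=
  Graphon (midpoint_meas c f) (midpoint_sym c f) (@midpoint_range c f).

Lemma cutdist_midpoint c f g (r : R) : cutdist c g <= r -> cutdist f g <= r ->
  cutdist (midpoint c f) g <= r.
Proof.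
move=> cg fg; apply: cutdist_leP => S A mS mA SI AI.
have mB : measurable (S `*` A) by exact: measurableX.
have BQ := sub_rect SI AI.
have := le_trans (cutset_le c g mS mA SI AI) cg.
have := le_trans (cutset_le f g mS mA SI AI) fg.
rewrite !bmf_intB// (bmf_intZ 2^-1 (bmfD (bg c) (bg f)) mB BQ).
rewrite bmf_intD// !ler_norml => /andP[? ?] /andP[? ?].
by apply/andP; split; lra.
Qed.

Lemma parallelogram c f :
  \int[mu2]_(z in unit_square) ((c z - f z) * (c z - f z)) =
  2 * energy c + 2 * energy f - 4 * energy (midpoint c f).
Proof.
rewrite /energy -!bmf_intZ// -bmf_intD//; try exact: bmfZ.
rewrite -bmf_intB//; try (by apply: bmfZ).
  by apply: eq_Rintegral => z _ /=; field.
by apply: bmfD; apply: bmfZ.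
Qed.

(** The inequality between L1 and L2 norms, from [2 d |x| <= d^2 + x^2]. *)
Lemma int_norm_le_sq c f (d : R) : 0 < d ->
  \int[mu2]_(z in unit_square) ((c z - f z) * (c z - f z)) <= d ^+ 2 ->
  \int[mu2]_(z in unit_square) `|c z - f z| <= d.
Proof.
move=> d0 H; have bcf := bmfB (bg c) (bg f).
apply: (@le_trans _ _ (\int[mu2]_(z in unit_square)
   (d / 2 + (2 * d)^-1 * ((c z - f z) * (c z - f z))))).
  have bc2 := bmf_cst (d / 2 : R).
  have bb := bmfZ (2 * d)^-1 (bmfM bcf bcf).
  apply: bmf_int_le => //; [exact: bmf_norm|exact: bmfD bc2 bb|].
  move=> z _; set x := c z - f z.
  rewrite -(@ler_pM2l _ (2 * d)) ?mulr_gt0// mulrDr mulVKf ?gt_eqF ?mulr_gt0//.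
  have -> : x * x = `|x| * `|x| by rewrite -!expr2 real_normK ?num_real.
  have := sqr_ge0 (`|x| - d); nra.
have bc2 := bmf_cst (d / 2 : R).
have bb := bmfZ (2 * d)^-1 (bmfM bcf bcf).
rewrite (bmf_intD bc2 bb)// int_square_cst bmf_intZ//; last exact: bmfM.
have : (2 * d)^-1 * \int[mu2]_(z in unit_square) ((c z - f z) * (c z - f z)) <= (2 * d)^-1 * d ^+ 2.
  by rewrite ler_pM2l ?invr_gt0 ?mulr_gt0.
have -> : (2 * d)^-1 * d ^+ 2 = d / 2 by field; rewrite gt_eqF.
lra.
Qed.

(** The sets [D j] of graphons within [2 / 2^i] of [g i] for all [i <= j] are convex
    and decrease.  Let [m j] be the infimum of the energy on [D j]; it increases
    to a limit [M].  Elements of almost minimal energy of [D j], for [m j] close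
    to [M], are close in L2 by the parallelogram identity, since their midpoint
    has energy almost [M] too.  Their L1 limit is the required graphon. *)
Lemma cutdist_complete (g : nat -> graphon R) :
  (forall j, cutdist (g j.+1) (g j) <= (2 ^+ j)^-1) ->
  exists h, forall i, cutdist h (g i) <= 3 * (2 ^+ i)^-1.
Proof.
move=> gg.
pose D (j : nat) : set (graphon R) := [set c | forall i, (i <= j)%N -> cutdist c (g i) <= 2 * (2 ^+ i)^-1].
have pow0 j : 0 < (2 ^+ j)^-1 :> R by rewrite invr_gt0 exprn_gt0.
have powS j : (2 ^+ j)^-1 = 2 * (2 ^+ j.+1)^-1 :> R.
  by rewrite exprS invfM mulVKf.
have Dg j : D j (g j).
  move=> i ij; suff : cutdist (g j) (g i) <= 2 * (2 ^+ i)^-1 - 2 * (2 ^+ j)^-1.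
    by move=> /le_trans; apply; rewrite lerBlDr lerDl mulr_ge0// ltW.
  elim: j ij => [|j IH]; first by rewrite leqn0 => /eqP ->; rewrite subrr cutdist_eq0.
  rewrite leq_eqVlt => /predU1P[->|]; first by rewrite subrr cutdist_eq0.
  rewrite ltnS => /IH {}IH.
  apply: le_trans (cutdist_triangle (g j) _ _) _.
  have := gg j; have := powS j; lra.
have Dmono i j : (i <= j)%N -> D j `<=` D i.
  by move=> ij c Dc k ki; apply: Dc; exact: leq_trans ij.
have Dmid j c f : D j c -> D j f -> D j (midpoint c f).
  by move=> Dc Df i ij; apply: cutdist_midpoint; [exact: Dc|exact: Df].
pose E j := [set energy c | c in D j].
have E0 j : E j !=set0 by exists (energy (g j)), (g j).
have Elb j : has_lbound (E j) by exists 0 => _ [c _ <-]; have /andP[] := energy_itv c.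
pose m j := inf (E j).
have mle j c : D j c -> m j <= energy c by move=> Dc; apply: ge_inf => //; exists c.
have mmono i j : (i <= j)%N -> m i <= m j.
  move=> ij; apply: lb_le_inf => // _ [c Dc <-]; apply: mle; exact: Dmono Dc.
have hsm : has_sup (range m).
  split; first by exists (m 0%N), 0%N.
  exists 1 => _ [j _ <-]; apply: le_trans (mle j (g j) (Dg j)) _.
  by have /andP[] := energy_itv (g j).
pose M := sup (range m).
have mM j : m j <= M by apply: ub_le_sup; [exact: hsm.2|exists j].
(* The parallelogram identity bounds the squared L2 distance of [c k] and [c k.+1]
   by [8 eta k]. *)
pose eta k : R := ((2 ^+ k.+1)^-1) ^+ 2 / 8.
have eta0 k : 0 < eta k by rewrite divr_gt0 ?exprn_gt0.
have etaS k : eta k.+1 <= eta k.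
  by rewrite /eta; have := powS k.+1; have := pow0 k.+2; move: (2 ^+ k.+1)^-1 (2 ^+ k.+2)^-1 => x y ? ->; nra.
have /choice[cN HcN] : forall k, exists cN : graphon R * nat,
    [/\ (k <= cN.2)%N, D cN.2 cN.1, M - eta k < m cN.2 & energy cN.1 <= M + eta k].
  move=> k; have [_ [J _ <-] HJ] := sup_adherent (eta0 k) hsm.
  have [_ [c Dc <-] Hc] := inf_adherent (eta0 k) (conj (E0 (maxn k J)) (Elb (maxn k J))).
  exists (c, maxn k J); split => //=; first exact: leq_maxl.
    by apply: lt_le_trans HJ _; apply: mmono; exact: leq_maxr.
  by apply: ltW; apply: lt_le_trans Hc _; rewrite lerD2r; exact: mM.
pose c k := (cN k).1.
have cc k : \int[mu2]_(z in unit_square) `|c k z - c k.+1 z| <= (2 ^+ k.+1)^-1.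
  apply: int_norm_le_sq => //; rewrite parallelogram.
  have [_ D1 m1 e1] := HcN k; have [_ D2 m2 e2] := HcN k.+1.
  have es := etaS k.
  have mid : M - eta k <= energy (midpoint (c k) (c k.+1)).
    have [le12|le21] := leqP (cN k).2 (cN k.+1).2.
      by apply: le_trans (ltW m1) (mle _ _ (Dmid _ _ _ D1 (Dmono _ _ le12 _ D2))).
    apply: le_trans (mle _ _ (Dmid _ _ _ (Dmono _ _ (ltnW le21) _ D1) D2)).
    by apply: ltW; apply: le_lt_trans m2; rewrite lerD2l lerN2.
  have -> : ((2 ^+ k.+1)^-1) ^+ 2 = 8 * eta k :> R by rewrite /eta mulrC divfK.
  rewrite -/(c k) in e1; rewrite -/(c k.+1) in e2; lra.
have [h Hh] := graphon_l1_limit cc; exists h => i.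
apply: le_trans (cutdist_triangle (c i) _ _) _.
have [iN Di _ _] := HcN i.
have h1 : cutdist h (c i) <= (2 ^+ i)^-1.
  by rewrite cutdistC; apply: le_trans (cutdist_le_int _ _) (Hh i).
have h2 : cutdist (c i) (g i) <= 2 * (2 ^+ i)^-1 by exact: Di.
lra.
Qed.

(** Composing the rearrangements that nearly realize the successive distances turns
    the sequence into a Cauchy sequence for [cutdist]. *)
Lemma deltacut_complete (f : nat -> graphon R) :
  (forall j, deltacut (f j.+1) (f j) < (2 ^+ j)^-1) ->
  exists h, forall i, deltacut h (f i) <= 3 * (2 ^+ i)^-1.
Proof.
move=> ff.
have /choice[s Hs] : forall j, exists s : mpbij R,
    cutdist (gact (f j.+1) s) (f j) < (2 ^+ j)^-1.
  move=> j; have := ff j; rewrite deltacutC => /deltacut_ltP[s hs].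
  by exists s; rewrite cutdistC.
pose t := fix t j := if j is i.+1 then mpb_comp (s i) (t i) else mpb_id : mpbij R.
have [h Hh] : exists h, forall i, cutdist h (gact (f i) (t i)) <= 3 * (2 ^+ i)^-1.
  apply: cutdist_complete => j.
  have -> : cutdist (gact (f j.+1) (t j.+1)) (gact (f j) (t j)) =
      cutdist (gact (f j.+1) (s j)) (f j).
    by rewrite -(cutdist_gact (gact (f j.+1) (s j)) (f j) (t j)).
  exact: ltW.
exists h => i; exact: le_trans (deltacut_le _ _ (t i)) (Hh i).
Qed.

End completeness.

(** * Exponentially unlikely sets *)

Section gibbs_measure.
Context {R : realType} (T : wgraphon R -> R).
Implicit Types (X Y : set (wgraphon R)) (h : wgraphon R).

(** The set [X] is a set of classes of graphons, of which only the classes of graphs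
    on [n] vertices count. *)
Definition gibbs_sum (n : nat) X : R :=
  \sum_(g : sgraph n | `[< X (wgraph g) >]) expR (n%:R ^+ 2 * T (wgraph g)).

Definition gibbs_prob (n : nat) X : R := gibbs_sum n X / gibbs_sum n setT.

Lemma gibbs_sumTE n : gibbs_sum n setT = \sum_(g : sgraph n) expR (n%:R ^+ 2 * T (wgraph g)).
Proof. by apply: eq_bigl => g; exact/asboolP. Qed.

Lemma gibbs_sumT_gt0 n : 0 < gibbs_sum n setT.
Proof.
rewrite gibbs_sumTE (bigD1 (empty_sgraph n))//= ltr_pwDl ?expR_gt0//.
by apply: sumr_ge0 => g _; exact: expR_ge0.
Qed.

Lemma gibbs_sum_mono n X Y : (forall g : sgraph n, X (wgraph g) -> Y (wgraph g)) ->
  gibbs_sum n X <= gibbs_sum n Y.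
Proof.
move=> XY; rewrite /gibbs_sum big_mkcond [leRHS]big_mkcond; apply: ler_sum => g _.
case: asboolP => [/XY Yg|_]; first by rewrite asboolT.
by case: ifP => // _; exact: expR_ge0.
Qed.

Lemma gibbs_prob_le1 n X : gibbs_prob n X <= 1.
Proof.
by rewrite /gibbs_prob ler_pdivrMr ?gibbs_sumT_gt0// mul1r; exact: gibbs_sum_mono.
Qed.

Lemma gibbs_weightE n (g : sgraph n.+1) :
  expR (n.+1%:R ^+ 2 * (T (wgraph g) - psi T n.+1)) =
  expR (n.+1%:R ^+ 2 * T (wgraph g)) / gibbs_sum n.+1 setT.
Proof.
rewrite mulrBr expRD; congr (_ * _).
rewrite /psi mulVKf ?expf_neq0// -gibbs_sumTE expRN lnK//.
by rewrite posrE; exact: gibbs_sumT_gt0.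
Qed.

Lemma measure_gibbs_le d (Om : measurableType d) (P : probability Om R) n
  (G : {RV P >-> sgraph n.+1}) X :
  (forall g, P [set w | G w = g] = (expR (n.+1%:R ^+ 2 * (T (wgraph g) - psi T n.+1)))%:E) ->
  (P [set w | X (wgraph (G w))] <= (gibbs_prob n.+1 X)%:E)%E.
Proof.
move=> law; pose F g := [set w | G w = g].
have mF g : measurable (F g).
  rewrite -[X in measurable X]setTI.
  have mg : measurable [set g] by [].
  exact: (@measurable_funPT _ _ _ _ G measurableT _ mg).
have -> : [set w | X (wgraph (G w))] =
    \big[setU/set0]_(g : sgraph n.+1 | `[< X (wgraph g) >]) F g.
  apply/seteqP; split => [w /= Xw|].
    by rewrite (bigD1 (G w))/=; [left|exact/asboolP].
  apply: (big_ind (fun S => S `<=` [set w | X (wgraph (G w))])) => //.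
    by move=> S S' H H' w [/H|/H'].
  by move=> g /asboolP Xg w /= ->.
have -> : gibbs_prob n.+1 X = \sum_(g : sgraph n.+1 | `[< X (wgraph g) >])
    expR (n.+1%:R ^+ 2 * (T (wgraph g) - psi T n.+1)).
  by rewrite /gibbs_prob /gibbs_sum mulr_suml; apply: eq_bigr => g _; rewrite gibbs_weightE.
rewrite -sumEFin.
suff [] : measurable (\big[setU/set0]_(g : sgraph n.+1 | `[< X (wgraph g) >]) F g) /\
  (P (\big[setU/set0]_(g : sgraph n.+1 | `[< X (wgraph g) >]) F g) <=
   \sum_(g : sgraph n.+1 | `[< X (wgraph g) >])
     (expR (n.+1%:R ^+ 2 * (T (wgraph g) - psi T n.+1)))%:E)%E by [].
apply: (big_ind2 (fun S r => measurable S /\ (P S <= r)%E)).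
- by split; [exact: measurable0|rewrite measure0].
- move=> S r S' r' [mS Sr] [mS' Sr']; split; first exact: measurableU.
  by apply: le_trans (measureU2 _ mS mS') _; exact: leeD.
- by move=> g _; split; [exact: mF|rewrite law].
Qed.

Definition exp_small X : Prop := exists C gamma : R, [/\ 0 < C, 0 < gamma &
  forall n, gibbs_prob n.+1 X <= C * expR (- (n.+1%:R ^+ 2 * gamma))].

Lemma exp_small_mono X Y : (forall n (g : sgraph n.+1), X (wgraph g) -> Y (wgraph g)) ->
  exp_small Y -> exp_small X.
Proof.
move=> XY [C [gam [C0 g0 H]]]; exists C, gam; split => // n.
apply: le_trans (H n); rewrite /gibbs_prob ler_pM2r ?invr_gt0 ?gibbs_sumT_gt0//.
exact: (gibbs_sum_mono (XY n)).
Qed.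

Lemma finite_lower_bound (I : eqType) (s : seq I) (gam : I -> R) :
  (forall i, 0 < gam i) -> exists2 d : R, 0 < d & forall i, i \in s -> d <= gam i.
Proof.
move=> g0; elim: s => [|i s [d d0 H]]; first by exists 1.
exists (Num.min d (gam i)); first by rewrite lt_min d0 g0.
move=> j; rewrite inE ge_min => /predU1P[->|/H ->//].
by rewrite lexx orbT.
Qed.

Lemma exp_small_cover (I : finType) (Y : I -> set (wgraphon R)) X :
  (forall i, exp_small (Y i)) ->
  (forall n (g : sgraph n.+1), X (wgraph g) -> exists i, Y i (wgraph g)) ->
  exp_small X.
Proof.
move=> /choice[C /choice[gam H]] XY.
have [d d0 dg] := @finite_lower_bound I (enum I) gam (fun i => let: And3 _ g0 _ := H i in g0).
have C0 i : 0 < C i by have [] := H i.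
exists (1 + \sum_i C i), d; split => //.
  by rewrite ltr_pwDl// sumr_ge0// => i _; exact: ltW.
move=> n; apply: (@le_trans _ _ (\sum_i gibbs_prob n.+1 (Y i))).
  rewrite /gibbs_prob -mulr_suml ler_pM2r ?invr_gt0 ?gibbs_sumT_gt0//.
  rewrite /gibbs_sum big_mkcond/=.
  under [leRHS]eq_bigr do rewrite big_mkcond.
  rewrite exchange_big/=; apply: ler_sum => g _.
  have p0 (b : bool) : 0 <= (if b then expR (n.+1%:R ^+ 2 * T (wgraph g)) else 0).
    by case: b => //; exact: expR_ge0.
  case: asboolP => [/XY[i Yi]|_]; last by apply: sumr_ge0.
  by rewrite (bigD1 i)//= asboolT// lerDl sumr_ge0.
rewrite mulrDl mul1r mulr_suml -[leLHS]add0r; apply: lerD; first exact: expR_ge0.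
apply: ler_sum => i _; have [_ _ Hi] := H i.
apply: le_trans (Hi n) _; rewrite ler_pM2l// ler_expR lerN2 ler_wpM2l ?sqr_ge0//.
by apply: dg; rewrite mem_enum.
Qed.

Lemma mdist_wgraph n (g : sgraph n) h :
  mdist h (wgraph g) = deltacut (graph_graphon g) (wrepr h).
Proof. by rewrite -[in LHS](wreprK h) /wgraph mdist_wclass deltacutC. Qed.

Lemma continuous_mdist (h : wgraphon R) (e : R) : continuous T -> 0 < e ->
  exists2 r : R, 0 < r & forall k, mdist h k < r -> `|T h - T k| < e.
Proof.
move=> cT e0; have := cT h _ (nbhsx_ballx (T h) e e0) => /nbhs_ballP[r /= r0 H].
exists r => // k hk; have /H : ball h r k by rewrite ballEmdist.
Qed.

(** Compares the upper count near [h] with the lower count near some [h'] at which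
    [T - rate] is larger; continuity of [T] makes [exp (n^2 T)] almost constant
    near both. *)
Lemma exp_small_near_nonmaximizer h : continuous T -> ~ maximizers T h ->
  exists2 r : R, 0 < r & exp_small [set k | mdist h k < r].
Proof.
move=> cT /existsNP[h' /negP]; rewrite -ltNge => hh'.
pose gap := (T h' - rate h') - (T h - rate h).
have gap0 : 0 < gap by rewrite subr_gt0.
pose e := gap / 8; have e0 : 0 < e by rewrite divr_gt0.
have [r1 r10 H1] := continuous_mdist h cT e0.
have [r2 r20 H2] := continuous_mdist h' cT e0.
have [r3 r30 [n3 H3]] := graphs_near_le (wrepr h) e0.
have [n4 H4] := graphs_near_ge (wrepr h') r20 e0.
exists (Num.min r1 r3); first by rewrite lt_min r10.
set X := [set k | _].
pose n0 := maxn n3 n4.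
have big n : (n0 <= n)%N -> gibbs_prob n.+1 X <= expR (- (n.+1%:R ^+ 2 * e)).
  rewrite geq_max => /andP[/H3 {}H3 /H4 {}H4]; set N := n.+1%:R ^+ 2 in H3 H4 *.
  have N0 : 0 <= N by exact: sqr_ge0.
  have up : gibbs_sum n.+1 X <= expR (N * (- rate h + e)) * expR (N * (T h + e)).
    apply: (@le_trans _ _ (\sum_(g in [set G : sgraph n.+1 |
        deltacut (graph_graphon G) (wrepr h) < r3]%SET) expR (N * (T h + e)))).
      rewrite /gibbs_sum big_mkcond [leRHS]big_mkcond; apply: ler_sum => g _.
      case: asboolP => [|_]; last by case: ifP => // _; exact: expR_ge0.
      rewrite /X/= lt_min => /andP[/H1 d1]; rewrite mdist_wgraph => d3.
      rewrite inE d3 ler_expR ler_wpM2l//.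
      by move: d1; rewrite ltr_norml => /andP[? ?]; lra.
    rewrite sumr_const -[_ *+ _]mulr_natl ler_pM2r ?expR_gt0//.
  have lo : expR (N * (- rate h' - e)) * expR (N * (T h' - e)) <= gibbs_sum n.+1 setT.
    apply: (@le_trans _ _ (\sum_(g in [set G : sgraph n.+1 |
        cutdist (graph_graphon G) (wrepr h') < r2]%SET) expR (N * (T h' - e)))).
      rewrite sumr_const -[_ *+ _]mulr_natl ler_pM2r ?expR_gt0//.
    rewrite gibbs_sumTE big_mkcond; apply: ler_sum => g _.
    case: ifP => [|_]; last exact: expR_ge0.
    rewrite inE => gr; have /H2 d2 : mdist h' (wgraph g) < r2.
      by rewrite mdist_wgraph; apply: le_lt_trans gr; exact: deltacut_cutdist.
    by rewrite ler_expR ler_wpM2l//; move: d2; rewrite ltr_norml => /andP[? ?]; lra.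
  rewrite /gibbs_prob ler_pdivrMr ?gibbs_sumT_gt0//.
  apply: le_trans up _; apply: le_trans (ler_wpM2l (expR_ge0 _) lo).
  rewrite -!expRD ler_expR -!mulrDr -mulrN -mulrDr ler_wpM2l//.
  by have : gap = 8 * e; [rewrite /e; field|rewrite /gap; lra].
exists (expR (n0.+1%:R ^+ 2 * e)), e; split => //; first exact: expR_gt0.
move=> n; rewrite -expRD; have [nn|nn] := leqP n0 n.
  apply: le_trans (big n nn) _; rewrite ler_expR lerDr mulr_ge0 ?sqr_ge0//.
  exact: ltW.
apply: le_trans (gibbs_prob_le1 _ _) _; rewrite -[leLHS]expR0 ler_expR -mulrBl.
rewrite mulr_ge0 ?(ltW e0)// subr_ge0 ler_pXn2r ?nnegrE// ler_nat.
by rewrite ltnS ltnW.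
Qed.

Lemma exists_pow2_inv_lt (e : R) : 0 < e -> exists i : nat, (2 ^+ i)^-1 < e.
Proof.
move=> e0; have [i /(_ i (leqnn _)) Hi] := eventually_natr_ge e^-1; exists i.
rewrite invf_plt ?posrE ?exprn_gt0//; apply: le_lt_trans Hi _.
by rewrite -natrX ltr_nat; exact: ltn_expl.
Qed.

(** The compactness argument: [X j] is a decreasing sequence of sets that are not
    [exp_small], starting from [K], in which graphs are at most [2^-j] apart for
    positive [j]. *)
Lemma exp_small_closed_set (K : set (wgraphon R)) : continuous T ->
  (forall h, (forall e : R, 0 < e -> exists2 k, K k & mdist h k < e) -> K h) ->
  (forall h, K h -> ~ maximizers T h) -> exp_small K.
Proof.
move=> cT cK Kmax; apply: contrapT => badK.
pose small X (e : R) := forall n n' (g : sgraph n.+1) (g' : sgraph n'.+1),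
  X (wgraph g) -> X (wgraph g') -> deltacut (graph_graphon g : graphon R) (graph_graphon g') <= e.
have /choice[next nextP] : forall Xj : set (wgraphon R) * nat, exists Y : set (wgraphon R),
    ~ exp_small Xj.1 ->
    [/\ Y `<=` Xj.1, ~ exp_small Y & small Y (2 ^+ Xj.2.+1)^-1].
  move=> [X j]; have [nX|badX] := pselect (exp_small X); first by exists X.
  have p0 : 0 < (2 ^+ j.+1)^-1 :> R by rewrite invr_gt0 exprn_gt0.
  (* If all the pieces of [X] were [exp_small], their union would be so. *)
  have [I [cl Hcl]] := graphs_totally_bounded p0.
  pose Y (i : I) : set (wgraphon R) := [set h | X h /\ exists n (g : sgraph n.+1), h = wgraph g /\ cl n g = i].
  have [i badY] : exists i, ~ exp_small (Y i).
    apply: contrapT => /forallNP nY; apply: badX; apply: (@exp_small_cover I Y).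
      by move=> i; exact: (contrapT (nY i)).
    by move=> n g Xg; exists (cl n g); split => //; exists n, g.
  exists (Y i) => _; split => //= [h []//|n n' g g'].
  move=> [_ [a [ga [/wclass_eq E ci]]]] [_ [a' [ga' [/wclass_eq E' ci']]]].
  apply: le_trans (deltacut_triangle (graph_graphon ga) _ _) _.
  rewrite E add0r; apply: le_trans (deltacut_triangle (graph_graphon ga') _ _) _.
  rewrite [deltacut (graph_graphon ga') _]deltacutC E' addr0.
  by apply: Hcl; rewrite ci ci'.
pose X := fix X j := if j is i.+1 then next (X i, i) else K.
have badX j : ~ exp_small (X j).
  by elim: j => [|j IH] //=; have [] := nextP (X j, j) IH.
have subX j : X j.+1 `<=` X j by have [] := nextP (X j, j) (badX j).
have smallX j : small (X j.+1) (2 ^+ j.+1)^-1 by have [] := nextP (X j, j) (badX j).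
have subK j : X j `<=` K by elim: j => [//|j IH]; apply: subset_trans IH; exact: subX.
have /choice[ng Hng] : forall j, exists ng : {n & sgraph n.+1}, X j.+1 (wgraph (projT2 ng)).
  move=> j; apply: contrapT => /forallNP nX; apply: (badX j.+1).
  exists 1, 1; split => // n; rewrite mul1r /gibbs_prob /gibbs_sum big_pred0 ?mul0r ?expR_ge0//.
  by move=> g; apply/asboolP => Xg; exact: (nX (existT _ n g)).
pose f j : graphon R := graph_graphon (projT2 (ng j)).
have [u Hu] : exists u : graphon R, forall i, deltacut u (f i) <= 3 * (2 ^+ i)^-1.
  apply: deltacut_complete => j.
  apply: le_lt_trans (smallX j _ _ _ _ (subX _ _ (Hng j.+1)) (Hng j)) _.
  by rewrite ltf_pV2 ?posrE ?exprn_gt0// exprS ltr_pMl ?exprn_gt0// ltr1n.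
have Kh : K (wclass u).
  apply: cK => e e0; have e30 : 0 < e / 3 by rewrite divr_gt0.
  have [i Hi] := exists_pow2_inv_lt e30.
  exists (wgraph (projT2 (ng i))); first exact: (subK i.+1).
  by rewrite mdist_wclass; apply: le_lt_trans (Hu i) _; lra.
have [r r0 nr] := exp_small_near_nonmaximizer cT (Kmax _ Kh).
have r40 : 0 < r / 4 by rewrite divr_gt0.
have [i Hi] := exists_pow2_inv_lt r40.
apply: (badX i.+1); apply: exp_small_mono nr => n g Xg /=.
rewrite mdist_wclass; apply: le_lt_trans (deltacut_triangle (f i) _ _) _.
have := Hu i; have := smallX i _ _ _ _ (Hng i) Xg.
have : (2 ^+ i.+1)^-1 <= (2 ^+ i)^-1 :> R.
  by rewrite lef_pV2 ?posrE ?exprn_gt0// exprS ler_pMl ?exprn_gt0// ler1n.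
rewrite -/(f i); lra.
Qed.

End gibbs_measure.

Unset Implicit Arguments.
Set Strict Implicit.
Set Printing Implicit Defensive.

Theorem theorem3p2 (R : realType) (T : wgraphon R -> R)
  (T_bounded : exists M : R, forall h : wgraphon R, `|T h| <= M)
  (T_continuous : continuous T)
  (d : nat -> measure_display) (Omega : forall n : nat, measurableType (d n))
  (P : forall n : nat, probability (Omega n) R)
  (G : forall n : nat, {RV (P n) >-> sgraph n})
  (G_law : forall n : nat, (0 < n)%N -> forall g : sgraph n,
     P n [set w | G n w = g] = (expR (n%:R ^+ 2 * (T (wgraph g) - psi T n)))%:E)
  (eta : R) (eta_gt0 : 0 < eta) :
  exists C gamma : R, [/\ 0 < C, 0 < gamma &
    forall n : nat, (0 < n)%N ->
      (P n [set w | eta%:E < mdist_set (wgraph (G n w)) (maximizers T)]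
        <= (C * expR (- (n%:R ^+ 2 * gamma)))%:E)%E].
Proof.
pose K : set (wgraphon R) := [set h | forall f, maximizers T f -> eta <= mdist h f].
have [C [gam [C0 g0 H]]] : exp_small T K.
  apply: exp_small_closed_set => // h.
    move=> hK f mf; apply/ler_addgt0Pl => e e0; have [k Kk hk] := hK e e0.
    apply: le_trans (Kk f mf) _; apply: le_trans (metric_triangle k h f) _.
    by rewrite [mdist k h]metric_sym; lra.
  by move=> Kh mh; have := Kh h mh; rewrite mdistxx leNgt eta_gt0.
exists C, gam; split => // -[//|n] _.
pose X : set (wgraphon R) := [set h | (eta%:E < mdist_set h (maximizers T))%E].
apply: (@le_trans _ _ (gibbs_prob T n.+1 X)%:E).
  by apply: (@measure_gibbs_le _ _ _ _ _ _ (G n.+1) X) => g; exact: G_law.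
rewrite lee_fin; apply: le_trans (H n).
rewrite /gibbs_prob ler_pM2r ?invr_gt0 ?gibbs_sumT_gt0//.
apply: gibbs_sum_mono => g; rewrite /X /K/= => eg f mf.
rewrite -lee_fin ltW//; apply: lt_le_trans eg _.
by apply: ereal_inf_lbound; exists f.
Qed.
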